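(* The relation $\sim_{al}$ is an equivalence relation in $\Sigma_D$, where for $A,A'\in\Sigma_D$ one writes $A\sim_{al}A'$ if there exists a finite sequence of algebraic moves $A=A_1\to A_2\to\cdots\to A_k=A'$ (each of type $\Omega_\beta,\Omega_{iso},\Omega_1^+,\Omega_1^-,\Omega_2^+,\Omega_2^-$ or $\Omega_3$) through elements of $\Sigma_D$, starting with $A$ and ending with $A'$.
   Context: Diagrams and based symbols. Work throughout in the smooth or throughout in the piecewise linear (pl) category. $\rho\subset\mathbb{R}^3$ is a fixed oriented plane, viewed from a fixed side. A diagram $K$ is an oriented parametrized smooth/pl closed curve on $\rho$ with finitely many self-intersections (possibly none), called crossings, all transverse double points, each equipped with over/under information; $\tau(K)$ is the number of crossings. A base point of $K$ is a point of $K$ other than a crossing. $\mathbb{N}_0=\emptyset$ and, for $n>0$, $\mathbb{N}_{2n}=\{1,\dots,2n\}$ with addition modulo $2n$. Let $p$ be a base point of $K$. If $\tau(K)=0$, put ${}_pK=\emptyset$. If $\tau(K)=n>0$, travel once around $K$ from $p$ along its orientation and number the successive passages through crossings $1,\dots,2n$; each crossing gets two labels and is written $\Delta=(i,j)^{\pi}$, where $i$ is the label received on the over-strand, $j$ the label received on the under-strand, and the sign $\pi$ is $+1$ (resp. $-1$) if at $\Delta$ one turns counterclockwise (resp. clockwise) from the direction of the over-strand to the direction of the under-strand. The based symbol ${}_pK$ is the set of these $n$ crossings. $\Sigma_D$ is the set of all based symbols of all diagrams. A numbered symbol is $\emptyset$ or a set of $n\ge 1$ signed ordered pairs $(i,j)^\pi$,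 $\pi=\pm1$, called crossings, whose $2n$ entries form exactly $\mathbb{N}_{2n}$; $\Sigma\supseteq\Sigma_D$ is the set of all numbered symbols and the order $\tau(A)$ is the number of crossings of $A$. In $(i,j)^\pi$ the heights are $v_i=+1$, $v_j=-1$; $(i:j)^\pi$ denotes either of $(i,j)^\pi,(j,i)^\pi$. Arcs, cycles, $i$-gons of $A\in\Sigma_D$ with $\tau(A)=n>0$. Basic arcs are formal symbols $e_i=\overrightarrow{i(i+1)}$, $i\in\mathbb{N}_{2n}$ (first endpoint $i$, last endpoint $i+1$); $-e_i$ has first endpoint $i+1$ and last endpoint $i$; main arcs are all $\pm e_i$, with signs $\pi_{e_i}=1$, $\pi_{-e_i}=-1$. Orientations are two letters $\alpha,\delta$ with $\pi_\alpha=1$, $\pi_\delta=-1$. For a main arc $f$ with last endpoint $x$, let $\Delta=(x:y)^{\pi_\Delta}$ be the crossing containing $x$; the $\phi$-turn $\phi(f)$ is the main arc with first endpoint $y$ equal to $e_y$ if $-\pi_\phi\pi_f\pi_\Delta v_y=+1$ and to $-e_{y-1}$ if it equals $-1$. The $\phi$-cycle of $f$ is the cyclic sequence $f,\phi(f),\phi(\phi(f)),\dots$. A 1-gon is a basic arc $e_a$ with $(a:a+1)$ a crossing of $A$. A 2-gon is a pair of distinct basic arcs $e_z,e_w$, neither a 1-gon, such that $(z:w),(z+1:w+1)$ or $(z:w+1),(z+1:w)$ are crossings of $A$ and $z,z+1$ have equal heights. A 3-gon is a triple of distinct basic arcs with endpoint sets $\{a_1,a_2\},\{b_1,b_2\},\{c_1,c_2\}$,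 none a 1-gon and no two a 2-gon, such that $(a_1:b_1),(a_2:c_1),(b_2:c_2)$ are crossings of $A$, both labels of one arc have height $+1$ and both labels of another have height $-1$. Algebraic moves on $A\in\Sigma_D$, $\tau(A)=n$ (result a priori in $\Sigma$): $\Omega_\beta$: replace every label $x$ by $x+c$ mod $2n$ for a fixed $c$ (for $A=\emptyset$: $\emptyset\to\emptyset$). $\Omega_{iso}$: $A\to A$. $\Omega_1^+$: for $n>0$ choose $a\in\mathbb{N}_{2n}$, replace each label $x>a$ by $x+2$ and adjoin $(a+1,a+2)^{\epsilon}$ or $(a+2,a+1)^{\epsilon}$, $\epsilon=\pm1$; if $a=2n$ one may additionally add $s\in\{0,1,2\}$ to all labels mod $2n+2$. For $n=0$: $\emptyset\to\{(1,2)^\epsilon\}$ or $\{(2,1)^\epsilon\}$. $\Omega_1^-$: delete the crossing of a 1-gon and relabel the remaining labels by the order-preserving bijection onto $\mathbb{N}_{2(n-1)}$. $\Omega_2^+$: for $n>0$ choose $a\le b$ in $\mathbb{N}_{2n}$, an orientation $\phi$ and $\varrho\in\{\pm1\}$ such that $e_a$ and $\varrho e_b$ lie in a common $\phi$-cycle of $A$, and $\theta\in\{\pm1\}$; replace labels $x$ with $a<x\le b$ by $x+2$ and $x>b$ by $x+4$; adjoin, if $\theta=1$, $(a+1,\,b+\tfrac{7+\varrho}{2})^{\pi_\phi\varrho}$ and $(a+2,\,b+\tfrac{7-\varrho}{2})^{-\pi_\phi\varrho}$, and if $\theta=-1$, $(b+\tfrac{7+\varrho}{2},\,a+1)^{-\pi_\phi\varrho}$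 and $(b+\tfrac{7-\varrho}{2},\,a+2)^{\pi_\phi\varrho}$; if $b=2n$ one may additionally add $s$ to all labels mod $2n+4$, with $s\in\{0,1,2\}$ if $a<2n$ and $s\in\{0,2,4\}$ if $a=2n$. For $n=0$: $\emptyset\to\{(1,4)^\epsilon,(2,3)^{-\epsilon}\}$ or $\{(4,1)^\epsilon,(3,2)^{-\epsilon}\}$. $\Omega_2^-$: delete the two crossings, of opposite signs, of a 2-gon and relabel the remaining labels by the order-preserving bijection onto $\mathbb{N}_{2(n-2)}$. $\Omega_3$: on a 3-gon of $A$ whose arcs have endpoint sets $\{a_1,a_2\},\{b_1,b_2\},\{c_1,c_2\}$ and whose three crossings are $(a_1:b_1),(a_2:c_1),(b_2:c_2)$, in these three crossings replace each label by its companion ($a_1\leftrightarrow a_2$, $b_1\leftrightarrow b_2$, $c_1\leftrightarrow c_2$), keeping positions in the ordered pairs and signs; other crossings are unchanged. *)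

(* Defs.v *)
From HB Require Import structures.
From mathcomp Require Import all_boot all_order all_algebra finmap.
From mathcomp Require Import all_classical all_reals all_analysis.
From Corelib Require Export RelationClasses.

Set Implicit Arguments.
Unset Strict Implicit.
Unset Printing Implicit Defensive.

Import Order.TTheory GRing.Theory Num.Theory.
Import numFieldNormedType.Exports.

Local Open Scope fset_scope.
Local Open Scope nat_scope.

(* The signed pair (i, j)^e is the triple (i, j, e); labels are natural
   numbers 1, ..., 2n and signs are the integers 1 and -1. *)
Definition crossing : Type := (nat * nat * int)%type.

Definition over (c : crossing) : nat := c.1.1.
Definition under (c : crossing) : nat := c.1.2.
Definition sign (c : crossing) : int := c.2.

Definition is_sign (e : int) : Prop := e = 1%R \/ e = (-1)%R.

(* Numbered symbols are the [A : symbol] satisfying [numbered] below. *)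
Definition symbol : Type := {fset nat * nat * int}.

Definition order (A : symbol) : nat := #|` A|.

Definition labels (A : symbol) : seq nat :=
  [seq over c | c <- enum_fset A] ++ [seq under c | c <- enum_fset A].

Definition numbered (A : symbol) : Prop :=
  (forall c, c \in A -> is_sign (sign c)) /\
  perm_eq (labels A) (iota 1 (order A).*2).

(* [c] is (x : y)^e for some e. *)
Definition links (c : crossing) (x y : nat) : bool :=
  ((over c == x) && (under c == y)) || ((over c == y) && (under c == x)).

(* The height v_x of a label x of A. *)
Definition height (A : symbol) (x : nat) : int :=
  if x \in [seq over c | c <- enum_fset A] then 1%R else (-1)%R.

Definition relabel (f : nat -> nat) (A : symbol) : symbol :=
  [fset (f (over c), f (under c), sign c) | c in A].

(* Addition of c modulo N, with representatives 1, ..., N. *)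
Definition shift (N c x : nat) : nat := (((x.-1 + c) %% N).+1)%N.

Definition next_label (A : symbol) (x : nat) : nat := shift (order A).*2 1 x.
Definition prev_label (A : symbol) (x : nat) : nat :=
  shift (order A).*2 (order A).*2.-1 x.

(* On the labels of B, x |-> #{y label of B | y <= x} is the order-preserving
   bijection onto {1, ..., 2 * order B}. *)
Definition compress (B : symbol) : symbol :=
  relabel (fun x => count (fun y => y <= x) (labels B)) B.

Inductive orientation : Type := alpha | delta.

Definition or_sign (phi : orientation) : int :=
  match phi with alpha => 1%R | delta => (-1)%R end.

(* The index i of a basic arc e_i is a label. *)
Definition basic_arc (A : symbol) (i : nat) : Prop := 1 <= i <= (order A).*2.

(* (i, 1) is e_i and (i, -1) is -e_i. *)
Definition main_arc : Type := (nat * int)%type.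

Definition is_main_arc (A : symbol) (f : main_arc) : Prop :=
  basic_arc A f.1 /\ is_sign f.2.

Definition last_end (A : symbol) (f : main_arc) : nat :=
  if f.2 == 1%R then next_label A f.1 else f.1.

Definition has_label (x : nat) (c : crossing) : bool :=
  (over c == x) || (under c == x).

(* The crossing of A containing the label x (the default value is irrelevant
   when A is a numbered symbol and x is one of its labels). *)
Definition crossing_at (A : symbol) (x : nat) : crossing :=
  head (0, 0, 0%R) [seq c <- enum_fset A | has_label x c].

Definition other_label (c : crossing) (x : nat) : nat :=
  if over c == x then under c else over c.

Definition turn (A : symbol) (phi : orientation) (f : main_arc) : main_arc :=
  let x := last_end A f in
  let c := crossing_at A x in
  let y := other_label c x in
  if (- (or_sign phi * f.2 * sign c * height A y) == 1)%R
  then (y, 1%R) else (prev_label A y, (-1)%R).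

Definition common_cycle (A : symbol) (phi : orientation) (g h : main_arc)
    : Prop :=
  exists f : main_arc, is_main_arc A f /\
    exists k l : nat, iter k (turn A phi) f = g /\ iter l (turn A phi) f = h.

Definition gon1 (A : symbol) (a : nat) : Prop :=
  basic_arc A a /\ exists c, c \in A /\ links c a (next_label A a).

(* The arcs e_z, e_w form a 2-gon with crossings c (on z) and d (on z+1). *)
Definition gon2_at (A : symbol) (z w : nat) (c d : crossing) : Prop :=
  [/\ basic_arc A z, basic_arc A w, z <> w, ~ gon1 A z & ~ gon1 A w] /\
  [/\ c \in A, d \in A,
      (links c z w /\ links d (next_label A z) (next_label A w)) \/
      (links c z (next_label A w) /\ links d (next_label A z) w) &
      height A z = height A (next_label A z)].

Definition gon2 (A : symbol) (z w : nat) : Prop :=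
  exists c d : crossing, gon2_at A z w c d.

(* {x1, x2} is the endpoint set of the basic arc e_i. *)
Definition endpoints (A : symbol) (i x1 x2 : nat) : Prop :=
  (x1 = i /\ x2 = next_label A i) \/ (x1 = next_label A i /\ x2 = i).

Definition both_heights (A : symbol) (v : int) (x1 x2 : nat) : Prop :=
  height A x1 = v /\ height A x2 = v.

Definition gon3_at (A : symbol) (a1 a2 b1 b2 c1 c2 : nat) : Prop :=
  (exists i j k : nat,
    [/\ basic_arc A i, basic_arc A j & basic_arc A k] /\
    [/\ i <> j, i <> k & j <> k] /\
    [/\ endpoints A i a1 a2, endpoints A j b1 b2 & endpoints A k c1 c2] /\
    [/\ ~ gon1 A i, ~ gon1 A j & ~ gon1 A k] /\
    [/\ ~ gon2 A i j, ~ gon2 A i k & ~ gon2 A j k]) /\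
  [/\ exists x, x \in A /\ links x a1 b1,
      exists y, y \in A /\ links y a2 c1 &
      exists z, z \in A /\ links z b2 c2] /\
  (forall v : int, is_sign v ->
     [\/ both_heights A v a1 a2, both_heights A v b1 b2
       | both_heights A v c1 c2]).

Definition Omega_beta (A A' : symbol) : Prop :=
  exists c : nat, A' = relabel (shift (order A).*2 c) A.

Definition Omega_iso (A A' : symbol) : Prop := A' = A.

Definition Omega1p (A A' : symbol) : Prop :=
  (A = fset0 /\ exists e : int, is_sign e /\
     (A' = [fset (1, 2, e)] \/ A' = [fset (2, 1, e)])) \/
  (A <> fset0 /\
   exists (a s : nat) (e : int) (x : crossing),
     [/\ 1 <= a <= (order A).*2, is_sign e,
         x = (a.+1, a.+2, e) \/ x = (a.+2, a.+1, e),
         (if a == (order A).*2 then s \in [:: 0; 1; 2] else s == 0) &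
         A' = relabel (shift ((order A).*2 + 2) s)
                (x |` relabel (fun y => if a < y then y + 2 else y) A)]).

Definition Omega1m (A A' : symbol) : Prop :=
  exists (a : nat) (c : crossing),
    [/\ basic_arc A a, c \in A, links c a (next_label A a) & A' = compress (A `\ c)].

(* (b + (7 + rho)/2, b + (7 - rho)/2) *)
Definition Omega2p_ends (b : nat) (rho : int) : nat * nat :=
  if rho == 1%R then (b + 4, b + 3) else (b + 3, b + 4).

Definition Omega2p_relabel (a b x : nat) : nat :=
  if x <= a then x else if x <= b then x + 2 else x + 4.

Definition Omega2p_new (a b : nat) (phi : orientation) (rho theta : int)
    : symbol :=
  let: (p, q) := Omega2p_ends b rho in
  let e : int := (or_sign phi * rho)%R in
  if theta == 1%R then [fset (a + 1, p, e); (a + 2, q, (- e)%R)]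
  else [fset (p, a + 1, (- e)%R); (q, a + 2, e)].

Definition Omega2p (A A' : symbol) : Prop :=
  (A = fset0 /\ exists e : int, is_sign e /\
     (A' = [fset (1, 4, e); (2, 3, (- e)%R)] \/
      A' = [fset (4, 1, e); (3, 2, (- e)%R)])) \/
  (A <> fset0 /\
   exists (a b s : nat) (phi : orientation) (rho theta : int),
     [/\ 1 <= a, a <= b, b <= (order A).*2, is_sign rho & is_sign theta] /\
     [/\ common_cycle A phi (a, 1%R) (b, rho),
         (if b == (order A).*2 then
            if a < (order A).*2 then s \in [:: 0; 1; 2]
            else s \in [:: 0; 2; 4]
          else s == 0) &
         A' = relabel (shift ((order A).*2 + 4) s)
                (Omega2p_new a b phi rho theta
                   `|` relabel (Omega2p_relabel a b) A)]).

Definition Omega2m (A A' : symbol) : Prop :=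
  exists (z w : nat) (c d : crossing),
    [/\ gon2_at A z w c d, sign c = (- sign d)%R
      & A' = compress ((A `\ c) `\ d)].

Definition companion (a1 a2 b1 b2 c1 c2 x : nat) : nat :=
  if x == a1 then a2 else if x == a2 then a1 else
  if x == b1 then b2 else if x == b2 then b1 else
  if x == c1 then c2 else if x == c2 then c1 else x.

(* The six labels of a 3-gon occur in its three crossings only, so relabelling
   all of A leaves the other crossings unchanged. *)
Definition Omega3 (A A' : symbol) : Prop :=
  exists a1 a2 b1 b2 c1 c2 : nat,
    gon3_at A a1 a2 b1 b2 c1 c2 /\
    A' = relabel (companion a1 a2 b1 b2 c1 c2) A.

Definition alg_move (A A' : symbol) : Prop :=
  Omega_beta A A' \/ Omega_iso A A' \/ Omega1p A A' \/ Omega1m A A' \/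
  Omega2p A A' \/ Omega2m A A' \/ Omega3 A A'.

Local Open Scope ring_scope.
Local Open Scope classical_set_scope.

Inductive category : Type := Smooth | PL.

Section Diagrams.
Context {R : realType}.
Implicit Types (X Y : R -> R) (s t : R).

Definition smooth_fun X : Prop :=
  forall (n : nat) (t : R), derivable (derive1n n X) t 1.

Definition smooth_curve X Y : Prop :=
  [/\ smooth_fun X, smooth_fun Y &
      forall t : R, derive1 X t != 0 \/ derive1 Y t != 0].

(* u is a subdivision of the period [0, 1]; nothing is required of its points
   with index greater than m. *)
Definition pl_curve X Y : Prop :=
  exists (m : nat) (u : nat -> R),
    [/\ u 0%N = 0, u m = 1, forall i : nat, (i < m)%N -> u i < u i.+1 &
        forall i : nat, (i < m)%N -> exists p q p' q' : R,
          forall t : R, u i <= t <= u i.+1 ->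
            X t = p + q * t /\ Y t = p' + q' * t].

(* Two parameters of the same point of the circle R / Z. *)
Definition same_param s t : Prop := exists k : int, s - t = k%:~R.

Definition double X Y s t : Prop :=
  [/\ ~ same_param s t, X s = X t & Y s = Y t].

Definition passage X Y t : Prop := exists s : R, double X Y t s.

Definition det X Y s t : R :=
  derive1 X s * derive1 Y t - derive1 Y s * derive1 X t.

(* A 1-periodic parametrization t |-> (X t, Y t) of a closed curve in the
   oriented plane R^2; [up t] tells whether the passage at t is on the
   over-strand, and is irrelevant when t is not a passage through a crossing.  Transversality
   is stated through the velocities; for a pl curve this contains the usual
   general-position convention that a crossing is not a corner. *)
Record diagram (C : category) := Diagram {
  cx : R -> R;
  cy : R -> R;
  up : R -> bool;
  cx_periodic : forall t, cx (t + 1) = cx t;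
  cy_periodic : forall t, cy (t + 1) = cy t;
  up_periodic : forall t, up (t + 1) = up t;
  curve_category :
    match C with Smooth => smooth_curve cx cy | PL => pl_curve cx cy end;
  finite_passages : finite_set [set t | 0 <= t < 1 /\ passage cx cy t];
  double_points : forall r s t,
    double cx cy r s -> double cx cy r t -> same_param s t;
  transverse : forall s t, double cx cy s t ->
    [/\ derivable cx s 1, derivable cy s 1, derivable cx t 1, derivable cy t 1
      & det cx cy s t != 0];
  over_under : forall s t, double cx cy s t -> up s = ~~ up t
}.

Definition base_point C (K : diagram C) (t0 : R) : Prop :=
  ~ passage (cx K) (cy K) t0.

(* ts lists the passages met when travelling once around K from t0; the
   passage at the parameter t gets the label 1 + (index of t in ts).  Turning
   counterclockwise from the over- to the under-direction means that the
   determinant of these directions is positive. *)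
Definition based_symbol C (K : diagram C) (t0 : R) (A : symbol) : Prop :=
  exists ts : seq R,
    [/\ sorted <%R ts,
        forall t, t \in ts <-> t0 < t < t0 + 1 /\ passage (cx K) (cy K) t &
        forall c : crossing, c \in A <->
          exists s t, [/\ s \in ts, t \in ts, double (cx K) (cy K) s t, up K s
            & c = ((index s ts).+1, (index t ts).+1,
                   if 0 < det (cx K) (cy K) s t then 1 else -1)]].

End Diagrams.

Definition Sigma_D (R : realType) (C : category) : set symbol :=
  [set A | exists (K : @diagram R C) (t0 : R),
     base_point K t0 /\ based_symbol K t0 A].

(* A = S 0 -> S 1 -> ... -> S k = A', with all S i in Sigma_D *)
Definition sim_al (R : realType) (C : category) (A A' : symbol) : Prop :=
  exists (k : nat) (S : nat -> symbol),
    [/\ S 0%N = A, S k = A',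
        forall i : nat, (i <= k)%N -> Sigma_D R C (S i) &
        forall i : nat, (i < k)%N -> alg_move (S i) (S i.+1)].

(* Main.v *)
Require Import Defs.
From mathcomp Require Import all_boot all_order all_algebra finmap.
From mathcomp Require Import all_classical all_reals all_analysis.
From mathcomp Require Import zify ring lra.

Set Implicit Arguments.
Unset Strict Implicit.
Unset Printing Implicit Defensive.

Import Order.TTheory GRing.Theory Num.Theory.
Import numFieldNormedType.Exports.
Import Defs.

(** Reflexivity and transitivity come from empty and concatenated sequences
    of moves. For symmetry every single move A -> A' between symbols of
    diagrams has to be undone by moves through symbols of diagrams.

    A rotation of the labels is undone by a rotation, and a triangle move by
    the same move. A move that creates a kink or a bigon keeps the order of
    the old labels; as deletion renumbers by the order-preserving bijection,
    deleting the new crossings gives A back ([compress_relabel],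
    [Omega1p_inverse], [Omega2p_inverse], [Omega3_inverse]).

    A deletion A -> A' needs more, because the creating moves put the new
    labels at restricted places. A is rotated until the kink or the bigon
    starts at the label 2; then the remaining labels, renumbered, form a
    symbol B0 that is a rotation of A' ([rotate_increasing], [sim_remove]),
    and the creating move with a = 1 leads from B0 to the rotated A (when
    nothing else remains, A comes from the empty symbol). Rotations stay
    among symbols of diagrams, since they move the base point past passages
    ([Sigma_D_shift]).

    For a bigon, the creating move also asks that its two strands lie on a
    common cycle of B0. The face next to a corner of the bigon, opposite to
    the bigon itself, has a cycle of main arcs in A; if this cycle avoids
    the opposite corner of the bigon, it survives in B0 as a path of turns
    that joins the two strands ([collapse_step], [common_cycle_collapse]).
    That the cycle does avoid the opposite corner is false for general
    numbered symbols. It follows from planarity: the part of the curve K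
    between the two passages of a crossing is a closed loop, and the parity
    of its winding number colours the complement of K. The colours on the
    two sides of an arc differ exactly when the arc belongs to the loop, and
    two arcs that follow each other by a turn border the same sector at a
    crossing, hence have the same colour ([face_color_turn],
    [subloop_coloring]). A path of turns between the two corners would
    connect two faces that the loop separates ([om_separates]).

    The topology is done by hand. The winding parity counts the crossings of
    a vertical ray with a fine sampling of the loop. It is locally constant
    off the loop ([winding_parity_locally_constant]) and changes when the
    loop is crossed at a simple point ([winding_parity_jump]). A side of the
    curve is described by displacements to the left of all short chords
    ([pushes]), which makes sense at corners of pl curves too; the colour of
    a side is constant along arcs ([side_interval]) and around each of the
    four sectors at a crossing ([corner_sides]). Of the regularity of K
    these arguments use only continuity, that such displacements exist, and
    that its strands are transverse at crossings in terms of chords. Smooth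
    curves have both properties by the mean value theorem; pl curves have
    them because finitely many double points exclude cusps ([pl_pushable]). *)

Local Open Scope ring_scope.
Local Open Scope classical_set_scope.


(** * Continuous functions on a segment *)

Lemma real_triangle (R : realType) (y x z : R) :
  `|x - z| <= `|x - y| + `|y - z|.
Proof. exact: ler_distD. Qed.

Lemma far_after_move (R : realType) (r z z' a : R) :
  `|z' - z| < r / 2 -> r <= `|a - z| -> r / 2 <= `|a - z'|.
Proof. by move=> h1 h2; have := real_triangle z' a z; lra. Qed.

(** The supremum of the points up to which Q has spread is not less than b:
    the local step at the supremum would carry Q beyond it. *)
Lemma segment_induction (R : realType) (a b : R) (Q : R -> Prop) :
  a <= b ->
  (forall t, a <= t <= b -> exists2 r : R, 0 < r & forall x y, a <= x -> x <= y ->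
     y <= b -> `|x - t| < r -> `|y - t| < r -> Q x -> Q y) ->
  Q a -> Q b.
Proof.
move=> ab loc Qa.
pose S := [set x | a <= x <= b /\ Q x].
have Sa : S a by split=> //; rewrite lexx.
have hS : has_sup S by split; [exists a | exists b => x [/andP[_ ?] _]].
have /andP[ac cb] : a <= sup S <= b.
  by rewrite sup_upper_bound //= ge_sup //; [exists a | move=> x [/andP[_ ?] _]].
have [|r r0 step] := loc (sup S); first by rewrite ac cb.
have [x [/andP[ax xb] Qx] xc] := sup_adherent r0 hS.
have xS : x <= sup S by apply: sup_upper_bound => //; split=> //; rewrite ax xb.
pose y := Num.min (sup S + r / 2) b.
have cy : sup S <= y by rewrite /y le_min cb andbT lerDl divr_ge0 // ltW.
have yr : y <= sup S + r / 2 by rewrite /y ge_min lexx.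
have yb : y <= b by rewrite /y ge_min lexx orbT.
have Qy : Q y.
  apply: (step x y) => //; first exact: le_trans cy.
    by rewrite ltr_norml; apply/andP; split; lra.
  by rewrite ltr_norml; apply/andP; split; lra.
have yS : y <= sup S.
  by apply: sup_upper_bound => //; split=> //; rewrite yb (le_trans ac cy).
have -> : b = y; last by [].
apply/eqP; rewrite eq_le yb andbT leNgt; apply/negP => yltb.
suff : sup S + r / 2 <= sup S by lra.
by move: yS; rewrite /y; case: (leP (sup S + r / 2) b) => // h; move: yltb; rewrite /y min_r ?ltxx // ltW.
Qed.

Lemma locally_constant_segment (R : realType) (T : Type) (f : R -> T) (a b : R) :
  a <= b ->
  (forall t, a <= t <= b -> exists2 r : R, 0 < r &
     forall t', a <= t' <= b -> `|t' - t| < r -> f t' = f t) ->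
  f a = f b.
Proof.
move=> ab loc; apply: (@segment_induction _ a b (fun x => f a = f x)) => //.
move=> t tab; have [r r0 fr] := loc t tab; exists r => // x y ax xy yb xt yt ->.
by rewrite fr ?fr // ?ax ?yb ?(le_trans ax xy) // (le_trans xy yb).
Qed.

Lemma uniform_continuity_segment (R : realType) (f : R -> R) (a b e : R) :
  continuous f -> a <= b -> 0 < e ->
  exists2 d : R, 0 < d & forall s t, a <= s <= b -> a <= t <= b ->
    `|s - t| < d -> `|f s - f t| < e.
Proof.
move=> cf ab e0.
pose Q x := exists2 d : R, 0 < d & forall s t, a <= s <= x -> a <= t <= x ->
    `|s - t| < d -> `|f s - f t| < e.
apply: (@segment_induction _ a b Q) => //; last first.
  exists 1 => // s t /andP[s1 s2] /andP[t1 t2] _.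
  by rewrite (_ : s = t) ?subrr ?normr0 //; lra.
move=> t _; have e2 : 0 < e / 2 by rewrite divr_gt0.
have /cvgrPdist_lt/(_ _ e2)/nbhs_ballP[r /= r0 fr] := cf t.
exists (r / 2); first by rewrite divr_gt0.
move=> x y ax xy yb xt yt [d d0 fd].
exists (Num.min d (r / 2)); first by rewrite lt_min d0 divr_gt0.
move=> s u /andP[as_ sy] /andP[au uy]; rewrite lt_min => /andP[sud sur].
have near v : x - r / 2 < v -> v <= y -> `|t - v| < r.
  move: xt yt; rewrite !ltr_norml => /andP[xt1 xt2] /andP[yt1 yt2].
  by clear -xt1 yt2 r0 => vx vy; apply/andP; split; lra.
move: sur; rewrite ltr_norml => /andP[su1 su2].
have [sx|sx] := leP s x; have [ux|ux] := leP u x;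
  first by apply: fd => //; apply/andP.
all: have both : `|t - s| < r /\ `|t - u| < r.
  1,3,5: by split; apply: near => //; clear -sx ux su1 su2 r0; lra.
all: have fs : `|f s - f t| < e / 2 by rewrite distrC; apply: fr; have [] := both.
all: have fu : `|f t - f u| < e / 2 by apply: fr; have [] := both.
all: apply: le_lt_trans (real_triangle (f t) _ _) _.
all: by rewrite [ltRHS]splitr; exact: ltrD fs fu.
Qed.

Lemma dist_segment_gt0 (R : realType) (f g : R -> R) (x y a b : R) :
  continuous f -> continuous g ->
  (forall t, a <= t <= b -> f t = x -> g t = y -> False) ->
  exists2 d : R, 0 < d & forall t, a <= t <= b -> (d <= `|f t - x|) || (d <= `|g t - y|).
Proof.
move=> cf cg off; have [ab|ba] := leP a b; last first.
  by exists 1 => // t /andP[h1 h2]; have := le_trans h1 h2; rewrite leNgt ba.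
pose h t := `|f t - x| + `|g t - y|.
have ch : continuous h.
  move=> t; apply: cvgD; (apply: cvg_norm; apply: cvgB; last exact: cvg_cst).
    exact: cf.
  exact: cg.
have [|c cab hmin] := @EVT_min R h a b ab.
  exact: continuous_subspaceT.
have hc : 0 < h c.
  have hc0 : 0 <= h c by rewrite addr_ge0.
  rewrite lt_def hc0 andbT; apply/eqP => h0.
  have fc : `|f c - x| = 0.
    by move: h0; rewrite /h; move: (normr_ge0 (f c - x)) (normr_ge0 (g c - y)); lra.
  have gc : `|g c - y| = 0.
    by move: h0; rewrite /h; move: (normr_ge0 (f c - x)) (normr_ge0 (g c - y)); lra.
  apply: (off c); first by move: cab; rewrite in_itv.
    by apply/eqP; rewrite -subr_eq0; apply/eqP/normr0_eq0.
  by apply/eqP; rewrite -subr_eq0; apply/eqP/normr0_eq0.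
exists (h c / 2); first by rewrite divr_gt0.
move=> t tab; have := hmin t; rewrite in_itv /= => /(_ tab).
case: (leP (h c / 2) `|f t - x|) => //= h1 h2.
by move: h2; rewrite {2}/h; lra.
Qed.

(** * Winding parity of a closed curve *)

Lemma telescope_addb (u : nat -> bool) (m n : nat) : (m <= n)%N ->
  \big[addb/false]_(m <= i < n) (u i (+) u i.+1) = u m (+) u n.
Proof.
move=> /subnKC <-; elim: (n - m)%N => [|k IH].
  by rewrite addn0 big_geq // addbb.
rewrite addnS big_nat_recr /= ?leq_addr // IH.
by rewrite addbA -(addbA (u m)) addbb addbF.
Qed.

Lemma sign_stable (R : realType) (r u v : R) : r <= `|u| -> `|v - u| < r ->
  (0 <= v) = (0 <= u) /\ (0 < v) = (0 < u).
Proof.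
move=> + /ltr_normlP[h1 h2]; have [u0|u0] := leP 0 u.
  rewrite (ger0_norm u0) => ru; have v0 : 0 < v by lra.
  have u0' : 0 < u by lra.
  by rewrite u0' (ltW v0) v0.
rewrite (ltr0_norm u0) => ru; have v0 : v < 0 by lra.
by rewrite (lt_geF v0) (lt_gtF v0) (lt_gtF u0).
Qed.

Lemma same_side (R : realType) (r x a b : R) : r <= `|a - x| -> `|b - a| < r ->
  (x <= b) = (x <= a) /\ (x < b) = (x < a).
Proof.
move=> h1 h2; have [] := sign_stable (v := b - x) h1.
  by rewrite opprB addrA subrK.
by rewrite !subr_ge0 !subr_gt0.
Qed.

Lemma same_side_moved (R : realType) (r z z' a b : R) :
  `|z' - z| < r / 2 -> r <= `|a - z| -> `|b - a| < r / 2 ->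
  [/\ (z' <= a) = (z <= a), (z <= b) = (z <= a) & (z' <= b) = (z <= a)] /\
  [/\ (z' < a) = (z < a), (z < b) = (z < a) & (z' < b) = (z < a)].
Proof.
move=> h1 h2 h3; have n1 := normr_ge0 (z' - z); have n3 := normr_ge0 (b - a).
have stable c w : `|w - c - (a - z)| < r -> (c <= w) = (z <= a) /\ (c < w) = (z < a).
  by move=> /(sign_stable h2); rewrite !subr_ge0 !subr_gt0.
have [e1 l1] : (z' <= a) = (z <= a) /\ (z' < a) = (z < a).
  by apply: stable; rewrite (_ : _ - _ = - (z' - z)) ?normrN; [lra|ring].
have [e2 l2] : (z <= b) = (z <= a) /\ (z < b) = (z < a).
  by apply: stable; rewrite (_ : _ - (a - z) = b - a); [lra|ring].
have [e3 l3] : (z' <= b) = (z <= a) /\ (z' < b) = (z < a).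
  apply: stable; rewrite (_ : _ - (a - z) = (b - a) - (z' - z)); last by ring.
  by apply: le_lt_trans (ler_normB _ _) _; lra.
by [].
Qed.

Section Parity.
Context {R : realType}.
Implicit Types (a b d e h r s t x y z : R).
Variables (f g : R -> R) (p q : R).

Definition node (N i : nat) : R := p + (q - p) * (i%:R / N%:R).

(** The number modulo 2 of crossings of the upward vertical ray from (x, y)
    with the curve (f, g), as seen by N steps of equal length; a step is
    counted at its first end. *)
Definition ray_parity (N : nat) (x y : R) : bool :=
  \big[addb/false]_(0 <= i < N)
    (((x <= f (node N i)) (+) (x <= f (node N i.+1))) && (y < g (node N i))).

(** The common value of all sufficiently fine samplings, for points off the
    curve. *)
Definition winding_parity (x y : R) : bool :=
  `[< exists N0, forall N, (N0 <= N)%N -> ray_parity N x y >].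

Definition fine_mesh (r : R) (N : nat) : Prop :=
  forall s t, p <= s <= q -> p <= t <= q -> `|s - t| <= (q - p) / N%:R ->
    `|f s - f t| < r /\ `|g s - g t| < r.

(** Distance in the maximum norm, kept as a disjunction since the two
    coordinates play different roles for a vertical ray. *)
Definition clear (r x y : R) : Prop :=
  forall t, p <= t <= q -> (r <= `|f t - x|) || (r <= `|g t - y|).

Hypotheses (pq : p < q) (cf : continuous f) (cg : continuous g)
  (fpq : f p = f q) (gpq : g p = g q).

Lemma small_mesh (d : R) : 0 < d ->
  exists N0, (0 < N0)%N /\ forall N, (N0 <= N)%N -> (q - p) / N%:R < d.
Proof.
move=> d0; exists (Num.truncn ((q - p) / d)).+1; split=> // N hN.
have N0 : 0 < N%:R :> R by rewrite ltr0n; apply: leq_trans hN.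
rewrite ltr_pdivrMr // mulrC -ltr_pdivrMr //.
apply: lt_le_trans (truncnS_gt _) _; by rewrite ler_nat.
Qed.

Lemma fine_mesh_exists (r : R) : 0 < r ->
  exists N0, (0 < N0)%N /\ forall N, (N0 <= N)%N -> fine_mesh r N.
Proof.
move=> r0.
have [d1 d10 h1] := uniform_continuity_segment cf (ltW pq) r0.
have [d2 d20 h2] := uniform_continuity_segment cg (ltW pq) r0.
have [|N0 [N00 hN]] := @small_mesh (Num.min d1 d2); first by rewrite lt_min d10.
exists N0; split=> // N /hN; rewrite lt_min => /andP[l1 l2] s t sp tp st.
by split; [apply: h1 | apply: h2] => //; apply: le_lt_trans st _.
Qed.

Lemma node_bounds N i : (0 < N)%N -> (i <= N)%N -> p <= node N i <= q.
Proof.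
move=> N0 iN; have N0' : 0 < N%:R :> R by rewrite ltr0n.
have h0 : 0 <= i%:R / N%:R :> R by rewrite divr_ge0 ?ler0n.
have h1 : i%:R / N%:R <= 1 :> R by rewrite ler_pdivrMr // mul1r ler_nat.
rewrite /node; move: pq h0 h1; set z := _ / _; nra.
Qed.

Lemma node0 N : node N 0 = p.
Proof. by rewrite /node mul0r mulr0 addr0. Qed.

Lemma node_last N : (0 < N)%N -> node N N = q.
Proof. by move=> N0; rewrite /node divff ?pnatr_eq0 -?lt0n //; ring. Qed.

Lemma node_sub N i j : (i <= j)%N ->
  `|node N i - node N j| = (q - p) * ((j - i)%:R / N%:R).
Proof.
move=> ij; rewrite /node (_ : _ - _ = - ((q - p) * ((j - i)%:R / N%:R))).
  by rewrite normrN ger0_norm // !mulr_ge0 ?invr_ge0 ?ler0n // subr_ge0 ltW.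
by rewrite natrB //; ring.
Qed.

Lemma node_step N i : `|node N i - node N i.+1| = (q - p) / N%:R.
Proof. by rewrite node_sub // subSnn mul1r. Qed.

Lemma node_refine N M i : (0 < M)%N -> node (N * M) (i * M) = node N i.
Proof.
move=> M0; rewrite /node !natrM; congr (_ + _ * _).
by rewrite -mulf_div divff ?mulr1 // pnatr_eq0 -lt0n.
Qed.

(** A step of a fine mesh keeps away from (x, y) in one fixed coordinate. If
    this is the horizontal one, no substep crosses the vertical line; if it is
    the vertical one, either all crossings of the substeps with the line count
    or none does, and their parity telescopes to that of the step. *)
Lemma ray_parity_refine r N M x y : (0 < N)%N -> (0 < M)%N ->
  clear r x y -> fine_mesh r N -> ray_parity (N * M) x y = ray_parity N x y.
Proof.
move=> N0 M0 off fine; rewrite /ray_parity big_nat_mul; apply: eq_big_nat => i iN.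
have NM0 : (0 < N * M)%N by rewrite muln_gt0 N0.
have mid : p <= node N i <= q by apply: node_bounds => //; apply: ltnW.
have near j : (i * M <= j <= i.+1 * M)%N ->
    p <= node (N * M) j <= q /\ `|node (N * M) j - node N i| <= (q - p) / N%:R.
  move=> /andP[l1 l2]; split.
    by apply: node_bounds => //; apply: leq_trans l2 _; rewrite leq_mul2r (andP iN).2 orbT.
  rewrite -(node_refine N i M0) distrC node_sub // ler_pM2l ?subr_gt0 //.
  rewrite ler_pdivrMr ?ltr0n // natrM mulrA mulVf ?mul1r ?pnatr_eq0 -?lt0n //.
  by rewrite ler_nat leq_subLR -mulSnr.
have tele : \big[addb/false]_(i * M <= j < i.+1 * M)
    ((x <= f (node (N * M) j)) (+) (x <= f (node (N * M) j.+1)))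
    = (x <= f (node N i)) (+) (x <= f (node N i.+1)).
  rewrite (telescope_addb (fun j => x <= f (node (N * M) j))) ?leq_mul2r ?leqnSn ?orbT //.
  by rewrite !node_refine.
have bnd j : (i * M <= j < i.+1 * M)%N -> (i * M <= j <= i.+1 * M)%N.
  by move=> /andP[-> /ltnW].
have bndS j : (i * M <= j < i.+1 * M)%N -> (i * M <= j.+1 <= i.+1 * M)%N.
  by move=> /andP[/leqW -> ->].
have iSN : p <= node N i.+1 <= q by apply: node_bounds; rewrite ?(andP iN).2.
case/orP: (off _ mid) => far.
  have side t : p <= t <= q -> `|t - node N i| <= (q - p) / N%:R ->
      (x <= f t) = (x <= f (node N i)).
    by move=> tp tn; have [? _] := fine _ _ tp mid tn; have [] := same_side far (b := f t).
  rewrite (side (node N i.+1)) // ?(distrC (node N i.+1)) ?node_step // addbb.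
  rewrite big_nat big1 // => j jb.
  have [n1 n2] := near _ (bnd _ jb); have [n3 n4] := near _ (bndS _ jb).
  by rewrite (side (node (N * M) j)) // (side (node (N * M) j.+1)) // addbb.
have side t : p <= t <= q -> `|t - node N i| <= (q - p) / N%:R ->
    (y < g t) = (y < g (node N i)).
  by move=> tp tn; have [_ ?] := fine _ _ tp mid tn; have [] := same_side far (b := g t).
rewrite -tele big_distrl big_nat [RHS]big_nat; apply: eq_bigr => j jb.
by have [n1 n2] := near _ (bnd _ jb); rewrite (side (node (N * M) j)).
Qed.

Lemma winding_parityE r N x y : (0 < N)%N -> clear r x y -> 0 < r ->
  fine_mesh r N -> winding_parity x y = ray_parity N x y.
Proof.
move=> N0 off r0 fineN; have [N1 [N10 hN1]] := fine_mesh_exists r0.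
have same M : (N1 <= M)%N -> ray_parity M x y = ray_parity N x y.
  move=> N1M; have M0 := leq_trans N10 N1M.
  by rewrite -(ray_parity_refine M0 N0 off (hN1 _ N1M)) mulnC
    (ray_parity_refine N0 M0 off fineN).
apply/asboolP/idP => [[N2 hN2]|h]; last by exists N1 => M /same ->.
by rewrite -(same (maxn N1 N2)) ?leq_maxl // hN2 // leq_maxr.
Qed.

(** Moving the point changes the i-th summand by B i + B (i + 1) modulo 2,
    where B i tells whether the i-th sample lies between the two vertical
    lines and above the point. This telescopes to B 0 + B N, which vanishes
    since the curve is closed. *)
Lemma winding_parity_locally_constant x y :
  (forall t, p <= t <= q -> f t = x -> g t = y -> False) ->
  exists2 r : R, 0 < r & forall x' y', `|x' - x| < r -> `|y' - y| < r ->
    winding_parity x' y' = winding_parity x y.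
Proof.
move=> offxy; have [r r0 off] := dist_segment_gt0 cf cg offxy.
have r2 : 0 < r / 2 by rewrite divr_gt0.
have [N [N0 /(_ _ (leqnn N)) fine]] := fine_mesh_exists r2.
exists (r / 2) => // x' y' xx' yy'.
have off' : clear (r / 2) x' y'.
  move=> t /off /orP[h|h]; first by rewrite (far_after_move xx').
  by rewrite (far_after_move yy') ?orbT.
have off2 : clear (r / 2) x y.
  by move=> t /off /orP[h|h]; rewrite (le_trans _ h) ?orbT //; lra.
rewrite (winding_parityE N0 off' r2 fine) (winding_parityE N0 off2 r2 fine).
pose B i := ((x' <= f (node N i)) (+) (x <= f (node N i))) && (y < g (node N i)).
suff : ray_parity N x' y' (+) ray_parity N x y = B 0%N (+) B N.
  rewrite /B node0 node_last // fpq gpq addbb.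
  by case: ray_parity; case: ray_parity.
rewrite -(telescope_addb B (leq0n N)) /ray_parity -big_split /=.
rewrite big_nat [RHS]big_nat; apply: eq_bigr => i iN.
have mid : p <= node N i <= q by apply: node_bounds => //; apply: ltnW.
have iSN : p <= node N i.+1 <= q by apply: node_bounds; rewrite ?iN.
have step : `|node N i.+1 - node N i| <= (q - p) / N%:R by rewrite distrC node_step.
have [fs gs] := fine _ _ iSN mid step.
case/orP: (off _ mid) => far; rewrite /B.
  by have [[-> -> ->] _] := same_side_moved xx' far fs; rewrite !addbb.
have [_ [-> -> _]] := same_side_moved yy' far gs.
by case: (y < _); rewrite ?andbT ?andbF //= addbACA.
Qed.

(** The two points are separated by the strand that passes between them at t1.
    The summands for the two points agree except at the step that contains t1:
    their sum is the change of the truth value of t1 <= node i, which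
    telescopes. *)
Lemma winding_parity_jump e t1 : 0 < e -> p < t1 -> t1 <= q ->
  (forall a b, t1 - e < a -> a < b -> b < t1 + e -> f a < f b) ->
  (forall t, p <= t <= q -> f t = f t1 -> g t = g t1 -> t = t1) ->
  exists2 h0 : R, 0 < h0 & forall h, 0 < h < h0 ->
    winding_parity (f t1) (g t1 - h) != winding_parity (f t1) (g t1 + h).
Proof.
move=> e0 pt1 t1q incr simple; set x := f t1; set y := g t1.
have incr_le t : t1 - e < t < t1 + e -> (x <= f t) = (t1 <= t).
  move=> /andP[l1 l2]; have [h|h] := leP t1 t; last first.
    by apply/negbTE; rewrite -ltNge; apply: incr => //; lra.
  move: h; rewrite le_eqVlt => /orP[/eqP <-|h]; first by rewrite lexx.
  by apply/ltW/incr => //; lra.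
have [d d0 far] : exists2 d : R, 0 < d & forall t, p <= t <= q -> e / 2 <= `|t - t1| ->
    (d <= `|f t - x|) || (d <= `|g t - y|).
  have [|d1 d10 h1] := dist_segment_gt0 (a := p) (b := t1 - e / 2) (x := x) (y := y) cf cg.
    by move=> t /andP[l1 l2] h1 h2; have := simple t ltac:(apply/andP; split; lra) h1 h2; lra.
  have [|d2 d20 h2] := dist_segment_gt0 (a := t1 + e / 2) (b := q) (x := x) (y := y) cf cg.
    by move=> t /andP[l1 l2] h2 h3; have := simple t ltac:(apply/andP; split; lra) h2 h3; lra.
  exists (Num.min d1 d2); first by rewrite lt_min d10.
  move=> t /andP[l1 l2]; rewrite !ge_min.
  have [h|h] := leP 0 (t - t1); rewrite ?(ger0_norm h) ?(ltr0_norm h) => h3.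
    by have /h2/orP[->|->] : t1 + e / 2 <= t <= q; rewrite ?orbT //; apply/andP; split; lra.
  by have /h1/orP[->|->] : p <= t <= t1 - e / 2; rewrite ?orbT //; apply/andP; split; lra.
exists d => // h /andP[h0 hd].
have avoid (z : R) : `|z| = h -> exists2 r : R, 0 < r & clear r x (y + z).
  move=> zh; apply: dist_segment_gt0 => // t tpq ft gt.
  have [h1|h1] := leP (e / 2) `|t - t1|.
    by have /orP[] := far t tpq h1; rewrite ?ft ?gt ?subrr ?normr0 ?(addrC y) ?addrK ?zh; lra.
  have h2 : t = t1.
    apply/eqP; rewrite eq_le -incr_le; last by move: h1; rewrite ltr_norml => /andP[? ?]; apply/andP; split; lra.
    rewrite ft lexx andbT leNgt; apply/negP => lt.
    by have := incr t1 t; rewrite -/x ft ltxx; move: h1; rewrite ltr_norml => /andP[? ?] H; suff: false by []; apply: H => //; lra.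
  have hz : z = 0 by move: gt; rewrite h2 -/y; lra.
  by move: zh; rewrite hz normr0; lra.
have [r1 r10 off1] : exists2 r : R, 0 < r & clear r x (y - h) by apply: avoid; rewrite normrN gtr0_norm.
have [r2 r20 off2] : exists2 r : R, 0 < r & clear r x (y + h) by apply: avoid; rewrite gtr0_norm.
(* r <= h puts the sample just before t1 between the two points; r <= d - h
   keeps a step far from t1 on one side of the vertical line. *)
pose r := Num.min (Num.min r1 r2) (Num.min (d - h) h).
have r0 : 0 < r by rewrite !lt_min r10 r20 h0 subr_gt0 hd.
have [rr1 rr2 rd rh] : [/\ r <= r1, r <= r2, r <= d - h & r <= h].
  by rewrite /r !ge_min !lexx ?orbT.
have mono (s x' y' : R) : r <= s -> clear s x' y' -> clear r x' y'.
  by move=> rs c t /c /orP[] k; rewrite (le_trans rs k) ?orbT.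
have {}off1 := mono _ _ _ rr1 off1; have {}off2 := mono _ _ _ rr2 off2.
have [N1 [N10 fine]] := fine_mesh_exists r0.
have [N2 [N20 mesh]] := small_mesh (divr_gt0 e0 (ltr0n _ 2)).
pose N := maxn N1 N2; have N0 : (0 < N)%N by rewrite leq_max N10.
have {}fine : fine_mesh r N by apply: fine; rewrite leq_maxl.
have {}mesh : (q - p) / N%:R < e / 2 by apply: mesh; rewrite leq_maxr.
rewrite (winding_parityE N0 off1 r0 fine) (winding_parityE N0 off2 r0 fine).
suff : ray_parity N x (y - h) (+) ray_parity N x (y + h) = (t1 <= node N 0) (+) (t1 <= node N N).
  rewrite node0 node_last // t1q (lt_geF pt1) /=; by case: ray_parity; case: ray_parity.
rewrite -(telescope_addb (fun i => t1 <= node N i)) //.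
rewrite /ray_parity -big_split /= big_nat [RHS]big_nat; apply: eq_bigr => i iN.
have mid : p <= node N i <= q by apply: node_bounds => //; apply: ltnW.
have iSN : p <= node N i.+1 <= q by apply: node_bounds; rewrite ?iN.
have step : `|node N i - node N i.+1| <= (q - p) / N%:R by rewrite node_step.
have [fs gs] := fine _ _ iSN mid ltac:(by rewrite distrC).
have ord : node N i <= node N i.+1.
  rewrite /node lerD2l ler_pM2l ?subr_gt0 // ler_pM2r ?invr_gt0 ?ltr0n //.
  by rewrite ler_nat.
move: (step); rewrite ler_norml => /andP[st1 st2].
have [nr|nr] := ltP `|node N i - t1| (e / 2).
  move: nr; rewrite ltr_norml => /andP[nr1 nr2].
  have n0 : t1 - e < node N i < t1 + e by clear -nr1 nr2 e0; apply/andP; split; lra.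
  have n1 : t1 - e < node N i.+1 < t1 + e.
    by clear -nr1 nr2 st1 st2 mesh; apply/andP; split; lra.
  rewrite !incr_le //.
  have [l1|l1] := leP t1 (node N i); first by rewrite (le_trans l1 ord).
  have [l2|//] := leP t1 (node N i.+1).
  have [|_ ] := fine _ t1 mid ltac:(by rewrite t1q ltW).
    rewrite ltr0_norm ?subr_lt0 //; lra.
  rewrite ltr_norml -/y => /andP[k1 k2] /=.
  rewrite (_ : y - h < _ = true); last by lra.
  by rewrite (_ : y + h < _ = false) //; apply/negbTE; rewrite -leNgt; lra.
have -> : (t1 <= node N i) = (t1 <= node N i.+1).
  apply/idP/idP => k; first lra.
  move: nr; clear -k st1 st2 mesh ord e0.
  have [k1|k1] := leP 0 (node N i - t1); rewrite ?(ger0_norm k1) ?(ltr0_norm k1); lra.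
rewrite addbb; case/orP: (far _ mid nr) => k.
  have [-> _] := same_side k (b := f (node N i.+1)) ltac:(by apply: lt_le_trans fs _; lra).
  by rewrite addbb.
have moved z : `|z| < d -> (y + z < g (node N i)) = (y < g (node N i)).
  move=> zd; have [|_] := sign_stable (v := g (node N i) - (y + z)) k.
    by rewrite (_ : _ - _ - _ = - z) ?normrN //; ring.
  by rewrite !subr_gt0.
by rewrite (moved h) ?(moved (- h)) ?normrN ?gtr0_norm // addbb.
Qed.

End Parity.

(** * Sides of a curve and sectors at a crossing *)

Lemma convex_gt0 (R : realType) (th x y : R) : 0 <= th <= 1 -> 0 < x -> 0 < y ->
  0 < (1 - th) * x + th * y.
Proof.
move=> /andP[th0 th1] x0 y0; have [->|/eqP thn] := eqVneq th 0; first by lra.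
have th0' : 0 < th by rewrite lt_def th0 andbT; apply/eqP.
have k1 : 0 <= (1 - th) * x by apply: mulr_ge0; lra.
by have k2 := mulr_gt0 th0' y0; lra.
Qed.

Section Sides.
Context {R : realType}.
Implicit Types (a b d e h r s t u v wx wy x y z D : R) (k : int).
Variables (X Y : R -> R) (kappa : R -> R -> bool).

Definition off_curve (x y : R) : Prop := forall t, X t = x -> Y t = y -> False.

(** The displacement w = (wx, wy) is strictly to the left (r = 1) or to the
    right (r = -1) of all chords of the curve near t. Chords replace tangents
    so that corners are covered. *)
Definition pushes (r t e wx wy : R) : Prop :=
  forall a b, t - e < a -> a < b -> b < t + e ->
    0 < r * ((X b - X a) * wy - (Y b - Y a) * wx).

(** The colour c of the plane next to the point at t on its side r. All short
    displacements are tested, so that the side does not depend on the choice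
    of one. *)
Definition side (r t : R) (c : bool) : Prop :=
  forall e, 0 < e -> exists2 h : R, 0 < h & forall wx wy,
    `|wx| < h -> `|wy| < h -> pushes r t e wx wy ->
    kappa (X t + wx) (Y t + wy) = c.

Hypotheses (cX : continuous X) (cY : continuous Y)
  (pX : forall t, X (t + 1) = X t) (pY : forall t, Y (t + 1) = Y t)
  (pushable : forall t, exists e wx wy : R, 0 < e /\ pushes 1 t e wx wy)
  (triple : forall r s t, double X Y r s -> double X Y r t -> same_param s t)
  (kappa_const : forall x y, off_curve x y -> exists2 r : R, 0 < r &
     forall x' y', `|x' - x| < r -> `|y' - y| < r -> kappa x' y' = kappa x y).

Lemma periodic_int (f : R -> R) : (forall t, f (t + 1) = f t) ->
  forall (k : int) t, f (t + k%:~R) = f t.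
Proof.
move=> pf; have pn (n : nat) t : f (t + n%:R) = f t.
  by elim: n t => [|n IH] t; rewrite ?addr0 // -natr1 addrA pf IH.
by move=> [] n t; rewrite ?NegzE ?mulrNz -?pmulrn ?pn // -{2}[t](subrK n.+1%:R) pn.
Qed.

Lemma shift_into (c t : R) : exists k : int, c <= t + k%:~R < c + 1.
Proof.
exists (- Num.floor (t - c)); rewrite mulrNz.
have := floor_le (t - c); have := floorD1_gt (t - c); rewrite intrD => h1 h2.
by apply/andP; split; lra.
Qed.

Lemma near_sum (d x y z : R) : `|x - z| < d / 2 -> `|y| < d / 2 ->
  (d <= `|x + y - z|) = false.
Proof.
move=> xz yd; apply/negbTE; rewrite -ltNge addrAC.
by apply: le_lt_trans (ler_normD _ _) _; rewrite [ltRHS]splitr ltrD.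
Qed.

Lemma near_continuous (f : R -> R) t e : continuous f -> 0 < e ->
  exists2 d : R, 0 < d & forall s, `|s - t| < d -> `|f s - f t| < e.
Proof.
move=> cf e0; have /cvgrPdist_lt/(_ _ e0)/nbhs_ballP[d /= d0 h] := cf t.
by exists d => // s st; rewrite distrC; apply: h; rewrite /ball /= distrC.
Qed.

Lemma path_const (gx gy : R -> R) a b : a <= b ->
  continuous gx -> continuous gy ->
  (forall t, a <= t <= b -> off_curve (gx t) (gy t)) ->
  kappa (gx a) (gy a) = kappa (gx b) (gy b).
Proof.
move=> ab cgx cgy off.
apply: (locally_constant_segment (f := fun t => kappa (gx t) (gy t))) => // t tab.
have [r r0 hr] := kappa_const (off t tab).
have [d1 d10 h1] := near_continuous t cgx r0.
have [d2 d20 h2] := near_continuous t cgy r0.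
exists (Num.min d1 d2); first by rewrite lt_min d10.
by move=> t' _; rewrite lt_min => /andP[k1 k2]; apply: hr; [apply: h1|apply: h2].
Qed.

Lemma off_curve_in c x y :
  (forall t, c <= t < c + 1 -> X t = x -> Y t = y -> False) -> off_curve x y.
Proof.
move=> h t Xt Yt; have [k tk] := shift_into c t.
by apply: (h _ tk); rewrite periodic_int.
Qed.

Lemma not_same_param (s t : R) : 0 < t - s < 1 -> ~ same_param t s.
Proof.
move=> /andP[h1 h2] [k hk]; move: h1 h2; rewrite hk.
by rewrite ltr0z ltrz1; lia.
Qed.

Lemma far_from_rest t e : ~ passage X Y t -> 0 < e ->
  exists2 d : R, 0 < d & forall u, t + e <= u <= t + 1 - e ->
    (d <= `|X u - X t|) || (d <= `|Y u - Y t|).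
Proof.
move=> np e0; apply: dist_segment_gt0 => // u /andP[l1 l2] Xu Yu.
apply: np; exists u; split=> // -[k hk].
apply: (@not_same_param t u); first by apply/andP; split; lra.
by exists (- k); rewrite mulrNz -hk opprB.
Qed.

(** Away from t the curve has a positive distance from the point at t, which
    is not a crossing. Near t, a point of the curve reached by w would make w
    a chord, but no chord is parallel to w. *)
Lemma push_off_curve r t e : ~ passage X Y t -> 0 < e ->
  exists2 h : R, 0 < h & forall t' wx wy, `|t' - t| < h -> `|wx| < h -> `|wy| < h ->
    pushes r t e wx wy -> off_curve (X t' + wx) (Y t' + wy).
Proof.
move=> np e0; have e2 : 0 < e / 2 by rewrite divr_gt0.
have [d d0 far] := far_from_rest np e2.
have d2 : 0 < d / 2 by rewrite divr_gt0.
have [d1 d10 h1] := near_continuous t cX d2.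
have [d2' d20 h2] := near_continuous t cY d2.
exists (Num.min (Num.min d1 d2') (Num.min (e / 2) (d / 2))).
  by rewrite !lt_min d10 d20 e2 d2.
move=> t' wx wy; rewrite !lt_min => /andP[/andP[t1 t2] /andP[t3 _]].
move=> /andP[_ /andP[_ x4]] /andP[_ /andP[_ y4]] pw.
apply: (@off_curve_in (t - e / 2)) => u /andP[u1 u2] Xu Yu.
have {h1 t1} h1 := h1 _ t1; have {h2 t2} h2 := h2 _ t2.
have [ue|ue] := ltP u (t + e / 2); last first.
  have um : t + e / 2 <= u <= t + 1 - e / 2 by clear -ue u2 kappa_const triple; apply/andP; split; lra.
  by have := far u um; rewrite Xu Yu !near_sum.
move: t3 x4 y4 h1 h2; rewrite !ltr_norml => /andP[t1 t2] /andP[x1 x2] /andP[y1 y2] _ _.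
have cross0 : (X u - X t') * wy - (Y u - Y t') * wx = 0 by rewrite Xu Yu; ring.
have [ut|ut|ut] := ltgtP u t'.
- have := pw u t' ltac:(lra) ut ltac:(lra).
  have -> : (X t' - X u) * wy - (Y t' - Y u) * wx
    = - ((X u - X t') * wy - (Y u - Y t') * wx) by ring.
  by rewrite cross0 oppr0 mulr0 ltxx.
- by have := pw t' u ltac:(lra) ut ltac:(lra); rewrite cross0 mulr0 ltxx.
have wx0 : wx = 0 by rewrite ut in Xu; lra.
have wy0 : wy = 0 by rewrite ut in Yu; lra.
have := pw (t - e / 2) t ltac:(lra) ltac:(lra) ltac:(lra).
by rewrite wx0 wy0 !mulr0 subrr mulr0 ltxx.
Qed.

Lemma pushes_shrink r t e t' e' wx wy : t - e <= t' - e' -> t' + e' <= t + e ->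
  pushes r t e wx wy -> pushes r t' e' wx wy.
Proof. by move=> l1 l2 pw a b h1 ab h2; apply: pw => //; lra. Qed.

Lemma pushes_scale r t e c wx wy : 0 < c -> pushes r t e wx wy ->
  pushes r t e (c * wx) (c * wy).
Proof.
move=> c0 pw a b h1 ab h2; have := pw a b h1 ab h2.
rewrite -(pmulr_rgt0 _ c0); congr (_ < _); ring.
Qed.

Lemma pushes_segment r t e th wx wy wx' wy' : 0 <= th <= 1 ->
  pushes r t e wx wy -> pushes r t e wx' wy' ->
  pushes r t e (wx + th * (wx' - wx)) (wy + th * (wy' - wy)).
Proof.
move=> /andP[th0 th1] p1 p2 a b h1 ab h2.
have k1 := p1 a b h1 ab h2; have k2 := p2 a b h1 ab h2.
set c := _ * _ - _ in k1; set c' := _ * _ - _ in k2.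
rewrite (_ : r * _ = (1 - th) * (r * c) + th * (r * c')); last by rewrite /c /c'; ring.
by apply: convex_gt0 => //; apply/andP.
Qed.

Lemma norm_segment (h th0 w w' : R) : 0 <= th0 <= 1 -> `|w| < h -> `|w'| < h ->
  `|w + th0 * (w' - w)| < h.
Proof.
move=> th; rewrite !ltr_norml => /andP[a b] /andP[c d]; apply/andP; split.
  rewrite -subr_gt0 (_ : _ - _ = (1 - th0) * (w + h) + th0 * (w' + h)); last by ring.
  by apply: convex_gt0 => //; lra.
rewrite -subr_gt0 (_ : _ - _ = (1 - th0) * (h - w) + th0 * (h - w')); last by ring.
by apply: convex_gt0 => //; lra.
Qed.

(** The displacements to one side form a convex set. *)
Lemma same_color r t e : ~ passage X Y t -> 0 < e ->
  exists2 h : R, 0 < h & forall wx wy wx' wy',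
    `|wx| < h -> `|wy| < h -> `|wx'| < h -> `|wy'| < h ->
    pushes r t e wx wy -> pushes r t e wx' wy' ->
    kappa (X t + wx) (Y t + wy) = kappa (X t + wx') (Y t + wy').
Proof.
move=> np e0; have [h h0 off] := push_off_curve r np e0.
exists h => // wx wy wx' wy' x y x' y' pw pw'.
have := @path_const (fun th => X t + (wx + th * (wx' - wx)))
  (fun th => Y t + (wy + th * (wy' - wy))) 0 1 ler01.
rewrite !mul0r !addr0 !mul1r !(addrC _ (_ - _)) !subrK; apply.
- by move=> th; apply: cvgD; [apply: cvg_cst|apply: cvgD; [apply: cvg_cst|apply: cvgMl]].
- by move=> th; apply: cvgD; [apply: cvg_cst|apply: cvgD; [apply: cvg_cst|apply: cvgMl]].
move=> th th01; apply: off; rewrite ?subrr ?normr0 //.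
- exact: norm_segment.
- exact: norm_segment.
- exact: pushes_segment.
Qed.

Lemma small_push r t e wx wy h : 0 < h -> pushes r t e wx wy ->
  exists2 h1 : R, 0 < h1 & forall c, 0 < c <= h1 ->
    [/\ `|c * wx| < h, `|c * wy| < h & pushes r t e (c * wx) (c * wy)].
Proof.
move=> h0 pw; pose m := `|wx| + `|wy| + 1.
have m0 : 0 < m by rewrite /m; have := normr_ge0 wx; have := normr_ge0 wy; lra.
exists (h / m); first by rewrite divr_gt0.
move=> c /andP[c0]; rewrite ler_pdivlMr // => cm.
have n0 := normr_ge0 wx; have n1 := normr_ge0 wy.
split; last exact: pushes_scale.
  by rewrite normrM (gtr0_norm c0); rewrite /m in cm; nra.
by rewrite normrM (gtr0_norm c0); rewrite /m in cm; nra.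
Qed.

Definition is_unit_sign (r : R) : Prop := r = 1 \/ r = - 1.

Lemma pushable_sign r t : is_unit_sign r ->
  exists e wx wy : R, 0 < e /\ pushes r t e wx wy.
Proof.
have [e [wx [wy [e0 pw]]]] := pushable t.
move=> [->|->]; first by exists e, wx, wy.
exists e, (- wx), (- wy); split=> // a b h1 ab h2.
have := pw a b h1 ab h2; congr (_ < _); ring.
Qed.

Lemma side_unique r t c c' : is_unit_sign r -> side r t c -> side r t c' -> c = c'.
Proof.
move=> rs h1 h2; have [e [wx [wy [e0 pw]]]] := pushable_sign t rs.
have [d1 d10 k1] := h1 e e0; have [d2 d20 k2] := h2 e e0.
have d0 : 0 < Num.min d1 d2 by rewrite lt_min d10.
have [s s0 /(_ s)[]] := small_push d0 pw; first by rewrite s0 lexx.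
by rewrite !lt_min => /andP[? ?] /andP[? ?] p; rewrite -(k1 (s * wx) (s * wy)) // k2.
Qed.

Lemma side_exists r t : is_unit_sign r -> ~ passage X Y t -> exists c, side r t c.
Proof.
move=> rs np; have [e [wx [wy [e0 pw]]]] := pushable_sign t rs.
have [h h0 same] := same_color r np e0.
have [s s0 /(_ s)[]] := small_push h0 pw; first by rewrite s0 lexx.
move=> sx sy sp; exists (kappa (X t + s * wx) (Y t + s * wy)) => e' e'0.
pose e1 := Num.min e e'; have e10 : 0 < e1 by rewrite lt_min e0.
have ee1 : e1 <= e by rewrite /e1 ge_min lexx.
have ee1' : e1 <= e' by rewrite /e1 ge_min lexx orbT.
have [h' h'0 same'] := same_color r np e10.
exists h' => // wx' wy' x' y' p'.
have m0 : 0 < Num.min h h' by rewrite lt_min h0.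
have [u u0 /(_ u)[]] := small_push m0 pw; first by rewrite u0 lexx.
rewrite !lt_min => /andP[? ?] /andP[? ?] pu.
rewrite (same' wx' wy' (u * wx) (u * wy)) //; first exact: same.
  by apply: pushes_shrink p'; lra.
by apply: pushes_shrink pu; lra.
Qed.

(** A displacement that is good for all chords near t can be slid along the
    curve. *)
Lemma side_near r t : is_unit_sign r -> ~ passage X Y t ->
  exists2 d : R, 0 < d & forall t' c, ~ passage X Y t' -> `|t' - t| < d ->
    side r t c <-> side r t' c.
Proof.
move=> rs np; have [e [wx [wy [e0 pw]]]] := pushable_sign t rs.
have [h h0 off] := push_off_curve r np e0.
exists (Num.min h e); first by rewrite lt_min h0.
move=> t' c np'; rewrite lt_min => /andP[th te].
suff agree (b b' : bool) : side r t b -> side r t' b' -> b = b'.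
  have [b sb] := side_exists rs np; have [b' sb'] := side_exists rs np'.
  split=> sc; first by rewrite (agree _ _ sc sb').
  by rewrite -(agree _ _ sb sc).
move=> sb sb'.
have e'0 : 0 < e - `|t' - t| by rewrite subr_gt0.
have [d1 d10 k1] := sb e e0; have [d2 d20 k2] := sb' _ e'0.
have m0 : 0 < Num.min h (Num.min d1 d2) by rewrite !lt_min h0 d10.
have [s s0 /(_ s)[]] := small_push m0 pw; first by rewrite s0 lexx.
rewrite !lt_min => /and3P[x1 x2 x3] /and3P[y1 y2 y3] ps.
rewrite -(k1 _ _ x2 y2 ps) -(k2 (s * wx) (s * wy)) //; last first.
  have := ler_norm (t' - t); have := ler_norm (t - t'); rewrite distrC => l1 l2.
  by apply: pushes_shrink ps; lra.
have slide x y : x <= y -> `|x - t| < h -> `|y - t| < h ->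
    kappa (X x + s * wx) (Y x + s * wy) = kappa (X y + s * wx) (Y y + s * wy).
  rewrite !ltr_norml => ab /andP[a1 a2] /andP[b1 b2].
  apply: (@path_const (fun u => X u + s * wx) (fun u => Y u + s * wy)) => //.
  - by move=> u; apply: cvgD; [apply: cX|apply: cvg_cst].
  - by move=> u; apply: cvgD; [apply: cY|apply: cvg_cst].
  move=> u /andP[u1 u2]; apply: off ps => //.
  by rewrite ltr_norml; apply/andP; split; lra.
have th0 : `|t - t| < h by rewrite subrr normr0.
by have [l|/ltW l] := leP t t'; [|symmetry]; apply: slide.
Qed.

Lemma side_interval r a b c : is_unit_sign r -> a <= b ->
  (forall t, a <= t <= b -> ~ passage X Y t) -> side r a c -> side r b c.
Proof.
move=> rs ab np; apply: (@segment_induction _ a b (fun t => side r t c)) => // t tab.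
have [d d0 near] := side_near rs (np _ tab).
exists d => // x y ax xy yb xt yt.
have nx : ~ passage X Y x by apply: np; apply/andP; split=> //; apply: le_trans xy yb.
have ny : ~ passage X Y y by apply: np; apply/andP; split=> //; apply: le_trans ax xy.
by move=> /(near x c nx xt) /(near y c ny yt).
Qed.

Lemma side_period r t (k : int) c : side r t c -> side r (t + k%:~R) c.
Proof.
move=> sc e e0; have [h h0 kh] := sc e e0; exists h => // wx wy x y pw.
rewrite !periodic_int //; apply: kh => // a b h1 ab h2.
have := pw (a + k%:~R) (b + k%:~R) ltac:(lra) ltac:(lra) ltac:(lra).
by rewrite !periodic_int.
Qed.

(** Transversality of the strands at s and t, with the sign D of the
    determinant, for chords instead of velocities: this controls whole
    neighbourhoods of the crossing. *)
Definition strictly_transverse (D s t e : R) : Prop := forall a a' b b',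
  s - e < a -> a < a' -> a' < s + e -> t - e < b -> b < b' -> b' < t + e ->
  0 < D * ((X a' - X a) * (Y b' - Y b) - (Y a' - Y a) * (X b' - X b)).

Lemma strictly_transverse_sym D s t e :
  strictly_transverse D s t e -> strictly_transverse (- D) t s e.
Proof.
move=> st a a' b b' h1 h2 h3 h4 h5 h6; have := st _ _ _ _ h4 h5 h6 h1 h2 h3.
congr (_ < _); ring.
Qed.

Lemma strictly_transverse_neq0 D s t e a a' b b' : strictly_transverse D s t e ->
  s - e < a < s + e -> s - e < a' < s + e -> t - e < b < t + e -> t - e < b' < t + e ->
  a != a' -> b != b' ->
  (X a' - X a) * (Y b' - Y b) - (Y a' - Y a) * (X b' - X b) != 0.
Proof.
move=> st /andP[a1 a2] /andP[a3 a4] /andP[b1 b2] /andP[b3 b4].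
move=> aa bb; apply/eqP => z; move: aa bb; rewrite !neq_lt.
move=> /orP[l1|l1] /orP[l2|l2].
- by have := st a a' b b' a1 l1 a4 b1 l2 b4; rewrite z mulr0 ltxx.
- have := st a a' b' b a1 l1 a4 b3 l2 b2; rewrite (_ : _ - _ = 0) ?mulr0 ?ltxx //.
  by rewrite -[RHS]oppr0 -[in RHS]z; ring.
- have := st a' a b b' a3 l1 a2 b1 l2 b4; rewrite (_ : _ - _ = 0) ?mulr0 ?ltxx //.
  by rewrite -[RHS]oppr0 -[in RHS]z; ring.
have := st a' a b' b a3 l1 a2 b3 l2 b2; rewrite (_ : _ - _ = 0) ?mulr0 ?ltxx //.
by rewrite -[in RHS]z; ring.
Qed.

(** Away from the two passages the curve does not return to the crossing,
    since triple points are excluded; compactness gives a positive distance. *)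
Lemma far_from_crossing s t e : double X Y s t -> 0 < e ->
  exists2 d : R, 0 < d & forall u, (forall k : int, e <= `|u + k%:~R - s|) ->
    (forall k : int, e <= `|u + k%:~R - t|) ->
    (d <= `|X u - X s|) || (d <= `|Y u - Y s|).
Proof.
move=> dst e0; have [nst Xst Yst] := dst; have [k0 /andP[l1 l2]] := shift_into s t.
have no u : s + e <= u -> u <= s + 1 - e -> e <= `|u - (t + k0%:~R)| ->
    X u = X s -> Y u = Y s -> False.
  move=> u1 u2 u3 Xu Yu.
  have nsu : ~ same_param s u.
    move=> [k hk]; apply: (@not_same_param s u); first by apply/andP; split; lra.
    by exists (- k); rewrite mulrNz -hk opprB.
  have [k hk] := triple dst (And3 nsu (esym Xu) (esym Yu)).
  have := @not_same_param; move=> nsp.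
  have [lt|lt|eq] := ltgtP u (t + k0%:~R).
  - apply: (nsp u (t + k0%:~R)); first by apply/andP; split; lra.
    by exists (k + k0); rewrite intrD -hk; ring.
  - apply: (nsp (t + k0%:~R) u); first by apply/andP; split; lra.
    by exists (- k - k0); rewrite intrB mulrNz -hk; ring.
  by move: u3; rewrite eq subrr normr0; lra.
have [|d1 d10 h1] := dist_segment_gt0 (a := s + e) (b := t + k0%:~R - e)
    (x := X s) (y := Y s) cX cY.
  move=> u /andP[u1 u2]; apply: no => //; first lra.
  by rewrite ltr0_norm; lra.
have [|d2 d20 h2] := dist_segment_gt0 (a := t + k0%:~R + e) (b := s + 1 - e)
    (x := X s) (y := Y s) cX cY.
  move=> u /andP[u1 u2]; apply: no => //; first lra.
  by rewrite gtr0_norm; lra.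
exists (Num.min d1 d2); first by rewrite lt_min d10.
move=> u us ut; rewrite !ge_min; have [k /andP[u1 u2]] := shift_into s u.
have := us k; have := us (k - 1); have := ut (k - k0); rewrite !intrB.
rewrite -(periodic_int pX k u) -(periodic_int pY k u).
set v := u + k%:~R in u1 u2 *.
rewrite (_ : u + (k%:~R - k0%:~R) - t = v - (t + k0%:~R)); last by rewrite /v; ring.
rewrite (_ : u + (k%:~R - 1) - s = v - (s + 1)); last by rewrite /v; ring.
have [?|ns] := eqVneq v s; first by rewrite (_ : v - s = 0) ?normr0; lra.
rewrite (ltr0_norm (_ : v - (s + 1) < 0)); last by lra.
rewrite (ger0_norm (_ : 0 <= v - s)); last by lra.
have [l|l] := leP 0 (v - (t + k0%:~R)); rewrite ?(ger0_norm l) ?(ltr0_norm l) => v1 v2 v3.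
  by have /h2/orP[->|->] : t + k0%:~R + e <= v <= s + 1 - e; rewrite ?orbT //; apply/andP; split; lra.
by have /h1/orP[->|->] : s + e <= v <= t + k0%:~R - e; rewrite ?orbT //; apply/andP; split; lra.
Qed.

(** Such a point is the fourth corner of a parallelogram spanned by chords of
    the two strands at the crossing. If it were on one of the strands, this
    strand would have a chord parallel to a chord of the other one. *)
Lemma crossing_off D s t e : double X Y s t -> 0 < e -> strictly_transverse D s t e ->
  exists2 h : R, 0 < h & forall a b, a != 0 -> `|a| < h -> b != 0 -> `|b| < h ->
    off_curve (X (s + a) + (X (t + b) - X t)) (Y (s + a) + (Y (t + b) - Y t)).
Proof.
move=> dst e0 st; have [_ Xst Yst] := dst.
have [d d0 far] := far_from_crossing dst e0; have d2 : 0 < d / 2 by rewrite divr_gt0.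
have [h1 h10 k1] := near_continuous s cX d2; have [h2 h20 k2] := near_continuous s cY d2.
have [h3 h30 k3] := near_continuous t cX d2; have [h4 h40 k4] := near_continuous t cY d2.
exists (Num.min e (Num.min (Num.min h1 h2) (Num.min h3 h4))).
  by rewrite !lt_min e0 h10 h20 h30 h40.
move=> a b a0; rewrite !lt_min => /andP[ae /andP[/andP[a1 a2] _]] b0.
move=> /andP[be /andP[_ /andP[b3 b4]]] u Xu Yu.
have shift z w : z + w - z = w :> R by ring.
have {k1 a1} k1 := k1 (s + a) ltac:(by rewrite shift).
have {k2 a2} k2 := k2 (s + a) ltac:(by rewrite shift).
have {k3 b3} k3 := k3 (t + b) ltac:(by rewrite shift).
have {k4 b4} k4 := k4 (t + b) ltac:(by rewrite shift).
have mem z w : `|w - z| < e -> z - e < w < z + e.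
  by rewrite ltr_norml => /andP[? ?]; apply/andP; split; lra.
have ms : s - e < s < s + e by apply: mem; rewrite subrr normr0.
have mt : t - e < t < t + e by apply: mem; rewrite subrr normr0.
have ma : s - e < s + a < s + e by apply: mem; rewrite shift.
have mb : t - e < t + b < t + e by apply: mem; rewrite shift.
have sa : s != s + a by rewrite -subr_eq0 opprD addrA subrr sub0r oppr_eq0.
have tb : t != t + b by rewrite -subr_eq0 opprD addrA subrr sub0r oppr_eq0.
have [[k /mem uk]|ns] := pselect (exists k : int, `|u + k%:~R - s| < e).
  have Xv := periodic_int pX k u; have Yv := periodic_int pY k u.
  have [eq|ne] := eqVneq (s + a) (u + k%:~R).
    have := strictly_transverse_neq0 st ms ma mt mb sa tb.
    have -> : X (t + b) - X t = 0.
      by apply: (addrI (X (s + a))); rewrite addr0 -Xu -Xv eq.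
    have -> : Y (t + b) - Y t = 0.
      by apply: (addrI (Y (s + a))); rewrite addr0 -Yu -Yv eq.
    by rewrite !mulr0 subrr eqxx.
  have /eqP := strictly_transverse_neq0 st ma uk mt mb ne tb; apply.
  by rewrite Xv Yv Xu Yu; ring.
have [[k /mem uk]|nt] := pselect (exists k : int, `|u + k%:~R - t| < e).
  have Xv := periodic_int pX k u; have Yv := periodic_int pY k u.
  have [eq|ne] := eqVneq (t + b) (u + k%:~R).
    have := strictly_transverse_neq0 st ms ma mt mb sa tb.
    have swap (f : R -> R) : f s = f t -> f (t + b) = f (s + a) + (f (t + b) - f t) ->
        f (s + a) - f s = 0 by move=> fst fu; apply: (addIr (f (t + b))); rewrite fst add0r {2}fu; ring.
    rewrite (swap X Xst) ?(swap Y Yst) ?mul0r ?subrr ?eqxx //.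
      by rewrite -Yu -Yv eq.
    by rewrite -Xu -Xv eq.
  have /eqP := strictly_transverse_neq0 st ms ma mb uk sa ne; apply.
  by rewrite Xv Yv Xu Yu Xst Yst; ring.
have ns' (k : int) : e <= `|u + k%:~R - s| by rewrite leNgt; apply/negP => h; apply: ns; exists k.
have nt' (k : int) : e <= `|u + k%:~R - t| by rewrite leNgt; apply/negP => h; apply: nt; exists k.
by have := far u ns' nt'; rewrite Xu Yu !near_sum.
Qed.

(** A short chord from t in the direction r pushes the strand of s to the side
    D r. *)
Lemma corner_color D s t e a r c h : strictly_transverse D s t e -> is_unit_sign r ->
  `|a| < e -> 0 < h -> side (D * r) (s + a) c ->
  exists2 b : R, 0 < b < h & kappa (X (s + a) + (X (t + r * b) - X t))
                               (Y (s + a) + (Y (t + r * b) - Y t)) = c.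
Proof.
move=> st rs ae h0 sc; have e'0 : 0 < e - `|a| by rewrite subr_gt0.
have [d d0 col] := sc _ e'0.
have [h1 h10 k1] := near_continuous t cX d0; have [h2 h20 k2] := near_continuous t cY d0.
pose b := Num.min (Num.min h e) (Num.min h1 h2) / 2.
have e0 : 0 < e by apply: le_lt_trans ae.
have m0 : 0 < Num.min (Num.min h e) (Num.min h1 h2) by rewrite !lt_min h0 e0 h10 h20.
have b0 : 0 < b by rewrite divr_gt0.
have : b < Num.min (Num.min h e) (Num.min h1 h2) by rewrite /b; lra.
rewrite !lt_min => /andP[/andP[bh be] /andP[b1 b2]].
have rb : `|t + r * b - t| = b.
  rewrite (_ : _ - t = r * b); last by ring.
  by case: rs => ->; rewrite ?mulN1r ?normrN ?mul1r gtr0_norm.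
exists b; first by rewrite b0.
apply: col; [by apply: k1; rewrite rb|by apply: k2; rewrite rb|].
move=> u v u1 uv v1.
have [l1 l2] : - `|a| <= a /\ a <= `|a| by split; [rewrite lerNl -normrN; apply: ler_norm|apply: ler_norm].
have [m1 m2] : s - e < u /\ v < s + e by clear -u1 v1 l1 l2 kappa_const triple; split; lra.
have [[n1 n2] [n3 n4]] : (t - e < t /\ t < t + e) /\ (t < t + b /\ t - b < t).
  by clear -e0 b0 kappa_const triple; split; split; lra.
have [n5 n6] : t + b < t + e /\ t - e < t - b by clear -be kappa_const triple; split; lra.
case: rs => ->; first by rewrite mul1r mulr1; apply: st.
by rewrite mulN1r; have := st u v _ _ m1 uv m2 n6 n4 n2; congr (_ < _); ring.
Qed.

(** The points K (s + r1 a) + (K (t + r2 b) - K t) with small a, b > 0 fill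
    the sector between the two half-strands given by r1 and r2 and avoid the
    curve, so they have one colour. Small b shows the sector from the strand
    of s, small a from the strand of t. *)
Lemma corner_sides D s t e : double X Y s t -> 0 < e -> strictly_transverse D s t e ->
  is_unit_sign D ->
  exists2 h : R, 0 < h & forall r1 r2 a b c, is_unit_sign r1 -> is_unit_sign r2 ->
    0 < a < h -> 0 < b < h -> ~ passage X Y (t + r2 * b) ->
    side (D * r2) (s + r1 * a) c -> side (- D * r1) (t + r2 * b) c.
Proof.
move=> dst e0 st Ds; have [_ Xst Yst] := dst.
have [h h0 off] := crossing_off dst e0 st.
exists (Num.min h e); first by rewrite lt_min h0.
move=> r1 r2 a b c r1s r2s /andP[a0]; rewrite lt_min => /andP[ah ae].
move=> /andP[b0]; rewrite lt_min => /andP[bh be] np sc.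
have norm_sign r x : is_unit_sign r -> 0 < x -> `|r * x| = x /\ r * x != 0.
  by move=> [->|->] x0; rewrite ?mulN1r ?mul1r ?normrN ?oppr_eq0 gtr0_norm // gt_eqF.
pose P (a b : R) := kappa (X (s + r1 * a) + (X (t + r2 * b) - X t))
                  (Y (s + r1 * a) + (Y (t + r2 * b) - Y t)).
have slide1 x y b' : 0 < x -> x <= y -> y < h -> 0 < b' < h -> P x b' = P y b'.
  move=> x0 xy yh /andP[b'0 b'h].
  apply: (@path_const (fun u => X (s + r1 * u) + (X (t + r2 * b') - X t))
    (fun u => Y (s + r1 * u) + (Y (t + r2 * b') - Y t))) => //.
  - move=> u; apply: cvgD; last exact: cvg_cst.
    apply: (@continuous_comp _ _ _ (fun u => s + r1 * u) X); last exact: cX.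
    by apply: cvgD; [apply: cvg_cst|apply: cvgMr].
  - move=> u; apply: cvgD; last exact: cvg_cst.
    apply: (@continuous_comp _ _ _ (fun u => s + r1 * u) Y); last exact: cY.
    by apply: cvgD; [apply: cvg_cst|apply: cvgMr].
  move=> u /andP[u1 u2]; have [n1 z1] := norm_sign r1 u r1s ltac:(lra).
  by have [n2 z2] := norm_sign r2 b' r2s b'0; apply: off; rewrite ?n1 ?n2 //; lra.
have slide2 x y a' : 0 < x -> x <= y -> y < h -> 0 < a' < h -> P a' x = P a' y.
  move=> x0 xy yh /andP[a'0 a'h].
  apply: (@path_const (fun u => X (s + r1 * a') + (X (t + r2 * u) - X t))
    (fun u => Y (s + r1 * a') + (Y (t + r2 * u) - Y t))) => //.
  - move=> u; apply: cvgD; first exact: cvg_cst.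
    apply: cvgB; last exact: cvg_cst.
    apply: (@continuous_comp _ _ _ (fun u => t + r2 * u) X); last exact: cX.
    by apply: cvgD; [apply: cvg_cst|apply: cvgMr].
  - move=> u; apply: cvgD; first exact: cvg_cst.
    apply: cvgB; last exact: cvg_cst.
    apply: (@continuous_comp _ _ _ (fun u => t + r2 * u) Y); last exact: cY.
    by apply: cvgD; [apply: cvg_cst|apply: cvgMr].
  move=> u /andP[u1 u2]; have [n1 z1] := norm_sign r2 u r2s ltac:(lra).
  by have [n2 z2] := norm_sign r1 a' r1s a'0; apply: off; rewrite ?n1 ?n2 //; lra.
have const x y x' y' : 0 < x < h -> 0 < y < h -> 0 < x' < h -> 0 < y' < h ->
    P x y = P x' y'.
  move=> /andP[? ?] /andP[? ?] /andP[? ?] /andP[? ?]; transitivity (P x' y).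
    by have [l|/ltW l] := leP x x'; [|symmetry]; apply: slide1 => //; apply/andP.
  by have [l|/ltW l] := leP y y'; [|symmetry]; apply: slide2 => //; apply/andP.
have [nb zb] := norm_sign r2 b r2s b0; have [na za] := norm_sign r1 a r1s a0.
have nae : `|r1 * a| < e by rewrite na.
have nbe : `|r2 * b| < e by rewrite nb.
have [b1 b1h Pb1] := corner_color st r2s nae h0 sc.
have Drs : is_unit_sign (- D * r1).
  by case: Ds r1s => [->|->] [->|->]; rewrite /is_unit_sign ?mulr1 ?mulrN1 ?opprK; tauto.
have [c' sc'] := side_exists Drs np.
have [a1 a1h Pa1] := corner_color (strictly_transverse_sym st) r1s nbe h0 sc'.
rewrite (_ : c = c') //; rewrite -Pb1 -Pa1 -/(P a b1) (const _ _ a1 b) ?a0 ?b0 //.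
by rewrite /P -Xst -Yst; congr (kappa _ _); ring.
Qed.

End Sides.

(** * Smooth and piecewise linear curves *)

Section Regularity.
Context {R : realType}.
Implicit Types (X Y : R -> R).

Lemma periodic_passage X Y t (k : int) : (forall t, X (t + 1) = X t) ->
  (forall t, Y (t + 1) = Y t) -> passage X Y t -> passage X Y (t + k%:~R).
Proof.
move=> pX pY [s [ns Xs Ys]]; exists s; split; rewrite ?periodic_int //.
move=> [l hl]; apply: ns; exists (l - k); rewrite intrB -hl; ring.
Qed.

(** An interval of passages would contain more of them, within one period,
    than the finite list holds. *)
Lemma nonpassage_dense X Y a b : (forall t, X (t + 1) = X t) ->
  (forall t, Y (t + 1) = Y t) -> finite_set [set t | 0 <= t < 1 /\ passage X Y t] ->
  a < b -> exists2 t, a < t < b & ~ passage X Y t.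
Proof.
move=> pX pY /finite_seqP[s hs] ab; apply: contrapT => none.
have [k /andP[k0 k1]] := shift_into 0 a.
pose b' := Num.min (b + k%:~R) 1; pose a' := a + k%:~R.
have ab' : a' < b' by rewrite lt_min /a' ltrD2r ab; rewrite add0r in k1.
pose pt (j : nat) : R := a' + (b' - a') * (j.+1%:R / (size s).+2%:R).
have n0 : 0 < (size s).+2%:R :> R by rewrite ltr0n.
have bnd j : (j <= size s)%N -> a' < pt j < b'.
  move=> js; have h0 : 0 < j.+1%:R / (size s).+2%:R :> R by rewrite divr_gt0 ?ltr0n.
  have h1 : j.+1%:R / (size s).+2%:R < 1 :> R by rewrite ltr_pdivrMr // mul1r ltr_nat.
  rewrite /pt; move: ab' h0 h1; set z := _ / _ => h h0 h1; apply/andP; split; nra.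
have inj : injective pt.
  have z1 : b' - a' != 0 by rewrite subr_eq0 gt_eqF.
  have z2 : (size s).+2%:R^-1 != 0 :> R by rewrite invr_eq0 gt_eqF.
  by move=> i j /addrI/(mulfI z1)/(mulIf z2)/eqP; rewrite eqr_nat eqSS => /eqP.
have sub : {subset [seq pt j | j <- iota 0 (size s).+1] <= s}.
  move=> x /mapP[j]; rewrite mem_iota /= add0n ltnS => js ->.
  have /andP[p1 p2] := bnd j js.
  have bb : b' <= b + k%:~R /\ b' <= 1 by rewrite /b' !ge_min !lexx orbT.
  have : [set t | 0 <= t < 1 /\ passage X Y t] (pt j).
    split; first by rewrite /a' in p1; apply/andP; split; lra.
    apply: contrapT => np; apply: none; exists (pt j - k%:~R).
      by rewrite /a' in p1; apply/andP; split; lra.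
    move=> /(periodic_passage k pX pY); by rewrite subrK.
  by rewrite hs.
have := uniq_leq_size _ sub; rewrite map_inj_uniq // iota_uniq size_map size_iota ltnn.
by move=> /(_ isT).
Qed.

Lemma find_right (m : nat) (u : nat -> R) t : u 0%N <= t -> t < u m ->
  exists i, (i < m)%N /\ u i <= t < u i.+1.
Proof.
elim: m => [|m IH] h0 hm; first by move: (le_lt_trans h0 hm); rewrite ltxx.
have [h|h] := ltP t (u m); first by have [i [im hi]] := IH h0 h; exists i; split=> //; apply: ltnW.
by exists m; rewrite ltnSn h hm.
Qed.

Lemma find_left (m : nat) (u : nat -> R) t : u 0%N < t -> t <= u m ->
  exists i, (i < m)%N /\ u i < t <= u i.+1.
Proof.
elim: m => [|m IH] h0 hm; first by move: (lt_le_trans h0 hm); rewrite ltxx.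
have [h|h] := leP t (u m); first by have [i [im hi]] := IH h0 h; exists i; split=> //; apply: ltnW.
by exists m; rewrite ltnSn h hm.
Qed.

Definition affine_right X Y t e a b : Prop :=
  forall h, 0 <= h < e -> X (t + h) = X t + a * h /\ Y (t + h) = Y t + b * h.

Definition affine_left X Y t e a b : Prop :=
  forall h, 0 <= h < e -> X (t - h) = X t - a * h /\ Y (t - h) = Y t - b * h.

Lemma pl_locally_affine X Y t : (forall t, X (t + 1) = X t) ->
  (forall t, Y (t + 1) = Y t) -> pl_curve X Y ->
  exists e a1 b1 a2 b2 : R, [/\ 0 < e, affine_left X Y t e a1 b1 & affine_right X Y t e a2 b2].
Proof.
move=> pX pY [m [u [u0 um ui aff]]].
have [k /andP[k0 k1]] := shift_into 0 t; rewrite add0r in k1.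
have [||i [im /andP[i1 i2]]] := @find_right m u (t + k%:~R); rewrite ?u0 ?um //.
have [p [q [p' [q' h1]]]] := aff i im.
have [l /andP[l0 l1]] := shift_into 0 (- t).
have [||j [jm /andP[j1 j2]]] := @find_left m u (1 - (- t + l%:~R)); rewrite ?u0 ?um; try lra.
have [r [s [r' [s' h2]]]] := aff j jm.
pose d1 := u i.+1 - (t + k%:~R); pose d2 := 1 - (- t + l%:~R) - u j.
have tl : t + (1 - l)%:~R = 1 - (- t + l%:~R) by rewrite intrB; ring.
exists (Num.min d1 d2), s, s', q, q'; split; first by rewrite lt_min /d1 /d2; apply/andP; split; lra.
  move=> h /andP[h0]; rewrite lt_min => /andP[hd1 hd2].
  rewrite -(periodic_int pX (1 - l) (t - h)) -(periodic_int pX (1 - l) t).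
  rewrite -(periodic_int pY (1 - l) (t - h)) -(periodic_int pY (1 - l) t).
  have -> : t - h + (1 - l)%:~R = t + (1 - l)%:~R - h by ring.
  rewrite tl; rewrite /d2 in hd2.
  have [-> ->] := h2 (1 - (- t + l%:~R)) ltac:(apply/andP; split; lra).
  have [-> ->] := h2 (1 - (- t + l%:~R) - h) ltac:(apply/andP; split; lra).
  by split; ring.
move=> h /andP[h0]; rewrite lt_min => /andP[hd1 hd2].
rewrite -(periodic_int pX k (t + h)) -(periodic_int pX k t).
rewrite -(periodic_int pY k (t + h)) -(periodic_int pY k t).
have -> : t + h + k%:~R = t + k%:~R + h by ring.
rewrite /d1 in hd1.
have [-> ->] := h1 (t + k%:~R) ltac:(apply/andP; split; lra).
have [-> ->] := h1 (t + k%:~R + h) ltac:(apply/andP; split; lra).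
by split; ring.
Qed.

Lemma affine_sides_continuous (f : R -> R) t e a b : 0 < e ->
  (forall h, 0 <= h < e -> f (t + h) = f t + a * h) ->
  (forall h, 0 <= h < e -> f (t - h) = f t - b * h) -> {for t, continuous f}.
Proof.
move=> e0 hr hl; apply/cvgrPdist_lt => z z0.
pose m := `|a| + `|b| + 1; have [na nb] := (normr_ge0 a, normr_ge0 b).
have m0 : 0 < m by rewrite /m; lra.
exists (Num.min e (z / m)) => /=; first by rewrite lt_min e0 divr_gt0.
move=> s /=; rewrite lt_min ltr_pdivlMr // => /andP[se sz].
have lin c h : 0 <= h -> `|c| <= m -> h * m < z -> `|f t - (f t + c * h)| < z.
  move=> h0 cm hz; rewrite opprD addrA subrr sub0r normrN normrM (ger0_norm h0).
  by apply: le_lt_trans hz; rewrite mulrC ler_wpM2l.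
have [st|st] := leP t s.
  have h0 : 0 <= s - t by rewrite subr_ge0.
  rewrite distrC ger0_norm // in se sz.
  have -> : s = t + (s - t) by ring.
  by rewrite hr ?h0 //; apply: lin => //; rewrite /m; lra.
have h0 : 0 <= t - s by rewrite subr_ge0 ltW.
rewrite ger0_norm // in se sz.
have -> : s = t - (t - s) by ring.
by rewrite hl ?h0 // -mulNr; apply: lin; rewrite ?normrN //; rewrite /m; lra.
Qed.

(** If the two one-sided velocities at t are nonzero and not opposite, some
    displacement is to the left of both. A zero velocity, or opposite ones,
    would make the curve trace the same points twice during an interval of
    times, hence produce infinitely many passages. *)
Lemma pl_pushable X Y t : (forall t, X (t + 1) = X t) -> (forall t, Y (t + 1) = Y t) ->
  finite_set [set t | 0 <= t < 1 /\ passage X Y t] -> pl_curve X Y ->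
  exists e wx wy : R, 0 < e /\ pushes X Y 1 t e wx wy.
Proof.
move=> pX pY fin pl.
have [e [a1 [b1 [a2 [b2 [e0 hl hr]]]]]] := pl_locally_affine t pX pY pl.
have hit x y : 0 < y - x < 1 -> X x = X y -> Y x = Y y -> passage X Y x /\ passage X Y y.
  move=> xy Xe Ye; split; [exists y|exists x]; split=> // -[k hk].
    by apply: (@not_same_param R x y) => //; exists (- k); rewrite mulrNz -hk opprB.
  by apply: (@not_same_param R x y) => //; exists k.
have dense x y : x < y -> exists2 z, x < z < y & ~ passage X Y z.
  exact: nonpassage_dense.
have right_nz : 0 < a2 ^+ 2 + b2 ^+ 2.
  rewrite lt_def addr_ge0 ?sqr_ge0 // andbT; apply/eqP => sq0.
  have [a20 b20] : a2 = 0 /\ b2 = 0 by split; nra.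
  have m0 : 0 < Num.min e 1 by rewrite lt_min e0 ltr01.
  have [|z /andP[z1 z2] np] := dense t (t + Num.min e 1); first by rewrite ltrDl.
  have [m1 m2] : Num.min e 1 <= e /\ Num.min e 1 <= 1 by rewrite !ge_min !lexx orbT.
  have [q1 q2] := hr (z - t) ltac:(apply/andP; split; lra).
  rewrite (_ : t + (z - t) = z) ?a20 ?b20 ?mul0r ?addr0 in q1 q2; last by ring.
  by have [|_ ] := hit t z _ (esym q1) (esym q2); first by apply/andP; split; lra.
have left_nz : 0 < a1 ^+ 2 + b1 ^+ 2.
  rewrite lt_def addr_ge0 ?sqr_ge0 // andbT; apply/eqP => sq0.
  have [a10 b10] : a1 = 0 /\ b1 = 0 by split; nra.
  have m0 : 0 < Num.min e 1 by rewrite lt_min e0 ltr01.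
  have [|z /andP[z1 z2] np] := dense (t - Num.min e 1) t; first by rewrite gtrBl.
  have [m1 m2] : Num.min e 1 <= e /\ Num.min e 1 <= 1 by rewrite !ge_min !lexx orbT.
  have [q1 q2] := hl (t - z) ltac:(apply/andP; split; lra).
  rewrite (_ : t - (t - z) = z) ?a10 ?b10 ?mul0r ?subr0 in q1 q2; last by ring.
  by have [|? _] := hit z t _ q1 q2; first by apply/andP; split; lra.
have no_cusp : a1 * b2 - b1 * a2 = 0 -> 0 < a1 * a2 + b1 * b2.
  move=> det0; rewrite ltNge; apply/negP => dot.
  (* At a cusp the velocity after t is - c times the one before t, so the times
     t - c (z - t) and z have the same image. *)
  pose c := - (a1 * a2 + b1 * b2) / (a1 ^+ 2 + b1 ^+ 2).
  have nz := lt0r_neq0 left_nz.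
  have cn : c * (a1 ^+ 2 + b1 ^+ 2) = - (a1 * a2 + b1 * b2) by rewrite /c divfK.
  have ca : a2 = - c * a1.
    apply: (mulIf nz); rewrite mulrAC mulNr cn.
    have -> : a2 * (a1 ^+ 2 + b1 ^+ 2) = a1 * (a1 * a2 + b1 * b2) - b1 * (a1 * b2 - b1 * a2) by ring.
    by rewrite det0; ring.
  have cb : b2 = - c * b1.
    apply: (mulIf nz); rewrite mulrAC mulNr cn.
    have -> : b2 * (a1 ^+ 2 + b1 ^+ 2) = b1 * (a1 * a2 + b1 * b2) + a1 * (a1 * b2 - b1 * a2) by ring.
    by rewrite det0; ring.
  have c0 : 0 <= c by rewrite /c divr_ge0 ?oppr_ge0 // ltW.
  pose m := Num.min e 1 / (1 + c).
  have m0 : 0 < Num.min e 1 by rewrite lt_min e0 ltr01.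
  have mp : 0 < m by rewrite /m divr_gt0 // ltr_wpDr.
  have [|z /andP[z1 z2] np] := dense t (t + m); first by rewrite ltrDl.
  have [m1 m2] : Num.min e 1 <= e /\ Num.min e 1 <= 1 by rewrite !ge_min !lexx orbT.
  have zm : (z - t) * (1 + c) < Num.min e 1.
    by rewrite -ltr_pdivlMr ?ltr_wpDr // ltrBlDl.
  have h0 : 0 <= c * (z - t) by apply: mulr_ge0; lra.
  have [q1 q2] := hr (z - t) ltac:(apply/andP; split; lra).
  have [q3 q4] := hl (c * (z - t)) ltac:(apply/andP; split; lra).
  rewrite (_ : t + (z - t) = z) in q1 q2; last by ring.
  have eX : X (t - c * (z - t)) = X z by rewrite q1 q3 ca; ring.
  have eY : Y (t - c * (z - t)) = Y z by rewrite q2 q4 cb; ring.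
  by have [|_ ] := hit _ _ _ eX eY; first by apply/andP; split; lra.
have push wx wy : 0 < a1 * wy - b1 * wx -> 0 < a2 * wy - b2 * wx -> pushes X Y 1 t e wx wy.
  move=> p1 p2 a b ha ab hb; rewrite mul1r.
  have [ta|ta] := leP t a.
    have [q1 q2] := hr (a - t) ltac:(apply/andP; split; lra).
    have [q3 q4] := hr (b - t) ltac:(apply/andP; split; lra).
    rewrite (_ : t + (a - t) = a) in q1 q2; last by ring.
    rewrite (_ : t + (b - t) = b) in q3 q4; last by ring.
    rewrite q1 q2 q3 q4 (_ : _ - _ = (b - a) * (a2 * wy - b2 * wx)); last by ring.
    by rewrite mulr_gt0 // subr_gt0.
  have [q1 q2] := hl (t - a) ltac:(apply/andP; split; lra).
  rewrite (_ : t - (t - a) = a) in q1 q2; last by ring.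
  have [tb|tb] := leP b t.
    have [q3 q4] := hl (t - b) ltac:(apply/andP; split; lra).
    rewrite (_ : t - (t - b) = b) in q3 q4; last by ring.
    rewrite q1 q2 q3 q4 (_ : _ - _ = (b - a) * (a1 * wy - b1 * wx)); last by ring.
    by rewrite mulr_gt0 // subr_gt0.
  have [q3 q4] := hr (b - t) ltac:(apply/andP; split; lra).
  rewrite (_ : t + (b - t) = b) in q3 q4; last by ring.
  rewrite q1 q2 q3 q4.
  rewrite (_ : _ - _ = (t - a) * (a1 * wy - b1 * wx) + (b - t) * (a2 * wy - b2 * wx)); last by ring.
  by rewrite addr_gt0 // mulr_gt0 // subr_gt0.
(* At a left turn from the velocity v1 to v2, the difference v2 - v1 is to
   the left of both; at a right turn, v1 - v2 is; without a turn, the normal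
   of v1. *)
have [lt|lt|eq] := ltgtP 0 (a1 * b2 - b1 * a2).
- by exists e, (a2 - a1), (b2 - b1); split=> //; apply: push; lra.
- by exists e, (a1 - a2), (b1 - b2); split=> //; apply: push; lra.
exists e, (- b1), a1; split=> //; apply: push; first by move: left_nz; rewrite !expr2; lra.
by have := no_cusp (esym eq); lra.
Qed.

End Regularity.

Section Transversality.
Context {R : realType}.
Implicit Types (X Y f : R -> R).

Lemma derive1_slope f t a e (r : R) : derivable f t 1 -> 0 < e -> is_unit_sign r ->
  (forall h, 0 <= h < e -> f (t + r * h) = f t + r * (a * h)) -> a = derive1 f t.
Proof.
move=> df e0 rs lin.
have cv : h^-1 *: (f (h + t) - f t) @[h --> 0^'] --> derive1 f t.
  rewrite derive1E; move: df; rewrite /derivable /derive.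
  set g := (fun h => _); suff -> : (fun h => h^-1 *: (f (h + t) - f t)) = g by [].
  by rewrite funeqE => h; rewrite /g /= [h%:A]mulr1.
apply/eqP/negPn/negP => ne.
have z0 : 0 < `|derive1 f t - a| by rewrite normr_gt0 subr_eq0 eq_sym.
move/cvgrPdist_lt: cv => /(_ _ z0) [d /= d0 hd].
pose h := Num.min d e / 2.
have m0 : 0 < Num.min d e by rewrite lt_min d0.
have [md me] : Num.min d e <= d /\ Num.min d e <= e by rewrite !ge_min !lexx orbT.
have h0 : 0 < h by rewrite divr_gt0.
have [rn r0] : `|r * h| = h /\ r != 0.
  by case: rs => ->; rewrite ?mul1r ?mulN1r ?normrN ?oppr_eq0 oner_eq0 gtr0_norm.
have := hd (r * h); rewrite /= sub0r normrN rn => /(_ _ _).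
have -> : r * h != 0 by rewrite mulf_neq0 // gt_eqF.
rewrite (addrC (r * h)) lin; last by rewrite /h; apply/andP; split; lra.
rewrite (_ : (r * h)^-1 *: _ = a) ?ltxx //; last first.
  rewrite /GRing.scale /= (addrC (f t)) addrK (_ : r * (a * h) = r * h * a); last by ring.
  by rewrite mulKf // mulf_neq0 // gt_eqF.
by move=> H; suff: false by []; apply: H => //; rewrite /h; lra.
Qed.

(** A passage is not a corner, since the coordinates are derivable there; so
    both strands are straight near the crossing. *)
Lemma pl_strictly_transverse X Y s t : (forall t, X (t + 1) = X t) ->
  (forall t, Y (t + 1) = Y t) -> pl_curve X Y ->
  derivable X s 1 -> derivable Y s 1 -> derivable X t 1 -> derivable Y t 1 ->
  det X Y s t != 0 ->
  exists2 e : R, 0 < e & strictly_transverse X Y (if 0 < det X Y s t then 1 else - 1) s t e.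
Proof.
move=> pX pY pl dXs dYs dXt dYt nz.
have straight u : derivable X u 1 -> derivable Y u 1 ->
    exists2 e : R, 0 < e & forall a b, u - e < a < u + e -> u - e < b < u + e ->
      X b - X a = derive1 X u * (b - a) /\ Y b - Y a = derive1 Y u * (b - a).
  move=> dX dY; have [e [a1 [b1 [a2 [b2 [e0 hl hr]]]]]] := pl_locally_affine u pX pY pl.
  have one : is_unit_sign (1 : R) by left. have mone : is_unit_sign (- 1 : R) by right.
  have sa2 : a2 = derive1 X u.
    by apply: derive1_slope dX e0 one _ => h /hr[q _]; rewrite !mul1r q.
  have sb2 : b2 = derive1 Y u.
    by apply: derive1_slope dY e0 one _ => h /hr[_ q]; rewrite !mul1r q.
  have sa1 : a1 = derive1 X u.
    by apply: derive1_slope dX e0 mone _ => h /hl[q _]; rewrite !mulN1r q.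
  have sb1 : b1 = derive1 Y u.
    by apply: derive1_slope dY e0 mone _ => h /hl[_ q]; rewrite !mulN1r q.
  have at_ a : u - e < a < u + e ->
      X a = X u + derive1 X u * (a - u) /\ Y a = Y u + derive1 Y u * (a - u).
    move=> /andP[l1 l2]; have [ua|ua] := leP u a.
      have [q1 q2] := hr (a - u) ltac:(apply/andP; split; lra).
      by rewrite (_ : u + (a - u) = a) in q1 q2; [rewrite q1 q2 sa2 sb2|ring].
    have [q1 q2] := hl (u - a) ltac:(apply/andP; split; lra).
    rewrite (_ : u - (u - a) = a) in q1 q2; last by ring.
    by rewrite q1 q2 sa1 sb1; split; ring.
  by exists e => // a b /at_[-> ->] /at_[-> ->]; split; ring.
have [e1 e10 h1] := straight s dXs dYs; have [e2 e20 h2] := straight t dXt dYt.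
exists (Num.min e1 e2); first by rewrite lt_min e10.
have [m1 m2] : Num.min e1 e2 <= e1 /\ Num.min e1 e2 <= e2 by rewrite !ge_min !lexx orbT.
move=> a a' b b' l1 l2 l3 l4 l5 l6.
have [-> ->] := h1 a a' ltac:(apply/andP; split; lra) ltac:(apply/andP; split; lra).
have [-> ->] := h2 b b' ltac:(apply/andP; split; lra) ltac:(apply/andP; split; lra).
rewrite (_ : _ * _ = (a' - a) * (b' - b) * ((if 0 < det X Y s t then 1 else - 1) * det X Y s t)).
  rewrite mulr_gt0 //; first by rewrite mulr_gt0 // subr_gt0.
  by case: ifPn => h; rewrite ?mul1r // mulN1r oppr_gt0 lt_neqAle nz leNgt.
by rewrite /det; ring.
Qed.

Lemma MVT_everywhere f (a b : R) : (forall t, derivable f t 1) -> a < b ->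
  exists2 c : R, a < c < b & f b - f a = derive1 f c * (b - a).
Proof.
move=> df ab; have [x _||c cab e] := @MVT R f (derive1 f) a b ab.
- by rewrite derive1E; apply: derivableP.
- apply: derivable_within_continuous => x _; exact: df.
by exists c => //; move: cab; rewrite in_itv.
Qed.

Lemma derive1_combination (f g : R -> R) (p q z : R) :
  derivable f z 1 -> derivable g z 1 ->
  derivable (fun z => p * f z + q * g z) z 1 /\
  derive1 (fun z => p * f z + q * g z) z = p * derive1 f z + q * derive1 g z.
Proof.
move=> df dg; have -> : (fun z => p * f z + q * g z) = (p *: f) + (q *: g) by [].
have df' : derivable (p *: f) z 1 by apply: derivableZ.
have dg' : derivable (q *: g) z 1 by apply: derivableZ.
split; first exact: (derivableD df' dg').
by rewrite !derive1E (deriveD df' dg') (deriveZ _ df) (deriveZ _ dg).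
Qed.

Lemma MVT_combination (f g : R -> R) (p q a b : R) :
  (forall t, derivable f t 1) -> (forall t, derivable g t 1) -> a < b ->
  exists2 c : R, a < c < b &
    p * (f b - f a) + q * (g b - g a) = (p * derive1 f c + q * derive1 g c) * (b - a).
Proof.
move=> df dg ab.
have [t|c cab e] := @MVT_everywhere (fun z => p * f z + q * g z) a b _ ab.
  by have [] := derive1_combination p q (df t) (dg t).
exists c => //; have [_ <-] := derive1_combination p q (df c) (dg c).
by rewrite -e; ring.
Qed.

(** The mean value theorem for each strand turns the determinant of two chords
    into the determinant of the velocities at two intermediate times, which
    keeps its sign near the crossing. *)
Lemma smooth_strictly_transverse X Y s t : smooth_fun X -> smooth_fun Y ->
  det X Y s t != 0 ->
  exists2 e : R, 0 < e & strictly_transverse X Y (if 0 < det X Y s t then 1 else - 1) s t e.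
Proof.
move=> sX sY nz; set D := if _ then _ else _.
have dX : forall t, derivable X t 1 := sX 0%N. have dY : forall t, derivable Y t 1 := sY 0%N.
have c1X : continuous (derive1 X).
  by move=> x; apply: differentiable_continuous; apply/derivable1_diffP; apply: (sX 1%N).
have c1Y : continuous (derive1 Y).
  by move=> x; apply: differentiable_continuous; apply/derivable1_diffP; apply: (sY 1%N).
have D0 : 0 < D * det X Y s t.
  by rewrite /D; case: ifPn => h; rewrite ?mul1r // mulN1r oppr_gt0 lt_neqAle nz leNgt.
have [e e0 pos] : exists2 e : R, 0 < e & forall a b, `|a - s| < e -> `|b - t| < e ->
    0 < D * det X Y a b.
  have cv : D * det X Y z.1 z.2 @[z --> ((s, t) : R * R)] --> D * det X Y s t.
    have k1 : z.1 @[z --> ((s, t) : R * R)] --> s by exact: cvg_fst.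
    have k2 : z.2 @[z --> ((s, t) : R * R)] --> t by exact: cvg_snd.
    apply: cvgMr; rewrite /det; apply: cvgB; apply: cvgM.
    - by apply: (cvg_comp _ _ k1); apply: c1X.
    - by apply: (cvg_comp _ _ k2); apply: c1Y.
    - by apply: (cvg_comp _ _ k1); apply: c1Y.
    - by apply: (cvg_comp _ _ k2); apply: c1X.
  move/cvgrPdist_lt: cv => /(_ _ D0)/nbhs_ballP[e /= e0 he].
  exists e => // a b ha hb.
  have := he (a, b); rewrite /= ltr_norml => /(_ _) H.
  suff /andP[_] : - (D * det X Y s t) < D * det X Y s t - D * det X Y a b < D * det X Y s t by lra.
  by apply: H; split; rewrite /ball /= distrC.
exists e => // a a' b b' l1 l2 l3 l4 l5 l6.
(* The mean value theorem has no vector form: it is applied to the component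
   of one strand normal to the chord, then to the velocity, of the other. *)
have [c /andP[c1 c2] eX] := MVT_combination (Y b' - Y b) (- (X b' - X b)) dX dY l2.
have [c' /andP[c'1 c'2] eY] := MVT_combination (derive1 X c) (- derive1 Y c) dY dX l5.
have -> : (X a' - X a) * (Y b' - Y b) - (Y a' - Y a) * (X b' - X b) =
   (a' - a) * (b' - b) * det X Y c c'.
  transitivity ((derive1 X c * (Y b' - Y b) + - derive1 Y c * (X b' - X b)) * (a' - a)).
    transitivity ((Y b' - Y b) * (X a' - X a) + - (X b' - X b) * (Y a' - Y a)); first by ring.
    by rewrite eX; ring.
  by rewrite eY /det; ring.
rewrite mulrCA mulr_gt0 //; first by rewrite mulr_gt0 // subr_gt0.
by apply: pos; rewrite ltr_norml; clear -c1 c2 c'1 c'2 l1 l3 l4 l6; apply/andP; split; lra.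
Qed.

(** The normal of the velocity at t: by continuity all velocities near t,
    hence all short chords, have a positive component along the velocity at t. *)
Lemma smooth_pushable X Y t : smooth_fun X -> smooth_fun Y ->
  derive1 X t != 0 \/ derive1 Y t != 0 ->
  exists e wx wy : R, 0 < e /\ pushes X Y 1 t e wx wy.
Proof.
move=> sX sY nz.
have dX : forall t, derivable X t 1 := sX 0%N. have dY : forall t, derivable Y t 1 := sY 0%N.
pose p := derive1 X t; pose q := derive1 Y t.
have n0 : 0 < p * p + q * q.
  have h1 := sqr_ge0 p; have h2 := sqr_ge0 q; rewrite !expr2 in h1 h2.
  have [hp|hq] := nz.
    by have : 0 < p * p; [rewrite -expr2 exprn_even_gt0|lra].
  by have : 0 < q * q; [rewrite -expr2 exprn_even_gt0|lra].
have c1X : {for t, continuous (derive1 X)}.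
  by apply: differentiable_continuous; apply/derivable1_diffP; apply: (sX 1%N).
have c1Y : {for t, continuous (derive1 Y)}.
  by apply: differentiable_continuous; apply/derivable1_diffP; apply: (sY 1%N).
have cv : p * derive1 X z + q * derive1 Y z @[z --> t] --> p * p + q * q.
  by apply: cvgD; apply: cvgMr.
move/cvgrPdist_lt: cv => /(_ _ n0)/nbhs_ballP[e /= e0 he].
exists e, (- q), p; split=> // a b ha ab hb; rewrite mul1r.
have [c /andP[ac cb] ec] := MVT_combination p q dX dY ab.
have -> : (X b - X a) * p - (Y b - Y a) * - q = p * (X b - X a) + q * (Y b - Y a) by ring.
rewrite ec mulr_gt0 ?subr_gt0 //.
have : `|t - c| < e by rewrite ltr_norml; apply/andP; split; lra.
by move=> /he; rewrite /= ltr_norml => /andP[_]; lra.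
Qed.
End Transversality.

(** * Two-colouring by a loop *)

Section Loop.
Context {R : realType}.
Variables (X Y : R -> R).

(** The winding parity of the loop, computed in orthogonal coordinates in
    which the pushing displacement w at t1 points upwards. In these
    coordinates the curve passes t1 from left to right, so that the parity
    jumps there. *)
Lemma loop_coloring p q t1 e wx wy : continuous X -> continuous Y ->
  p < q -> X p = X q -> Y p = Y q -> p < t1 -> t1 < q -> 0 < e ->
  pushes X Y 1 t1 e wx wy ->
  (forall t, p <= t <= q -> X t = X t1 -> Y t = Y t1 -> t = t1) ->
  exists kappa : R -> R -> bool,
    [/\ forall x y, (forall t, p <= t <= q -> X t = x -> Y t = y -> False) ->
          exists2 r : R, 0 < r & forall x' y', `|x' - x| < r -> `|y' - y| < r ->
            kappa x' y' = kappa x y &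
        forall c c', side X Y kappa 1 t1 c -> side X Y kappa (- 1) t1 c' -> c != c'].
Proof.
move=> cX cY pq Xpq Ypq pt1 t1q e0 pw simple.
pose f t := wy * X t - wx * Y t; pose g t := wx * X t + wy * Y t.
pose kappa x y := winding_parity f g p q (wy * x - wx * y) (wx * x + wy * y).
have cf : continuous f by move=> t; apply: cvgB; apply: cvgMr; [apply: cX|apply: cY].
have cg : continuous g by move=> t; apply: cvgD; apply: cvgMr; [apply: cX|apply: cY].
pose n := wx ^+ 2 + wy ^+ 2.
have n0 : 0 < n.
  rewrite lt_def addr_ge0 ?sqr_ge0 // andbT; apply/eqP => nz.
  have [x0 y0] : wx = 0 /\ wy = 0 by move: nz; rewrite /n; split; nra.
  by have := pw (t1 - e / 2) t1 ltac:(lra) ltac:(lra) ltac:(lra); rewrite x0 y0; lra.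
have back x y x' y' : wy * x - wx * y = wy * x' - wx * y' ->
    wx * x + wy * y = wx * x' + wy * y' -> x = x' /\ y = y'.
  move=> h1 h2; have nz := lt0r_neq0 n0; split; apply: (mulIf nz); rewrite /n.
    transitivity (wx * (wx * x + wy * y) + wy * (wy * x - wx * y)); first by ring.
    by rewrite h1 h2; ring.
  transitivity (wy * (wx * x + wy * y) - wx * (wy * x - wx * y)); first by ring.
  by rewrite h1 h2; ring.
have fpq : f p = f q by rewrite /f Xpq Ypq.
have gpq : g p = g q by rewrite /g Xpq Ypq.
exists kappa; split.
  move=> x y off.
  have [|r r0 hr] := winding_parity_locally_constant pq cf cg fpq gpq
     (x := wy * x - wx * y) (y := wx * x + wy * y).
    by move=> t tpq h1 h2; have [ex ey] := back _ _ _ _ h1 h2; apply: (off t).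
  pose m := `|wx| + `|wy| + 1; have [nx ny] := (normr_ge0 wx, normr_ge0 wy).
  have m0 : 0 < m by rewrite /m; lra.
  exists (r / m); first by rewrite divr_gt0.
  move=> x' y'; rewrite !ltr_pdivlMr // => hx hy; apply: hr.
    have -> : wy * x' - wx * y' - (wy * x - wx * y) = wy * (x' - x) + - wx * (y' - y) by ring.
    apply: le_lt_trans (ler_normD _ _) _; rewrite !normrM normrN.
    have := normr_ge0 (x' - x); have := normr_ge0 (y' - y); move: hx hy; rewrite /m; nra.
  have -> : wx * x' + wy * y' - (wx * x + wy * y) = wx * (x' - x) + wy * (y' - y) by ring.
  apply: le_lt_trans (ler_normD _ _) _; rewrite !normrM.
  have := normr_ge0 (x' - x); have := normr_ge0 (y' - y); move: hx hy; rewrite /m; nra.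
move=> c c' s1 s2.
have [||h h0 jump] := winding_parity_jump pq cf cg e0 pt1 (ltW t1q).
- move=> a b l1 ab l2; have := pw a b l1 ab l2; rewrite mul1r => h.
  by rewrite -subr_gt0 (_ : f b - f a = (X b - X a) * wy - (Y b - Y a) * wx) // /f; ring.
- by move=> t tpq h1 h2; have [ex ey] := back _ _ _ _ h1 h2; apply: simple.
have [h1 h10 k1] := s1 e e0; have [h2 h20 k2] := s2 e e0.
pose m := `|wx| + `|wy| + 1; have [nx ny] := (normr_ge0 wx, normr_ge0 wy).
have m0 : 0 < m by rewrite /m; lra.
pose z := Num.min (h / n) (Num.min (h1 / m) (h2 / m)) / 2.
have z0' : 0 < Num.min (h / n) (Num.min (h1 / m) (h2 / m)) by rewrite !lt_min !divr_gt0.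
have z0 : 0 < z by rewrite /z divr_gt0.
have : z < Num.min (h / n) (Num.min (h1 / m) (h2 / m)) by rewrite /z; lra.
rewrite !lt_min => /and3P[zh zh1 zh2]; rewrite !ltr_pdivlMr // in zh zh1 zh2.
have wxm : z * `|wx| <= z * m by rewrite ler_pM2l // /m; lra.
have wym : z * `|wy| <= z * m by rewrite ler_pM2l // /m; lra.
have zx : `|z * wx| = z * `|wx| by rewrite normrM gtr0_norm.
have zy : `|z * wy| = z * `|wy| by rewrite normrM gtr0_norm.
have pz : pushes X Y 1 t1 e (z * wx) (z * wy) by apply: pushes_scale.
have pz' : pushes X Y (- 1) t1 e (- (z * wx)) (- (z * wy)).
  by move=> a b l1 ab l2; have := pz a b l1 ab l2; congr (_ < _); ring.
have [x1 y1] : `|z * wx| < h1 /\ `|z * wy| < h1.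
  by rewrite zx zy (le_lt_trans wxm) // (le_lt_trans wym).
have [x2 y2] : `|- (z * wx)| < h2 /\ `|- (z * wy)| < h2.
  by rewrite !normrN zx zy (le_lt_trans wxm) // (le_lt_trans wym).
rewrite -(k1 _ _ x1 y1 pz) -(k2 _ _ x2 y2 pz').
have jz : 0 < z * n < h by rewrite mulr_gt0.
have := jump _ jz; rewrite eq_sym /kappa; congr (_ != _); congr (winding_parity f g p q _ _);
  rewrite /f /g /n; ring.
Qed.
End Loop.

Local Close Scope classical_set_scope.
Local Close Scope ring_scope.
Local Open Scope fset_scope.
Local Open Scope nat_scope.


(** * Numbered symbols *)

(** Numbered symbols in terms of membership instead of a permutation of lists,
    and with the number M of labels made explicit; in this form the axioms
    pass through relabellings. *)
Definition labelled (M : nat) (A : symbol) : Prop :=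
  [/\ forall c, c \in A -> is_sign (sign c),
      forall c, c \in A -> over c != under c,
      forall c d x, c \in A -> d \in A -> has_label x c -> has_label x d -> c = d &
      forall x, (1 <= x <= M) <-> exists2 c, c \in A & has_label x c].

Lemma mem_labels (A : symbol) x :
  reflect (exists2 c, c \in A & has_label x c) (x \in labels A).
Proof.
rewrite mem_cat; apply: (iffP orP).
  by move=> [] /mapP[c cA ->]; exists c; rewrite // /has_label eqxx ?orbT.
by move=> [c cA /orP[]/eqP<-]; [left|right]; apply: map_f.
Qed.

Lemma map_uniq_inj (T U : eqType) (f : T -> U) (s : seq T) : uniq [seq f i | i <- s] ->
  {in s &, injective f}.
Proof.
elim: s => //= a s IH /andP[afs /IH inj] x y; rewrite !inE.
move=> /predU1P[->|xs] /predU1P[->|ys] // fe; last exact: inj.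
  by rewrite fe map_f in afs.
by rewrite -fe map_f in afs.
Qed.

Lemma labelled_numbered M A : labelled M A -> numbered A /\ M = (order A).*2.
Proof.
move=> [sg ou lu lm].
have ul : uniq (labels A).
  rewrite cat_uniq !map_inj_in_uniq ?fset_uniq //=; first last.
  - by move=> c d cA dA e; apply: (lu c d (over c)) => //; rewrite /has_label ?e eqxx.
  - by move=> c d cA dA e; apply: (lu c d (under c)) => //; rewrite /has_label ?e eqxx orbT.
  rewrite andbT; apply/hasPn => x /mapP[c cA ->]; apply/negP => /mapP[d dA e].
  have cd : c = d by apply: (lu c d (under c)) => //; rewrite /has_label ?e eqxx ?orbT.
  by have := ou d dA; rewrite -e cd eqxx.
have pl : perm_eq (labels A) (iota 1 M).
  apply: uniq_perm; rewrite ?iota_uniq // => x.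
  rewrite mem_iota add1n ltnS; apply/mem_labels/idP => /lm //.
have e : M = (order A).*2.
  by have := perm_size pl; rewrite size_iota size_cat !size_map addnn => ->.
by rewrite /numbered -e.
Qed.

Lemma numbered_labelled A : numbered A -> labelled (order A).*2 A.
Proof.
move=> [sg pl]; have ul : uniq (labels A) by rewrite (perm_uniq pl) iota_uniq.
move: (ul); rewrite cat_uniq => /and3P[u1 /hasPn dj u2].
have no c d : c \in A -> d \in A -> over c != under d.
  move=> cA dA; apply/eqP => e; have := dj (under d); rewrite map_f // => /(_ isT).
  by rewrite -e map_f.
split=> //.
- by move=> c cA; apply: no.
- move=> c d x cA dA /orP[]/eqP <- /orP[] /eqP h.
  + by apply: (map_uniq_inj u1).
  + by have := no c d cA dA; rewrite h eqxx.
  + by have := no d c dA cA; rewrite h eqxx.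
  + by apply: (map_uniq_inj u2).
move=> x; have := perm_mem pl x; rewrite mem_iota add1n ltnS => <-.
by split=> /mem_labels.
Qed.

Lemma mem_relabel f A c :
  reflect (exists2 d, d \in A & c = (f (over d), f (under d), sign d)) (c \in relabel f A).
Proof.
rewrite /relabel; apply: (iffP (imfsetP _ _ _ _)) => [[d /= dA ->]|[d dA ->]]; first by exists d.
by exists d.
Qed.

Lemma eq_relabel f g A : (forall c x, c \in A -> has_label x c -> f x = g x) ->
  relabel f A = relabel g A.
Proof.
move=> fg; apply/fsetP => c; apply/mem_relabel/mem_relabel => -[d dA ->]; exists d => //.
  by rewrite !(fg d) // /has_label eqxx ?orbT.
by rewrite !(fg d) // /has_label eqxx ?orbT.
Qed.

Lemma relabel_comp f g A : relabel f (relabel g A) = relabel (f \o g) A.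
Proof.
apply/fsetP => c; apply/mem_relabel/mem_relabel.
  by move=> [d /mem_relabel[d' d'A ->] ->]; exists d'.
move=> [d dA ->]; exists (g (over d), g (under d), sign d) => //.
by apply/mem_relabel; exists d.
Qed.

Lemma relabel_id f A : (forall c x, c \in A -> has_label x c -> f x = x) ->
  relabel f A = A.
Proof.
move=> fid; apply/fsetP => c; apply/mem_relabel/idP => [[d dA ->]|cA]; last exists c => //.
  by rewrite !(fid d) // ?/has_label ?eqxx ?orbT //; move: dA; case: d => [[]].
by rewrite !(fid c) // ?/has_label ?eqxx ?orbT //; case: c {cA} => [[]].
Qed.

Lemma relabelU f A B : relabel f (A `|` B) = relabel f A `|` relabel f B.
Proof.
apply/fsetP => c; rewrite in_fsetU; apply/mem_relabel/orP.
  by move=> [d]; rewrite in_fsetU => /orP[] dA ->; [left|right]; apply/mem_relabel; exists d.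
by move=> [] /mem_relabel[d dA ->]; exists d; rewrite // in_fsetU dA ?orbT.
Qed.

Lemma relabel1 f c : relabel f [fset c] = [fset (f (over c), f (under c), sign c)].
Proof.
apply/fsetP => d; rewrite in_fset1; apply/mem_relabel/eqP.
  by move=> [c']; rewrite in_fset1 => /eqP -> ->.
by move=> ->; exists c; rewrite // in_fset1.
Qed.

Lemma relabel0 f : relabel f fset0 = fset0.
Proof. by apply/fsetP => c; rewrite in_fset0; apply/mem_relabel => -[d]; rewrite in_fset0. Qed.

Lemma relabel_labelled M M' f g A : labelled M A ->
  (forall x, 1 <= x <= M -> 1 <= f x <= M' /\ g (f x) = x) ->
  (forall y, 1 <= y <= M' -> exists2 x, 1 <= x <= M & f x = y) ->
  labelled M' (relabel f A).
Proof.
move=> [sg ou lu lm] fM fs.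
have lab c x : c \in A -> has_label x c -> 1 <= x <= M by move=> cA xc; apply/lm; exists c.
have labo c : c \in A -> 1 <= over c <= M by move=> cA; apply: (lab c); rewrite // /has_label eqxx.
have labu c : c \in A -> 1 <= under c <= M by move=> cA; apply: (lab c); rewrite // /has_label eqxx orbT.
have inj x y : 1 <= x <= M -> 1 <= y <= M -> f x = f y -> x = y.
  by move=> /fM[_ {2}<-] /fM[_ {2}<-] ->.
split.
- by move=> c /mem_relabel[d /sg ? ->].
- move=> c /mem_relabel[d dA ->]; apply/eqP => /= /inj e; have := ou d dA.
  by rewrite e ?eqxx //; [apply: labo|apply: labu].
- move=> c c' x /mem_relabel[d dA ->] /mem_relabel[d' d'A ->].
  move=> /orP[] /eqP /= <- /orP[] /eqP /= /inj e; (rewrite (_ : d = d') //).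
  + apply: (lu d d' (over d)) => //; rewrite /has_label ?eqxx //.
    by rewrite e ?eqxx //; apply: labo.
  + apply: (lu d d' (over d)) => //; rewrite /has_label ?eqxx //.
    by rewrite e ?eqxx ?orbT //; [apply: labu|apply: labo].
  + apply: (lu d d' (under d)) => //; rewrite /has_label ?eqxx ?orbT //.
    by rewrite e ?eqxx ?orbT //; [apply: labo|apply: labu].
  + apply: (lu d d' (under d)) => //; rewrite /has_label ?eqxx ?orbT //.
    by rewrite e ?eqxx ?orbT //; apply: labu.
move=> y; split.
  move=> /fs[x /lm[c cA xc] <-]; exists (f (over c), f (under c), sign c).
    by apply/mem_relabel; exists c.
  by case/orP: xc => /eqP <-; rewrite /has_label /= eqxx ?orbT.
move=> [c /mem_relabel[d dA ->] /orP[]/eqP/= <-].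
  by have [] := fM _ (labo d dA).
by have [] := fM _ (labu d dA).
Qed.

Lemma perm_labels_relabel f (A : symbol) :
  {in A &, injective (fun c => (f (over c), f (under c), sign c))} ->
  perm_eq (labels (relabel f A)) [seq f x | x <- labels A].
Proof.
move=> inj; pose F (c : crossing) : crossing := (f (over c), f (under c), sign c).
have p : perm_eq (enum_fset (relabel f A)) [seq F c | c <- enum_fset A].
  apply: uniq_perm; rewrite ?fset_uniq // ?map_inj_in_uniq ?fset_uniq // => c.
  by apply/mem_relabel/mapP => -[d dA ->]; exists d.
rewrite /labels map_cat -!map_comp; apply: perm_cat.
  by rewrite (perm_trans (perm_map over p)) // -map_comp.
by rewrite (perm_trans (perm_map under p)) // -map_comp.
Qed.

(** The number of labels not above f x is the number of labels not above x,
    and this is x itself. *)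
Lemma compress_relabel f A : numbered A ->
  (forall x y, 1 <= x -> x < y -> y <= (order A).*2 -> f x < f y) ->
  compress (relabel f A) = A.
Proof.
move=> nA incr; have [_ ou lu lm] := numbered_labelled nA; have [_ pl] := nA.
have lab c x : c \in A -> has_label x c -> 1 <= x <= (order A).*2.
  by move=> cA xc; apply/lm; exists c.
have le_f x y : 1 <= x <= (order A).*2 -> 1 <= y <= (order A).*2 -> (f x <= f y) = (x <= y).
  move=> /andP[x1 x2] /andP[y1 y2]; have [xy|yx] := leqP x y; last first.
    by apply/negbTE; rewrite -ltnNge incr.
  by move: xy; rewrite leq_eqVlt => /orP[/eqP->|xy]; rewrite ?leqnn // ltnW ?incr.
have fi x y : 1 <= x <= (order A).*2 -> 1 <= y <= (order A).*2 -> f x = f y -> x = y.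
  by move=> hx hy e; apply/eqP; rewrite eqn_leq -(le_f x y) // -(le_f y x) // e leqnn.
rewrite /compress relabel_comp; apply: relabel_id => c x cA xc /=.
have xl := lab c x cA xc.
rewrite (permP (perm_labels_relabel _)); last first.
  move=> a b aA bA [/fi e _ _]; apply: (lu a b (over a)) => //; rewrite /has_label ?eqxx //.
  by rewrite e ?eqxx //; [apply: (lab a)|apply: (lab b)]; rewrite // /has_label eqxx.
rewrite count_map (permP pl).
rewrite (@eq_in_count _ _ (fun y => y <= x)); last first.
  by move=> y; rewrite mem_iota add1n ltnS /= => hy; rewrite le_f.
move/andP: xl => [x1 x2]; rewrite -(subnKC x2) iotaD count_cat.
have -> : count (fun y => y <= x) (iota (1 + x) ((order A).*2 - x)) = 0.
  apply/eqP; rewrite -leqn0 leqNgt -has_count; apply/hasPn => y.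
  by rewrite mem_iota -ltnNge add1n => /andP[].
rewrite addn0 -[RHS](size_iota 1) -(count_predT (iota 1 x)); apply: eq_in_count => y.
by rewrite mem_iota add1n ltnS => /andP[_ ->].
Qed.


(** * Cyclic labels and turns *)

Lemma shift_bounds N c x : 0 < N -> 1 <= shift N c x <= N.
Proof. by move=> N0; rewrite /shift /= ltn_mod. Qed.

Lemma shift_shift N a b x : shift N a (shift N b x) = shift N (a + b) x.
Proof. by rewrite /shift /= modnDml -addnA (addnC b). Qed.

Lemma shift_mult N k x : 1 <= x <= N -> shift N (k * N) x = x.
Proof.
by case: x => // x /andP[_ xN]; rewrite /shift /= addnC modnMDl modn_small.
Qed.

Lemma shift0 N x : 1 <= x <= N -> shift N 0 x = x.
Proof. exact: (@shift_mult N 0). Qed.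

Lemma shift_self N x : 1 <= x <= N -> shift N N x = x.
Proof. by move=> xN; rewrite -{2}(mul1n N) shift_mult. Qed.

Lemma shift_inverse N c : exists c', forall x, 1 <= x <= N ->
  shift N c' (shift N c x) = x /\ shift N c (shift N c' x) = x.
Proof.
case: (posnP N) => [->|N0]; first by exists 0 => -[].
(* N - 1 is -1 modulo N. *)
exists (c * N.-1) => x xN; rewrite !shift_shift.
have e : c * N.-1 + c = c * N by rewrite -mulnSr prednK.
by rewrite (addnC c) e shift_mult.
Qed.

Lemma next_shift N x : 1 <= x <= N -> shift N 1 x = if x == N then 1 else x.+1.
Proof.
case: x => // x /andP[_ xN]; rewrite /shift /= addn1.
by case: eqP => [->|/eqP h]; rewrite ?modnn // modn_small // ltn_neqAle h.
Qed.

Lemma prev_shift N x : 1 <= x <= N -> shift N N.-1 x = if x == 1 then N else x.-1.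
Proof.
case: x => // x /andP[_ xN]; rewrite /shift /=.
case: x xN => [|x] xN; first by rewrite add0n modn_small ?prednK.
have -> : x.+1 + N.-1 = x + N by lia.
by rewrite eqSS modnDr modn_small // ltnW.
Qed.

Section Labels.
Variable A : symbol.
Hypothesis nA : numbered A.
Let N := (order A).*2.
Let labA := numbered_labelled nA.

Lemma sign_of c : c \in A -> is_sign (sign c).
Proof. by case: labA => h _ _ _; apply: h. Qed.

Lemma label_bounds c x : c \in A -> has_label x c -> 1 <= x <= N.
Proof. by case: labA => _ _ _ h cA xc; apply/h; exists c. Qed.

Lemma over_bounds c : c \in A -> 1 <= over c <= N.
Proof. by move=> cA; apply: label_bounds cA _; rewrite /has_label eqxx. Qed.

Lemma under_bounds c : c \in A -> 1 <= under c <= N.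
Proof. by move=> cA; apply: label_bounds cA _; rewrite /has_label eqxx orbT. Qed.

Lemma label_crossing x : 1 <= x <= N -> exists2 c, c \in A & has_label x c.
Proof. by case: labA => _ _ _ h; move/h. Qed.

Lemma label_inj c d x : c \in A -> d \in A -> has_label x c -> has_label x d -> c = d.
Proof. by case: labA => _ _ h _; apply: h. Qed.

Lemma over_neq_under c : c \in A -> over c != under c.
Proof. by case: labA => _ h _ _; apply: h. Qed.

Lemma crossing_atE c x : c \in A -> has_label x c -> crossing_at A x = c.
Proof.
move=> cA xc; rewrite /crossing_at.
have : c \in [seq c0 <- enum_fset A | has_label x c0] by rewrite mem_filter xc.
case e : [seq c0 <- enum_fset A | has_label x c0] => [//|d s] _ /=.
have : d \in [seq c0 <- enum_fset A | has_label x c0] by rewrite e mem_head.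
by rewrite mem_filter => /andP[xd dA]; apply: label_inj xd xc.
Qed.

Lemma height_over c : c \in A -> height A (over c) = 1%R.
Proof. by move=> cA; rewrite /height map_f. Qed.

Lemma height_under c : c \in A -> height A (under c) = (-1)%R.
Proof.
move=> cA; rewrite /height; case: ifP => // /mapP[d dA e].
have cd : c = d by apply: (label_inj (x := under c)); rewrite // /has_label ?eqxx ?orbT // -e eqxx.
by have := over_neq_under dA; rewrite -e cd eqxx.
Qed.

Lemma turn_over phi f c : c \in A -> over c = last_end A f ->
  turn A phi f = if (or_sign phi * f.2 * sign c == 1)%R then (under c, 1%R)
                 else (prev_label A (under c), (-1)%R).
Proof.
move=> cA oc; rewrite /turn -oc (@crossing_atE c) /has_label ?eqxx //.
by rewrite /other_label eqxx height_under // mulrN1 opprK.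
Qed.

Lemma turn_under phi f c : c \in A -> under c = last_end A f ->
  turn A phi f = if (or_sign phi * f.2 * sign c == -1)%R then (over c, 1%R)
                 else (prev_label A (over c), (-1)%R).
Proof.
move=> cA oc; rewrite /turn -oc (@crossing_atE c) /has_label ?eqxx ?orbT //.
by rewrite /other_label (negbTE (over_neq_under cA)) height_over // mulr1 eqr_oppLR.
Qed.

Lemma next_bounds x : 1 <= x <= N -> 1 <= next_label A x <= N.
Proof. by move=> /andP[x1 xN]; apply: shift_bounds; apply: leq_trans xN. Qed.

Lemma prev_bounds x : 1 <= x <= N -> 1 <= prev_label A x <= N.
Proof. by move=> /andP[x1 xN]; apply: shift_bounds; apply: leq_trans xN. Qed.

Lemma nextE x : 1 <= x <= N -> next_label A x = if x == N then 1 else x.+1.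
Proof. exact: next_shift. Qed.

Lemma prevE x : 1 <= x <= N -> prev_label A x = if x == 1 then N else x.-1.
Proof. exact: prev_shift. Qed.

Lemma prev_next x : 1 <= x <= N -> prev_label A (next_label A x) = x.
Proof.
move=> xN; rewrite /prev_label /next_label shift_shift addn1 prednK.
  exact: shift_self.
by case/andP: xN => x1; apply: leq_trans.
Qed.

Lemma next_prev x : 1 <= x <= N -> next_label A (prev_label A x) = x.
Proof.
move=> xN; rewrite /prev_label /next_label shift_shift add1n prednK.
  exact: shift_self.
by case/andP: xN => x1; apply: leq_trans.
Qed.

Lemma last_end_bounds f : is_main_arc A f -> 1 <= last_end A f <= N.
Proof. by case: f => x e [/= xb es]; rewrite /last_end /=; case: eqP => // _; apply: next_bounds. Qed.

Lemma or_sign_is phi : is_sign (or_sign phi).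
Proof. by case: phi; [left|right]. Qed.

Lemma turn_main phi f : is_main_arc A f -> is_main_arc A (turn A phi f).
Proof.
move=> mf; have [c cA] := label_crossing (last_end_bounds mf).
move=> /orP[/eqP h|/eqP h]; [rewrite (turn_over phi cA h)|rewrite (turn_under phi cA h)].
  have ub := under_bounds cA; case: ifP => _; split; rewrite /basic_arc //=; try by [left|right].
  exact: prev_bounds.
have ub := over_bounds cA; case: ifP => _; split; rewrite /basic_arc //=; try by [left|right].
exact: prev_bounds.
Qed.

(** The crossing at which f turns and the sign of f can be read off the
    result. *)
Lemma turn_inj phi f g : is_main_arc A f -> is_main_arc A g ->
  turn A phi f = turn A phi g -> f = g.
Proof.
move=> mf mg.
have back (h : main_arc) : is_main_arc A h ->
    h = if h.2 == 1%R then (prev_label A (last_end A h), 1%R) else (last_end A h, (-1)%R).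
  case: h => x e [/= xb [->|->]]; rewrite /last_end /=; last by [].
  by rewrite prev_next.
have out (h : main_arc) : is_main_arc A h -> exists c x y,
    [/\ c \in A, has_label x c, has_label y c, x != y & x = last_end A h] /\
    exists e : int, [/\ is_sign e, turn A phi h = if (e * h.2 == 1)%R then (y, 1%R) else (prev_label A y, (-1)%R)
       & forall c' , c' \in A -> has_label y c' -> e = (- (or_sign phi * sign c' * height A y))%R].
  move=> mh; have [c cA hx] := label_crossing (last_end_bounds mh).
  have [c1|c1] := boolP (over c == last_end A h).
    exists c, (over c), (under c); rewrite /has_label !eqxx !orbT (eqP c1).
    split; first by split=> //; rewrite -(eqP c1) over_neq_under.
    exists (or_sign phi * sign c)%R; split.
    - by case: (or_sign_is phi) (sign_of cA) => [->|->] [->|->]; [left|right|right|left].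
    - by rewrite (turn_over phi cA (eqP c1)) mulrAC.
    move=> c' c'A hc'; have -> : c' = c by apply: label_inj c'A cA hc' _; rewrite /has_label eqxx orbT.
    by rewrite height_under // mulrN1 opprK.
  have c2 : under c = last_end A h by move: hx; rewrite /has_label (negbTE c1) => /eqP.
  exists c, (under c), (over c); rewrite /has_label !eqxx !orbT.
  split; first by split=> //; rewrite eq_sym over_neq_under.
  exists (- (or_sign phi * sign c))%R; split.
  - by case: (or_sign_is phi) (sign_of cA) => [->|->] [->|->]; [right|left|left|right].
  - rewrite (turn_under phi cA c2) mulNr eqr_oppLR.
    by rewrite -mulrA (mulrC h.2) mulrA.
  move=> c' c'A hc'; have -> : c' = c by apply: label_inj c'A cA hc' _; rewrite /has_label eqxx.
  by rewrite height_over // mulr1.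
have [c [x [y [[cA xc yc xy xf] [e [es te he]]]]]] := out f mf.
have [c' [x' [y' [[c'A x'c y'c xy' xg] [e' [es' te' he']]]]]] := out g mg.
have inj u v : 1 <= u <= N -> 1 <= v <= N -> prev_label A u = prev_label A v -> u = v.
  by move=> ub vb h; rewrite -(next_prev ub) -(next_prev vb) h.
have yb := label_bounds cA yc; have yb' := label_bounds c'A y'c.
rewrite te te' => tt.
have [s1 s2] : is_sign f.2 /\ is_sign g.2 by split; [case: mf|case: mg].
have [yy ee] : y = y' /\ (e * f.2 == 1)%R = (e' * g.2 == 1)%R.
  have := congr1 snd tt; have := congr1 fst tt.
  case: (e * f.2 == 1)%R; case: (e' * g.2 == 1)%R => //= h1 _; split=> //.
  exact: inj.
have eq_e : e = e' by rewrite (he c cA yc) (he' c cA) // -yy.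
have f2 : f.2 = g.2.
  move: ee; rewrite eq_e; by case: es' s1 s2 => [->|->] [->|->] [->|->].
have cc : c = c' by apply: (label_inj (x := y)) => //; rewrite yy.
have xx : x = x'.
  move: xc yc x'c y'c xy xy'; rewrite -cc -yy /has_label.
  move=> /orP[] /eqP <- /orP[] /eqP <- /orP[] /eqP <- /orP[] /eqP hh; rewrite ?hh ?eqxx //.
by rewrite (back f mf) (back g mg) -xf -xg f2 xx.
Qed.

End Labels.


(** * Moves undone by one move *)

Lemma shift_labelled M k A : labelled M A -> labelled M (relabel (shift M k) A).
Proof.
move=> lA; have [k' inv] := shift_inverse M k.
apply: (relabel_labelled (g := shift M k') lA).
  move=> x xM; have [-> _] := inv x xM; split=> //.
  by case/andP: xM => x1 xM; apply: shift_bounds; apply: leq_trans xM.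
move=> y yM; exists (shift M k' y); last by have [] := inv y yM.
by case/andP: yM => y1 yM; apply: shift_bounds; apply: leq_trans yM.
Qed.

Lemma shift_numbered A k : numbered A ->
  numbered (relabel (shift (order A).*2 k) A) /\
  order (relabel (shift (order A).*2 k) A) = order A.
Proof.
move=> /numbered_labelled/(shift_labelled k)/labelled_numbered[nB e]; split=> //.
by apply: double_inj; rewrite -e.
Qed.

Lemma shift_back A k : numbered A -> exists k',
  relabel (shift (order A).*2 k') (relabel (shift (order A).*2 k) A) = A.
Proof.
move=> nA; have [k' inv] := shift_inverse (order A).*2 k; exists k'.
rewrite relabel_comp; apply: relabel_id => c x cA xc /=.
by have [] := inv x (label_bounds nA cA xc).
Qed.

Lemma order_relabel f A : numbered A ->
  (forall x y, 1 <= x <= (order A).*2 -> 1 <= y <= (order A).*2 -> f x = f y -> x = y) ->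
  order (relabel f A) = order A.
Proof.
move=> nA inj; rewrite /order /relabel; apply/eqP/card_in_imfsetP => c d cA dA [h1 _ _].
apply: (label_inj nA (x := over c)) => //; rewrite /has_label ?eqxx //.
by rewrite (inj _ _ (over_bounds nA cA) (over_bounds nA dA) h1) eqxx.
Qed.

Section Sim.
Variable P : symbol -> Prop.

(** Equivalence by moves inside a class P of symbols; the combinatorics uses
    of P only that it consists of numbered symbols, is stable under rotation
    and has colourings. *)
Definition sim (A A' : symbol) : Prop :=
  exists (k : nat) (S : nat -> symbol),
    [/\ S 0 = A, S k = A', forall i, i <= k -> P (S i) &
        forall i, i < k -> alg_move (S i) (S i.+1)].

Lemma sim_refl A : P A -> sim A A.
Proof. by move=> pA; exists 0, (fun=> A). Qed.

Lemma sim_trans A B C : sim A B -> sim B C -> sim A C.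
Proof.
move=> [k [S [S0 Sk PS mS]]] [l [T [T0 Tl PT mT]]].
exists (k + l), (fun i => if i <= k then S i else T (i - k)); split.
- by rewrite leq0n.
- case: ifP => [|_]; last by rewrite addnC addnK.
  by rewrite -{2}[k]addn0 leq_add2l leqn0 => /eqP l0; rewrite l0 addn0 Sk -T0 -Tl l0.
- move=> i il; case: leqP => [ik|ki]; first exact: PS.
  by apply: PT; rewrite leq_subLR.
move=> i il; case: (ltngtP i k) => [ik|ki|ik].
- exact: mS.
- by rewrite subSn ?(ltnW ki) //; apply: mT; rewrite ltn_subLR // ltnW.
by rewrite ik subSnn Sk -T0; apply: mT; lia.
Qed.

Lemma sim_move A B : P A -> P B -> alg_move A B -> sim A B.
Proof.
move=> pA pB m; exists 1, (fun i => if i == 0 then A else B); split=> //.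
  by move=> [|i].
by move=> [|i].
Qed.
End Sim.

Lemma Omega_beta_inverse A A' : numbered A -> Omega_beta A A' -> Omega_beta A' A.
Proof.
move=> nA [k ->]; have [k' e] := shift_back k nA.
by exists k'; have [_ ->] := shift_numbered k nA.
Qed.

Lemma compress0 : compress fset0 = fset0.
Proof. exact: relabel0. Qed.

Lemma fsetU1D1 (K : choiceType) (c : K) (B : {fset K}) : c \notin B ->
  (c |` B) `\ c = B.
Proof.
move=> cB; apply/fsetP => d; rewrite in_fsetD1 in_fset1U.
by case: eqP => [->|//]; rewrite (negbTE cB).
Qed.

Lemma fsetU2D2 (K : choiceType) (c d : K) (B : {fset K}) : c != d -> c \notin B ->
  d \notin B -> (([fset c; d] `|` B) `\ c) `\ d = B.
Proof.
move=> cd cB dB; apply/fsetP => x; rewrite !in_fsetD1 in_fsetU in_fset2.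
case: (x =P d) => [->|_] /=; first by rewrite (negbTE dB).
by case: (x =P c) => [->|//] /=; rewrite (negbTE cB).
Qed.

Lemma relabelU1 f c A : relabel f (c |` A) = (f (over c), f (under c), sign c) |` relabel f A.
Proof. by rewrite relabelU relabel1. Qed.

(** The labels of the old crossings occur in the same order after the move as
    before it. *)
Lemma Omega1p_inverse A A' : numbered A -> Omega1p A A' -> Omega1m A' A.
Proof.
move=> nA [[-> [e [es h]]]|[nz [a [s [e [x [/andP[a1 aN] es hx hs ->]]]]]]].
  have [c Ac hc] : exists2 c, A' = [fset c] & links c 1 2.
    by case: h => ->; [exists (1, 2, e)|exists (2, 1, e)].
  have o1 : order A' = 1 by rewrite /order Ac cardfs1.
  exists 1, c; rewrite /basic_arc /next_label o1; split=> //; first by rewrite Ac in_fset1.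
  by rewrite Ac fsetDv compress0.
set N := (order A).*2 in aN hs *; set f := fun y => _; set S := shift _ s.
have sN : s = 0 \/ a = N /\ s <= 2.
  move: hs; case: eqP => [->|_]; last by move/eqP; left.
  by rewrite !inE => /or3P[] /eqP ->; [left|right|right].
have fb y : 1 <= y <= N -> 1 <= f y <= N + 2 - s /\ f y != a.+1 /\ f y != a.+2.
  by move=> /andP[y1 yN]; rewrite /f; case: (ltnP a y) => ay; case: sN => [->|[aN' s2]]; (split; [|split]); lia.
have Sf y : 1 <= y <= N + 2 - s -> S y = y + s.
  move=> yb; case: y yb => // y yb; rewrite /S /shift /=.
  by rewrite modn_small ?addSn //; lia.
have incr y z : 1 <= y -> y < z -> z <= N -> S (f y) < S (f z).
  move=> y1 yz zN; rewrite !Sf; try by have [] := fb y ltac:(lia); have [] := fb z ltac:(lia).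
  by rewrite ltn_add2r /f; case: (ltnP a y); case: (ltnP a z); lia.
have Sinj y z : 1 <= y <= N + 2 -> 1 <= z <= N + 2 -> S y = S z -> y = z.
  have [s' inv] := shift_inverse (N + 2) s.
  move=> yb zb h; have [hy _] := inv y yb; have [hz _] := inv z zb.
  by rewrite -hy -hz -/S h.
set c := (S (over x), S (under x), sign x).
have c_lab : forall y, has_label y x -> y = a.+1 \/ y = a.+2.
  by move=> y; case: hx => -> /orP[] /eqP <-; [left|right|right|left].
have cB : c \notin relabel (S \o f) A.
  apply/negP => /mem_relabel[d dA /(congr1 over) h].
  have db := over_bounds nA dA; have [fb1 [fb2 fb3]] := fb _ db.
  have xo : over x = a.+1 \/ over x = a.+2 by apply: c_lab; rewrite /has_label eqxx.
  have {}h : over x = f (over d) by apply: Sinj h; [case: xo => ->; lia|lia].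
  by move: fb2 fb3; rewrite -h; case: xo => ->; rewrite eqxx.
have e1 : relabel S (x |` relabel f A) = c |` relabel (S \o f) A.
  by rewrite relabelU1 relabel_comp.
have oB : order (relabel (S \o f) A) = order A.
  apply: order_relabel => // y z /andP[y1 yN] /andP[z1 zN] /= h.
  by have [l|l|//] := ltngtP y z; [have := incr y z y1 l zN|have := incr z y z1 l yN]; rewrite h ltnn.
have oA : (order (c |` relabel (S \o f) A)).*2 = N + 2.
  by rewrite /order cardfsU1 cB -/(order _) oB doubleD addnC.
exists (S a.+1), c; rewrite e1; split.
- by rewrite /basic_arc oA; apply: shift_bounds; lia.
- by rewrite fset1U1.
- rewrite /next_label oA /S shift_shift (addnC 1) -shift_shift next_shift; last by lia.
  rewrite (_ : (a.+1 == N + 2) = false); last by apply/eqP; lia.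
  by rewrite /c; case: hx => ->; rewrite /links /= !eqxx ?orbT.
by rewrite fsetU1D1 // compress_relabel.
Qed.


Lemma links_label c x y z : links c x y -> has_label z c -> z = x \/ z = y.
Proof.
by move=> /orP[] /andP[/eqP o /eqP u] /orP[] /eqP <-; rewrite ?o ?u; auto.
Qed.

Lemma links_has c x y : links c x y -> has_label x c /\ has_label y c.
Proof.
by move=> /orP[] /andP[/eqP o /eqP u]; rewrite /has_label o u !eqxx ?orbT.
Qed.

Lemma links_sym c x y : links c x y = links c y x.
Proof. by rewrite /links orbC. Qed.

(** The end of e_w that is joined to the first end of e_z; the last end of e_z
    is joined to the other one, obtained for ~~ par. *)
Definition bigon_end (A : symbol) (w : nat) (par : bool) : nat :=
  if par then w else next_label A w.

(** Only the distinctness of the four labels has to be checked: a 1-gon on one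
    of the two arcs would put a third label on a crossing of the bigon. *)
Lemma gon2_intro A z w c d par : numbered A -> basic_arc A z -> basic_arc A w ->
  c \in A -> d \in A ->
  links c z (bigon_end A w par) -> links d (next_label A z) (bigon_end A w (~~ par)) ->
  uniq [:: z; next_label A z; w; next_label A w] ->
  height A z = height A (next_label A z) -> gon2_at A z w c d.
Proof.
move=> nA zA wA cA dA lc ld.
rewrite /= !inE !negb_or andbT => /and3P[/and3P[z1 z2 z3] /andP[z4 z5] z6] hz.
have [cz cw] := links_has lc; have [dz dw] := links_has ld.
have only c' x y x' y' : links c' x y -> x' \notin [:: x; y] -> has_label x' c' -> False.
  move=> l; rewrite !inE negb_or => /andP[/eqP n1 /eqP n2] h.
  by case: (links_label l h).
have nz : ~ gon1 A z.
  move=> [_ [c' [c'A /links_has[h1 h2]]]].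
  have e := label_inj nA c'A cA h1 cz; move: h2; rewrite e.
  apply: only lc _ => //; rewrite !inE negb_or eq_sym z1.
  by rewrite /bigon_end; case: (par).
have nw : ~ gon1 A w.
  move=> [_ [c' [c'A /links_has[h1 h2]]]].
  move: (lc) (ld) (cw) (dw); rewrite /bigon_end; case: (par) => /= {}lc {}ld {}cw {}dw.
    have e := label_inj nA c'A cA h1 cw; move: h2; rewrite e.
    by apply: only lc _ => //; rewrite !inE negb_or eq_sym z3 eq_sym.
  have e := label_inj nA c'A dA h1 dw; move: h2; rewrite e.
  by apply: only ld _ => //; rewrite !inE negb_or eq_sym z5 eq_sym.
split; split=> //; first exact/eqP.
by move: lc ld; rewrite /bigon_end; case: (par) => /= ? ?; [left|right].
Qed.

(** The arcs that start at a + 1 and b + 3 form a bigon. The old labels keep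
    their order: even when an extra rotation by s is allowed, the labels that
    it moves past the base point are new ones. *)
Lemma Omega2p_inverse A A' : numbered A -> numbered A' -> Omega2p A A' -> Omega2m A' A.
Proof.
move=> nA nA' [[-> [e [es h]]]|[nz [a [b [s [phi [rho [theta
  [[a1 ab bN rs ts] [_ hs eA']]]]]]]]]].
  have [c [d [Ac [cd lc ld hh sg]]]] : exists c d, A' = [fset c; d] /\ [/\ c != d, links c 1 4,
      links d 2 3, (over c = 1 /\ over d = 2) \/ (under c = 1 /\ under d = 2)
      & sign c = (- sign d)%R].
    case: h => ->; [exists (1, 4, e), (2, 3, (- e)%R)|exists (4, 1, e), (3, 2, (- e)%R)].
      by split=> //; split=> //; [left|rewrite opprK].
    by split=> //; split=> //; [right|rewrite opprK].
  have o2 : order A' = 2 by rewrite /order Ac cardfs2 cd.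
  have cA : c \in A' by rewrite Ac !inE eqxx.
  have dA : d \in A' by rewrite Ac !inE eqxx orbT.
  exists 1, 3, c, d; split=> //.
    have [n1 n3] : next_label A' 1 = 2 /\ next_label A' 3 = 4 by rewrite /next_label o2.
    apply: (@gon2_intro _ _ _ _ _ false); rewrite /basic_arc /bigon_end ?n1 ?n3 ?o2 //.
    case: hh => -[<- <-]; first by rewrite (height_over cA) (height_over dA).
    by rewrite (height_under nA' cA) (height_under nA' dA).
  have -> : (A' `\ c) `\ d = fset0; last by rewrite compress0.
  by apply/fsetP => x; rewrite Ac !inE; case: eqP; case: eqP.
set N := (order A).*2 in bN hs eA'; set f := Omega2p_relabel a b in eA'.
set S := shift _ s in eA'.
have sN : s = 0 \/ (b = N /\ ((a < N /\ s <= 2) \/ (a = N /\ s <= 4))).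
  move: hs; case: eqP => [->|_]; last by move/eqP; left.
  case: ltnP => l; rewrite !inE => /or3P[] /eqP ->; try by [left]; right; split=> //; try by left.
    by right; split=> //; apply/eqP; rewrite eqn_leq l andbT (leq_trans ab).
  by right; split=> //; apply/eqP; rewrite eqn_leq l andbT (leq_trans ab).
have fb y : 1 <= y <= N -> 1 <= f y <= N + 4 - s /\
    [/\ f y != a + 1, f y != a + 2, f y != b + 3 & f y != b + 4].
  move=> /andP[y1 yN]; rewrite /f /Omega2p_relabel.
  by case: (leqP y a) => ay; case: (leqP y b) => yb; (split; [|split]);
    case: sN => [s0|[bN' [[aN s2]|[aN s2]]]]; lia.
have f_incr y z : y < z -> f y < f z.
  move=> yz; rewrite /f /Omega2p_relabel.
  by case: (leqP y a); case: (leqP z a); case: (leqP y b); case: (leqP z b); lia.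
have Sf y : 1 <= y <= N + 4 - s -> S y = y + s.
  move=> yb; case: y yb => // y yb; rewrite /S /shift /=.
  by rewrite modn_small ?addSn //; lia.
have incr y z : 1 <= y -> y < z -> z <= N -> S (f y) < S (f z).
  move=> y1 yz zN; have [fy _] := fb y ltac:(lia); have [fz _] := fb z ltac:(lia).
  by rewrite !Sf // ltn_add2r f_incr.
have Sinj y z : 1 <= y <= N + 4 -> 1 <= z <= N + 4 -> S y = S z -> y = z.
  have [s' inv] := shift_inverse (N + 4) s.
  move=> yb zb h; have [hy _] := inv y yb; have [hz _] := inv z zb.
  by rewrite -hy -hz -/S h.
pose pq := Omega2p_ends b rho; pose e : int := (or_sign phi * rho)%R.
have [c0 [d0 [enew hc hd hh sg]]] : exists c0 d0, [/\ Omega2p_new a b phi rho theta = [fset c0; d0],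
    links c0 (a + 1) pq.1, links d0 (a + 2) pq.2,
    (over c0 = a + 1 /\ over d0 = a + 2) \/ (under c0 = a + 1 /\ under d0 = a + 2)
    & sign c0 = (- sign d0)%R].
  rewrite /Omega2p_new /pq; case: (Omega2p_ends b rho) => p q /=; case: ifP => _.
    exists (a + 1, p, e), (a + 2, q, (- e)%R); rewrite /links /= !eqxx ?orbT opprK; split=> //; by left.
  exists (p, a + 1, (- e)%R), (q, a + 2, e); rewrite /links /= !eqxx ?orbT; split=> //; by right.
have pqE : pq = if rho == 1%R then (b + 4, b + 3) else (b + 3, b + 4) by [].
have pqb : pq.1 = b + 3 \/ pq.1 = b + 4 by rewrite pqE; case: ifP => _; [right|left].
have pqb' : pq.2 = b + 3 \/ pq.2 = b + 4 by rewrite pqE; case: ifP => _; [left|right].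
pose Sc (x : crossing) : crossing := (S (over x), S (under x), sign x).
have links_S x y z : links x y z -> links (Sc x) (S y) (S z).
  by move=> /orP[] /andP[/eqP <- /eqP <-]; rewrite /links /= !eqxx ?orbT.
have notB x y z : links x y z -> (y = a + 1 \/ y = a + 2) -> (z = b + 3 \/ z = b + 4) ->
    Sc x \notin relabel (S \o f) A.
  move=> lx ya zb; apply/negP => /mem_relabel[d dA /(congr1 over) h].
  have db := over_bounds nA dA; have [fb1 [fb2 fb3 fb4 fb5]] := fb _ db.
  have xo : over x = y \/ over x = z by apply: (links_label lx); rewrite /has_label eqxx.
  have {}h : over x = f (over d).
    by apply: Sinj h; [case: xo => ->; [case: ya => ->|case: zb => ->]; lia|lia].
  by move: fb2 fb3 fb4 fb5; rewrite -h; case: xo => ->; [case: ya => ->|case: zb => ->]; rewrite eqxx.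
have cB := notB _ _ _ hc (or_introl erefl) pqb.
have dB := notB _ _ _ hd (or_intror erefl) pqb'.
have cd : Sc c0 != Sc d0.
  apply/eqP => h; have h1 := congr1 over h; have h2 := congr1 under h.
  case: hh => -[u v]; [move: h1|move: h2]; rewrite /Sc /over /under /= in u v * => /Sinj; rewrite u v; lia.
have e1 : A' = [fset Sc c0; Sc d0] `|` relabel (S \o f) A.
  by rewrite eA' relabelU relabel_comp enew relabelU !relabel1.
have oB : order (relabel (S \o f) A) = order A.
  apply: order_relabel => // y z /andP[y1 yN] /andP[z1 zN] /= h.
  by have [l|l|//] := ltngtP y z; [have := incr y z y1 l zN|have := incr z y z1 l yN]; rewrite h ltnn.
have e2 : A' = Sc c0 |` (Sc d0 |` relabel (S \o f) A) by rewrite e1 fsetUA.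
have oA : (order A').*2 = N + 4.
  rewrite e2 /order !cardfsU1 in_fset1U negb_or cd cB dB -/(order _) oB.
  by rewrite !add1n !doubleS addnC.
have nextS x : 1 <= x < N + 4 -> next_label A' (S x) = S x.+1.
  move=> xb; rewrite /next_label oA /S shift_shift (addnC 1) -shift_shift next_shift; last by lia.
  by rewrite (_ : (x == N + 4) = false) //; apply/eqP; lia.
have n1 : next_label A' (S (a + 1)) = S (a + 2) by rewrite nextS ?addn2 ?addn1 //; lia.
have n2 : next_label A' (S (b + 3)) = S (b + 4) by rewrite nextS ?addn3 ?addn4 //; lia.
have cA : Sc c0 \in A' by rewrite e2 fset1U1.
have dA : Sc d0 \in A' by rewrite e2 in_fset1U fset1U1 orbT.
exists (S (a + 1)), (S (b + 3)), (Sc c0), (Sc d0); split=> //; last first.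
  by rewrite e1 fsetU2D2 // compress_relabel.
apply: (@gon2_intro _ _ _ _ _ (rho != 1%R)) => //.
- by rewrite /basic_arc oA; apply: shift_bounds; rewrite addn4.
- by rewrite /basic_arc oA; apply: shift_bounds; rewrite addn4.
- rewrite /bigon_end n2; have := links_S _ _ _ hc; rewrite pqE; by case: (rho == 1%R).
- rewrite /bigon_end n1 n2; have := links_S _ _ _ hd; rewrite pqE; by case: (rho == 1%R).
- rewrite n1 n2 (map_inj_in_uniq (f := S) (s := [:: a + 1; a + 2; b + 3; b + 4])).
    by clear -ab; rewrite /= !inE; lia.
  have in4 x : x \in [:: a + 1; a + 2; b + 3; b + 4] -> 1 <= x <= N + 4.
    by clear -ab bN; rewrite !inE; lia.
  by move=> x y /in4 xx /in4 yy; apply: Sinj.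
rewrite n1; case: hh => -[<- <-].
  by rewrite (height_over cA) (height_over dA).
by rewrite (height_under nA' cA) (height_under nA' dA).
Qed.


(** * Triangles *)

Lemma gon1_links A i x1 x2 c : endpoints A i x1 x2 -> c \in A -> links c x1 x2 ->
  basic_arc A i -> gon1 A i.
Proof.
move=> [[-> ->]|[-> ->]] cA l iA; split=> //; exists c; split=> //.
by rewrite links_sym.
Qed.

Lemma next_neq A x : numbered A -> 1 <= x <= (order A).*2 -> next_label A x != x.
Proof.
by move=> nA xN; rewrite nextE //; move: xN; case: ifP => [/eqP ->|_]; lia.
Qed.

(** A coincidence of two labels would either turn one of the three arcs into a
    1-gon or give some label two different partners. *)
Lemma gon3_uniq A a1 a2 b1 b2 c1 c2 : numbered A -> gon3_at A a1 a2 b1 b2 c1 c2 ->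
  uniq [:: a1; a2; b1; b2; c1; c2].
Proof.
move=> nA [[i [j [k [[iA jA kA] [_ [[ea eb ec] [[gi gj gk] _]]]]]]] [[hx hy hz] _]].
have [x [xA lx]] := hx; have [y [yA ly]] := hy; have [z [zA lz]] := hz.
have neq l u v : basic_arc A l -> endpoints A l u v -> u <> v.
  move=> lA; have /eqP h := next_neq nA lA.
  by move=> [[-> ->]|[-> ->]] // e; apply: h.
have a12 := neq _ _ _ iA ea; have b12 := neq _ _ _ jA eb; have c12 := neq _ _ _ kA ec.
have irr c u v : c \in A -> links c u v -> u <> v.
  move=> cA l e; have := over_neq_under nA cA; move: l; rewrite e.
  by move=> /orP[] /andP[/eqP-> /eqP->]; rewrite eqxx.
have ab1 := irr _ _ _ xA lx; have ac := irr _ _ _ yA ly; have bc := irr _ _ _ zA lz.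
have ga c : c \in A -> ~ links c a1 a2 by move=> cA l; apply: gi; apply: gon1_links ea cA l iA.
have gb c : c \in A -> ~ links c b1 b2 by move=> cA l; apply: gj; apply: gon1_links eb cA l jA.
have gc c : c \in A -> ~ links c c1 c2 by move=> cA l; apply: gk; apply: gon1_links ec cA l kA.
have same c d u v w : c \in A -> d \in A -> links c u v -> links d u w -> v = w.
  move=> cA dA l1 l2; have [h1 h2] := links_has l1; have [h3 h4] := links_has l2.
  have e := label_inj nA cA dA h1 h3; rewrite e in l1 h2.
  by case: (links_label l2 h2) => // e'; have := irr _ _ _ dA l1; rewrite e'.
have a1b2 : a1 <> b2 by move=> e; apply: (gb x) => //; rewrite links_sym -e.
have a1c1 : a1 <> c1 by move=> e; apply: (ga y) => //; rewrite links_sym e.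
have a2b1 : a2 <> b1 by move=> e; apply: (ga x) => //; rewrite e.
have a2c2 : a2 <> c2 by move=> e; apply: (gc y) => //; rewrite links_sym -e.
have b1c2 : b1 <> c2 by move=> e; apply: (gb z) => //; rewrite links_sym e.
have b2c1 : b2 <> c1 by move=> e; apply: (gc z) => //; rewrite -e.
have a1c2 : a1 <> c2.
  by move=> e; apply: b12; apply: (same x z a1) => //; rewrite e links_sym.
have a2b2 : a2 <> b2 by move=> e; apply: c12; apply: (same y z a2) => //; rewrite e.
have b1c1 : b1 <> c1.
  move=> e; apply: a12; apply: (same x y b1) => //; first by rewrite links_sym.
  by rewrite links_sym e.
by rewrite /= !inE !negb_or !andbT; do ![apply/andP; split]; apply/eqP.
Qed.

Ltac use_neq :=
  repeat match goal with H : is_true (?x != ?y) |- _ =>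
    rewrite ?(negbTE H) ?[y == x]eq_sym ?(negbTE H); clear H end; rewrite ?eqxx.

Section Companion.
Variables a1 a2 b1 b2 c1 c2 : nat.
Let f := companion a1 a2 b1 b2 c1 c2.
Hypothesis abc : uniq [:: a1; a2; b1; b2; c1; c2].

Lemma companion_vals :
  [/\ f a1 = a2, f a2 = a1, f b1 = b2 & f b2 = b1] /\ [/\ f c1 = c2 & f c2 = c1].
Proof.
move: abc; rewrite /= !inE !negb_or !andbT -!andbA.
do 14![move=> /andP[?]] => ?.
by rewrite /f /companion; split; split; use_neq.
Qed.

Lemma companion_other x : x \notin [:: a1; a2; b1; b2; c1; c2] -> f x = x.
Proof.
rewrite !inE !negb_or /f /companion.
by do 5![move=> /andP[?]] => ?; use_neq.
Qed.

Lemma companionK x : f (f x) = x.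
Proof.
have [[e1 e2 e3 e4] [e5 e6]] := companion_vals.
have [|n] := boolP (x \in [:: a1; a2; b1; b2; c1; c2]); last by rewrite !companion_other.
by rewrite !inE => /or4P[|||/or3P[||]] /eqP ->; rewrite ?e1 ?e2 ?e3 ?e4 ?e5 ?e6.
Qed.

Lemma companion_swap x : companion a2 a1 b2 b1 c2 c1 x = f x.
Proof.
have [[e1 e2 e3 e4] [e5 e6]] := companion_vals.
have [|n] := boolP (x \in [:: a1; a2; b1; b2; c1; c2]); last first.
  rewrite companion_other //; move: n; rewrite !inE !negb_or /companion.
  by do 5![move=> /andP[?]] => ?; use_neq.
move: abc; rewrite /= !inE !negb_or !andbT -!andbA.
do 14![move=> /andP[?]] => ?.
rewrite /companion => /or4P[|||/or3P[||]] /eqP ->; rewrite ?e1 ?e2 ?e3 ?e4 ?e5 ?e6;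
  by use_neq.
Qed.
End Companion.

(** Exchanging companions is an involution, and it maps the triangle to a
    triangle on the same three arcs with the roles of their ends exchanged. A
    1-gon on one of these arcs would have been one before; a 2-gon on two of
    them is excluded because one of its labels is joined by a crossing to the
    third arc. *)
Lemma Omega3_inverse A A' : numbered A -> Omega3 A A' -> Omega3 A' A.
Proof.
move=> nA [a1 [a2 [b1 [b2 [c1 [c2 [g3 ->]]]]]]].
have abc := gon3_uniq nA g3.
set f := companion a1 a2 b1 b2 c1 c2; set A1 := relabel f A.
have fK : cancel f f := companionK abc.
have [[fa1 fa2 fb1 fb2] [fc1 fc2]] := companion_vals abc.
rewrite -/f in fa1 fa2 fb1 fb2 fc1 fc2.
move: (g3) => [[i [j [k [[iA jA kA] [dist [[ea eb ec] [[gi gj gk] _]]]]]]] [[hx hy hz] ht]].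
have [x [xA lx]] := hx; have [y [yA ly]] := hy; have [z [zA lz]] := hz.
pose N := (order A).*2.
have rng l u v : basic_arc A l -> endpoints A l u v -> (1 <= u <= N) /\ (1 <= v <= N).
  by move=> lA [[-> ->]|[-> ->]]; split=> //; apply: next_bounds.
have [ra1 ra2] := rng _ _ _ iA ea; have [rb1 rb2] := rng _ _ _ jA eb.
have [rc1 rc2] := rng _ _ _ kA ec.
have fN u : 1 <= u <= N -> 1 <= f u <= N.
  move=> uN; have [|n] := boolP (u \in [:: a1; a2; b1; b2; c1; c2]).
    by rewrite !inE => /or4P[|||/or3P[||]] /eqP ->; rewrite ?fa1 ?fa2 ?fb1 ?fb2 ?fc1 ?fc2.
  by rewrite /f companion_other.
have oA : order A1 = order A by apply: order_relabel => // u v _ _ /(can_inj fK).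
have nA1 : numbered A1.
  apply: (@labelled_numbered N _ _).1; apply: (relabel_labelled (g := f) (numbered_labelled nA)).
    by move=> u uN; split; [apply: fN|apply: fK].
  by move=> u uN; exists (f u); [apply: fN|apply: fK].
have nxt u : next_label A1 u = next_label A u by rewrite /next_label oA.
have ba l : basic_arc A l -> basic_arc A1 l by rewrite /basic_arc oA.
have ends l u v : endpoints A l u v -> endpoints A1 l v u.
  by rewrite /endpoints nxt => -[[-> ->]|[-> ->]]; [right|left].
pose F (c : crossing) : crossing := (f (over c), f (under c), sign c).
have lF c u v : links c u v -> links (F c) (f u) (f v).
  by move=> /orP[] /andP[/eqP <- /eqP <-]; rewrite /links /= !eqxx ?orbT.
have FA c : c \in A -> F c \in A1 by move=> cA; apply/mem_relabel; exists c.
have FK c : F (F c) = c by rewrite /F /over /under /= !fK; case: c => [[]].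
have FA1 c : c \in A1 -> F c \in A.
  by move=> /mem_relabel[d dA ->]; rewrite -/(F d) FK.
have hgt u : 1 <= u <= N -> height A1 (f u) = height A u.
  move=> /(label_crossing nA)[c cA /orP[]/eqP <-].
    by rewrite (height_over cA) -(height_over (FA c cA)).
  by rewrite (height_under nA cA) -(height_under nA1 (FA c cA)).
have lx' : links (F x) a2 b2 by have := lF _ _ _ lx; rewrite fa1 fb1.
have ly' : links (F y) a1 c2 by have := lF _ _ _ ly; rewrite fa2 fc1.
have lz' : links (F z) b1 c1 by have := lF _ _ _ lz; rewrite fb2 fc2.
have ng1 l u v : endpoints A l u v -> f u = v -> f v = u -> basic_arc A l ->
    ~ gon1 A l -> ~ gon1 A1 l.
  move=> e fu fv lA ng [_ [c [/FA1 cA l1]]]; apply: ng.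
  have : links (F c) v u.
    by move: l1; rewrite nxt; case: e => -[<- <-] /lF; rewrite fu fv // links_sym.
  by rewrite links_sym => l2; apply: gon1_links e cA l2 lA.
have ng2 l l' u v u' v' c p q : endpoints A l u v -> endpoints A l' u' v' ->
    c \in A1 -> links c p q -> p = u \/ p = v -> q \notin [:: u'; v'; p] -> ~ gon2 A1 l l'.
  move=> e e' cA lc pu; rewrite !inE !negb_or => /and3P[/eqP q1 /eqP q2 /eqP q3].
  move=> [d1 [d2 [_ [d1A d2A ll _]]]]; move: ll; rewrite !nxt => ll.
  have [d [w [dA ld wu]]] : exists d w, [/\ d \in A1, links d p w & w = u' \/ w = v'].
    have [pl|pn] : p = l \/ p = next_label A l by case: pu => ->; case: e => -[h1 h2]; rewrite ?h1 ?h2; auto.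
      rewrite pl; case: ll => -[h1 h2]; [exists d1, l'|exists d1, (next_label A l')]; split=> //;
      by case: e' => -[-> ->]; auto.
    rewrite pn; case: ll => -[h1 h2]; [exists d2, (next_label A l')|exists d2, l']; split=> //;
    by case: e' => -[-> ->]; auto.
  have [h1 h2] := links_has lc; have [h3 h4] := links_has ld.
  have ed := label_inj nA1 dA cA h3 h1; rewrite ed in ld.
  by case: (links_label ld h2) => // qw; move: wu; rewrite -qw => -[].
move: (abc); rewrite /= !inE !negb_or !andbT -!andbA.
do 14![move=> /andP[?]] => ?.
exists a2, a1, b2, b1, c2, c1; split; last first.
  rewrite /A1 relabel_comp; apply/esym/relabel_id => c w cA wc /=.
  by rewrite companion_swap.
split.
  exists i, j, k; split; first by split; apply: ba.
  split=> //; split; first by split; apply: ends.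
  split; first by split; [apply: ng1 ea fa1 fa2 iA gi|apply: ng1 eb fb1 fb2 jA gj|apply: ng1 ec fc1 fc2 kA gk].
  split.
  - apply: (ng2 _ _ _ _ _ _ (F y) a1 c2 ea eb) => //; [exact: FA|by left|].
    by rewrite !inE; use_neq.
  - apply: (ng2 _ _ _ _ _ _ (F x) a2 b2 ea ec) => //; [exact: FA|by right|].
    by rewrite !inE; use_neq.
  apply: (ng2 _ _ _ _ _ _ (F x) b2 a2 eb ec) => //; [exact: FA|by rewrite links_sym|by right|].
  by rewrite !inE; use_neq.
split.
  split; [exists (F x)|exists (F y)|exists (F z)]; split=> //; exact: FA.
move=> v vs; have both p q : 1 <= p <= N -> 1 <= q <= N -> f p = q -> f q = p ->
    both_heights A v p q -> both_heights A1 v q p.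
  by move=> pN qN fp fq [h1 h2]; split; rewrite -?fp ?hgt // -1?fq ?hgt.
by case: (ht v vs) => h; [apply: Or31|apply: Or32|apply: Or33]; apply: both h.
Qed.


(** * Undoing the deletion of a kink *)

Lemma threshold (M : nat) (p : pred nat) :
  (forall x y, 1 <= x -> x < y -> y <= M -> p y -> p x) ->
  exists j, j <= M /\ forall x, 1 <= x <= M -> p x = (x <= j).
Proof.
elim: M => [|M IH] down; first by exists 0; split=> // -[].
have [j [jM hj]] := IH (fun x y x1 xy yM => down x y x1 xy (leqW yM)).
have [pM|npM] := boolP (p M.+1).
  exists M.+1; split=> // x /andP[x1 xM]; rewrite xM.
  by move: xM; rewrite leq_eqVlt => /orP[/eqP ->//|xM]; apply: down pM.
exists j; split; first exact: leqW.
move=> x /andP[x1]; rewrite leq_eqVlt => /orP[/eqP ->|xM]; last by rewrite hj ?x1.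
by rewrite (negbTE npM) leqNgt ltnS jM.
Qed.

Lemma shift_modn N k x : shift N (k %% N) x = shift N k x.
Proof. by rewrite /shift modnDmr. Qed.

Lemma shift_cases N k x : k < N -> 1 <= x <= N ->
  shift N k x = if x + k <= N then x + k else x + k - N.
Proof.
case: x => // x kN /andP[_ xN]; have [h|h] := leqP (x.+1 + k) N; rewrite /shift succnK.
  by rewrite modn_small; lia.
have -> : x + k = x + k - N + N by lia.
by rewrite modnDr modn_small; lia.
Qed.

(** As F increases, the labels that the rotation by k carries past N are the
    last ones. Rotating the domain so that they come first restores the order. *)
Lemma rotate_increasing N M F k :
  (forall x y, 1 <= x -> x < y -> y <= M -> F x < F y) ->
  (forall x, 1 <= x <= M -> 1 <= F x <= N) ->
  exists m, forall x y, 1 <= x -> x < y -> y <= M ->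
    shift N k (F (shift M m x)) < shift N k (F (shift M m y)).
Proof.
move=> incr rng; have [->|M0] := posnP M; first by exists 0 => x y; lia.
have N0 : 0 < N by have := rng 1; lia.
have [|j [jM hj]] := @threshold M (fun x => F x + k %% N <= N).
  by move=> x y x1 xy yM /=; have := incr x y x1 xy yM; lia.
have kN : k %% N < N by rewrite ltn_mod.
(* j is the number of labels that are not carried past N. *)
exists (j %% M) => x y x1 xy yM.
have jM' : j %% M < M by rewrite ltn_mod.
have xb : 1 <= x <= M by lia. have yb : 1 <= y <= M by lia.
rewrite -![shift N k _](shift_modn N k).
have [je|je] := eqVneq j M.
  have j0 : j %% M = 0 by rewrite je modnn.
  rewrite j0 !shift0 // !shift_cases ?rng // !hj // je.
  by have := incr x y x1 xy yM; case/andP: xb => _ ->; case/andP: yb => _ ->; lia.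
have jj : j %% M = j by rewrite modn_small // ltn_neqAle je.
rewrite jj in jM' *; rewrite !(shift_cases jM') //.
have val z : 1 <= z <= M -> shift N (k %% N) (F z) = if z <= j then F z + k %% N else F z + k %% N - N.
  by move=> zM; rewrite shift_cases ?rng // hj.
have bnd z : 1 <= z <= M -> (1 <= F z <= N) /\ ((F z + k %% N <= N) = (z <= j)).
  by move=> zM; rewrite rng // hj.
case: (leqP (x + j) M) => h1; case: (leqP (y + j) M) => h2; rewrite !val; try lia.
- have [? ?] := bnd (x + j) ltac:(lia); have [? ?] := bnd (y + j) ltac:(lia).
  have := incr (x + j) (y + j); case: (leqP (x + j) j); case: (leqP (y + j) j); lia.
- have [? ?] := bnd (x + j) ltac:(lia); have [? ?] := bnd (y + j - M) ltac:(lia).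
  case: (leqP (x + j) j); case: (leqP (y + j - M) j); lia.
have [? ?] := bnd (x + j - M) ltac:(lia); have [? ?] := bnd (y + j - M) ltac:(lia).
have := incr (x + j - M) (y + j - M); case: (leqP (x + j - M) j); case: (leqP (y + j - M) j); lia.
Qed.

Lemma compress_rotated (B0 : symbol) N F k : numbered B0 ->
  (forall x y, 1 <= x -> x < y -> y <= (order B0).*2 -> F x < F y) ->
  (forall x, 1 <= x <= (order B0).*2 -> 1 <= F x <= N) ->
  exists m, compress (relabel (shift N k) (relabel F B0)) = relabel (shift (order B0).*2 m) B0.
Proof.
move=> nB incr rng; have [m hm] := rotate_increasing k incr rng.
have [m' inv] := shift_inverse (order B0).*2 m.
have [nB' oB'] := shift_numbered m' nB.
exists m'; rewrite -[RHS](@compress_relabel (shift N k \o F \o shift (order B0).*2 m)) //.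
  congr compress; rewrite !relabel_comp; apply: eq_relabel => c x cB xc /=.
  by have [_ ->] := inv x (label_bounds nB cB xc).
by rewrite oB'; apply: hm.
Qed.

Lemma relabelD1 f A c : c \in A ->
  (forall d, d \in A -> f (over d) = f (over c) -> d = c) ->
  relabel f (A `\ c) = relabel f A `\ (f (over c), f (under c), sign c).
Proof.
move=> cA inj; apply/fsetP => x; rewrite in_fsetD1; apply/mem_relabel/andP.
  move=> [d]; rewrite in_fsetD1 => /andP[dc dA] ->; split; last by apply/mem_relabel; exists d.
  by apply/eqP => /(congr1 over)/inj h; rewrite h ?eqxx in dc.
move=> [xc /mem_relabel[d dA e]]; exists d => //; rewrite in_fsetD1 dA andbT.
by apply/eqP => dc; rewrite e dc eqxx in xc.
Qed.

Definition shifted (N k : nat) (c : crossing) : crossing :=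
  (shift N k (over c), shift N k (under c), sign c).

Lemma shift_eq N k x y : 1 <= x <= N -> 1 <= y <= N -> shift N k x = shift N k y -> x = y.
Proof.
have [k' inv] := shift_inverse N k; move=> xN yN h.
by have [hx _] := inv x xN; have [hy _] := inv y yN; rewrite -hx -hy h.
Qed.

Lemma shift_removeE A k c : numbered A -> c \in A ->
  relabel (shift (order A).*2 k) (A `\ c) =
  relabel (shift (order A).*2 k) A `\ shifted (order A).*2 k c.
Proof.
move=> nA cA; apply: relabelD1 => // d dA /(shift_eq (over_bounds nA dA) (over_bounds nA cA)) h.
by apply: (label_inj nA (x := over c)); rewrite // /has_label ?h eqxx.
Qed.

Lemma shift_to N z t : 1 <= z <= N -> 1 <= t <= N -> exists k, shift N k z = t.
Proof.
move=> zN tN; exists (N + t - z).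
case: z t zN tN => // z [|t] // zN tN; rewrite /shift /=.
by rewrite (_ : z + _ = t + N) ?modnDr ?modn_small; lia.
Qed.

(** Renumbering of what a deletion leaves: G closes the gaps and F reopens
    them. *)
Lemma sub_labelled (B Q : symbol) M F G : numbered B -> (forall d, d \in Q -> d \in B) ->
  (forall d x, d \in Q -> has_label x d -> F (G x) = x /\ 1 <= G x <= M) ->
  (forall y, 1 <= y <= M -> G (F y) = y /\ exists2 d, d \in Q & has_label (F y) d) ->
  labelled M (relabel G Q) /\ relabel F (relabel G Q) = Q.
Proof.
move=> nB QB FG GF; split; last first.
  by rewrite relabel_comp; apply: relabel_id => d x dQ xd; have [] := FG d x dQ xd.
have inj d d' x x' : d \in Q -> d' \in Q -> has_label x d -> has_label x' d' -> G x = G x' -> x = x'.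
  move=> dQ dQ' xd xd' e; have [<- _] := FG d x dQ xd.
  by have [<- _] := FG d' x' dQ' xd'; rewrite e.
have ho d : has_label (over d) d by rewrite /has_label eqxx.
have hu d : has_label (under d) d by rewrite /has_label eqxx orbT.
have img d x : d \in Q -> has_label x (G (over d), G (under d), sign d) ->
    exists2 y, has_label y d & x = G y.
  by move=> dQ /orP[] /eqP <-; [exists (over d)|exists (under d)].
split.
- by move=> c /mem_relabel[d /QB dB ->]; apply: sign_of dB.
- move=> c /mem_relabel[d dQ ->]; apply: contraNneq (over_neq_under nB (QB d dQ)).
  by move=> /(inj _ _ _ _ dQ dQ (ho d) (hu d)) ->.
- move=> c c' x /mem_relabel[d dQ ->] /mem_relabel[d' dQ' ->].
  move=> /(img _ _ dQ)[y yd ->] /(img _ _ dQ')[y' yd' /(inj _ _ _ _ dQ dQ' yd yd') e].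
  by rewrite (label_inj nB (QB d dQ) (QB d' dQ') yd) // e.
move=> x; split.
  move=> /GF[e [d dQ hd]]; exists (G (over d), G (under d), sign d).
    by apply/mem_relabel; exists d.
  by rewrite -e; case/orP: hd => /eqP <-; rewrite /has_label /= eqxx ?orbT.
by move=> [c /mem_relabel[d dQ ->] /(img _ _ dQ)[y yd ->]]; have [] := FG d y dQ yd.
Qed.

Section Inverses.
Variable P : symbol -> Prop.
Hypothesis P_numbered : forall A, P A -> numbered A.
Hypothesis P_shift : forall A k, P A -> P (relabel (shift (order A).*2 k) A).

Lemma sim_shift A k : P A -> sim P A (relabel (shift (order A).*2 k) A).
Proof. by move=> pA; apply: sim_move (P_shift k pA) _ => //; left; exists k. Qed.

Lemma sim_unshift A k : P A -> sim P (relabel (shift (order A).*2 k) A) A.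
Proof.
move=> pA; apply: sim_move; [exact: P_shift|done|left].
by apply: Omega_beta_inverse; [apply: P_numbered|exists k].
Qed.

(** Common form of the undoing of deletions. Here Q is what remains of A, the
    symbol B0 is its renumbering after a rotation of A by k, and F reopens the
    gaps in B0. By [compress_rotated] B0 is a rotation of A', so it belongs to
    P, and it suffices to create the deleted crossings in B0. *)
Lemma sim_remove A A' Q B0 F k :
  P A -> P A' -> numbered B0 -> A' = compress Q -> (forall d, d \in Q -> d \in A) ->
  relabel (shift (order A).*2 k) Q = relabel F B0 ->
  (forall x y, 1 <= x -> x < y -> y <= (order B0).*2 -> F x < F y) ->
  (forall x, 1 <= x <= (order B0).*2 -> 1 <= F x <= (order A).*2) ->
  (P B0 -> sim P B0 (relabel (shift (order A).*2 k) A)) -> sim P A' A.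
Proof.
move=> pA pA' nB0 eA' QA eQ incr rng mv; have nA := P_numbered pA.
have [k' inv] := shift_inverse (order A).*2 k.
have Qback : Q = relabel (shift (order A).*2 k') (relabel F B0).
  rewrite -eQ relabel_comp; apply/esym/relabel_id => d x dQ xd /=.
  by have [] := inv x (label_bounds nA (QA d dQ) xd).
have [m em] := compress_rotated k' nB0 incr rng.
rewrite -Qback -eA' in em; have [m' em'] := shift_back m nB0.
have oA' : order A' = order B0 by rewrite em; have [] := shift_numbered m nB0.
rewrite -em -oA' in em'.
have pB0 : P B0 by rewrite -em'; apply: P_shift.
apply: sim_trans (_ : sim P A' B0) _; first by rewrite -em'; apply: sim_shift.
exact: sim_trans (mv pB0) (sim_unshift k pA).
Qed.

Lemma two_labels A : order A = 1 -> numbered A -> exists e : int, is_sign e /\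
  (A = [fset (1, 2, e)] \/ A = [fset (2, 1, e)]).
Proof.
move=> o1 nA; have [c cA _] := label_crossing nA (x := 1) ltac:(by rewrite o1).
have Ac : A = [fset c].
  by apply/esym/eqP; rewrite eqEfcard fsub1set cA cardfs1 -/(order A) o1.
exists (sign c); split; first exact: sign_of cA.
have := over_bounds nA cA; have := under_bounds nA cA; have := over_neq_under nA cA.
rewrite o1 Ac; case: c {cA Ac} => [[x u] s]; rewrite /over /under /sign /= => ou ub ob.
have [[-> ->]|[-> ->]] : (x = 1 /\ u = 2) \/ (x = 2 /\ u = 1) by lia.
  by left.
by right.
Qed.

(** The rotation puts the kink at the labels 2 and 3, where it can be created
    with a = 1 and without an additional rotation. A single crossing comes
    from the empty symbol. *)
Lemma Omega1m_inverse A A' : P A -> P A' -> Omega1m A A' -> sim P A' A.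
Proof.
move=> pA pA' [a [c [aA cA l eA']]]; have nA := P_numbered pA.
pose N := (order A).*2.
have o0 : 0 < order A by rewrite /order cardfs_gt0; apply/fset0Pn; exists c.
have [n1|n1] := eqVneq (order A) 1.
  have [e [es he]] := two_labels n1 nA.
  have A0 : A' = fset0.
    rewrite eA'; have -> : A `\ c = fset0; last by rewrite compress0.
    by apply/eqP; rewrite -cardfs_eq0; have := cardfsD1 c A; rewrite cA -/(order A) n1 add1n => /eqP; rewrite eqSS eq_sym.
  apply: sim_move => //; do 2 right; left; left; split=> //; by exists e.
have N4 : 4 <= N by rewrite /N -addnn; move: o0 n1; lia.
have [k ka] := @shift_to N a 2 aA ltac:(lia).
pose B := relabel (shift N k) A; pose c1 := shifted N k c.
have pB : P B by apply: P_shift.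
have [nB oB] : numbered B /\ order B = order A by apply: shift_numbered.
have c1B : c1 \in B by apply/mem_relabel; exists c.
have l1 : links c1 2 3.
  have n3 : shift N k (next_label A a) = 3.
    by rewrite /next_label shift_shift addnC -shift_shift ka next_shift; [case: eqP; lia|lia].
  move: l; rewrite /c1 /shifted => /orP[] /andP[/eqP -> /eqP ->];
    by rewrite /links /= ka n3 !eqxx ?orbT.
have labc x : has_label x c1 = (x == 2) || (x == 3).
  apply/idP/idP; first by move=> h; case: (links_label l1 h) => ->.
  by have [h2 h3] := links_has l1; move=> /orP[] /eqP ->.
pose F y := if 1 < y then y + 2 else y; pose G y := if 1 < y then y - 2 else y.
pose M := N - 2; pose B0 := relabel G (B `\ c1).
have lab d x : d \in B `\ c1 -> has_label x d -> [/\ 1 <= x <= N, x != 2 & x != 3].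
  rewrite in_fsetD1 => /andP[dc dB] xd; split; first by rewrite /N -oB; apply: label_bounds xd.
    by apply: contra_neq dc => x2; apply: (label_inj nB (x := x)) => //; rewrite labc x2.
  by apply: contra_neq dc => x2; apply: (label_inj nB (x := x)) => //; rewrite labc x2 orbT.
have [lB0 FB0] : labelled M B0 /\ relabel F B0 = B `\ c1.
  apply: (@sub_labelled B) => //; first by move=> d; rewrite in_fsetD1 => /andP[].
    move=> d x dB xd; have [x1 x2 x3] := lab d x dB xd.
    by rewrite /F /G /M; case: (ltnP 1 x) => h; case: ifP; lia.
  move=> y yM; split; first by rewrite /F /G; case: (ltnP 1 y) => h; case: ifP; lia.
  have [d dB yd] : exists2 d, d \in B & has_label (F y) d.
    by apply: label_crossing => //; rewrite oB -/N /F; case: ifP; move: yM; rewrite /M; lia.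
  exists d => //; rewrite in_fsetD1 dB andbT; apply: contraTneq yd => ->.
  by rewrite labc /F; case: (ltnP 1 y); lia.
have [nB0 oB0] := labelled_numbered lB0.
apply: (@sim_remove A A' (A `\ c) B0 F k) => //.
- by move=> d; rewrite in_fsetD1 => /andP[].
- by rewrite FB0 shift_removeE.
- by move=> x y x1 xy yM; rewrite /F; case: (ltnP 1 x); case: (ltnP 1 y); lia.
- by move=> x; rewrite -oB0 /F /M; case: (ltnP 1 x); lia.
move=> pB0; apply: sim_move => //; do 2 right; left; right; split.
  by move=> B00; move: oB0; rewrite B00 /order cardfs0 /M; lia.
exists 1, 0, (sign c1), c1; split.
- by rewrite -oB0 /M; lia.
- exact: sign_of c1B.
- move: l1; case: (c1) => [[x y] s]; rewrite /links /over /under /sign /=.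
  by move=> /orP[] /andP[/eqP -> /eqP ->]; [left|right].
- by case: eqP.
have -> : relabel (fun y => if 1 < y then y + 2 else y) B0 = B `\ c1 by [].
rewrite fsetD1K //; apply/esym/relabel_id => d x dB xd; apply: shift0.
by have := label_bounds nB dB xd; rewrite oB -oB0 /M -/N; lia.
Qed.
End Inverses.


(** * Undoing the deletion of a bigon *)

(** A bigon with crossings of opposite signs, in a form that is stable under
    rotation and treats its arcs alike; par tells whether the arcs run in the
    same direction. *)
Definition bigon (A : symbol) (z w : nat) (c d : crossing) (par : bool) : Prop :=
  [/\ basic_arc A z, basic_arc A w, c \in A & d \in A] /\
  [/\ links c z (bigon_end A w par), links d (next_label A z) (bigon_end A w (~~ par)),
      uniq [:: z; next_label A z; w; next_label A w],
      (over c = z /\ over d = next_label A z) \/ (under c = z /\ under d = next_label A z) &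
      sign c = (- sign d)%R].

Lemma links_irr A c x : numbered A -> c \in A -> ~ links c x x.
Proof.
move=> nA cA; have := over_neq_under nA cA.
by move=> h /orP[] /andP[/eqP e1 /eqP e2]; rewrite e1 e2 eqxx in h.
Qed.

Lemma next_inj A x y : 1 <= x <= (order A).*2 -> 1 <= y <= (order A).*2 ->
  next_label A x = next_label A y -> x = y.
Proof. exact: shift_eq. Qed.

Lemma links_cases c x y : links c x y -> (over c = x /\ under c = y) \/ (under c = x /\ over c = y).
Proof. by move=> /orP[] /andP[/eqP-> /eqP->]; [left|right]. Qed.

Lemma gon2_bigon A z w c d : numbered A -> gon2_at A z w c d -> sign c = (- sign d)%R ->
  exists par, bigon A z w c d par.
Proof.
move=> nA [[zA wA zw gz gw] [cA dA l hz]] sg.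
have nz := next_neq nA zA; have nw := next_neq nA wA.
have zw' : next_label A z != next_label A w by apply/eqP => /(next_inj zA wA).
have loop c' u v : c' \in A -> links c' u v -> u <> v.
  by move=> cA' lk e; move: lk; rewrite e; apply: links_irr nA cA'.
have ng c' : c' \in A -> ~ links c' z (next_label A z) by move=> cA' lk; apply: gz; split=> //; exists c'.
pose par := links c z w && links d (next_label A z) (next_label A w).
have [lc ld] : links c z (bigon_end A w par) /\ links d (next_label A z) (bigon_end A w (~~ par)).
  rewrite /bigon_end /par; case: andP => // h; by case: l => // -[].
have u4 : uniq [:: z; next_label A z; w; next_label A w].
  have n1 : z != w by apply/eqP.
  have n2 : z != next_label A w.
    apply/eqP => e; case: l => -[l1 l2]; last by apply: (loop _ _ _ cA l1).
    by apply: (ng d) => //; move: l2; rewrite -e links_sym.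
  have n3 : next_label A z != w.
    apply/eqP => e; case: l => -[l1 l2]; first by apply: (ng c) => //; rewrite e.
    by apply: (loop _ _ _ dA l2).
  by rewrite /= !inE !negb_or n1 n2 n3 zw' (eq_sym z) nz (eq_sym w) nw.
exists par; split=> //; split=> //.
have [hc|hc] := links_cases lc; have [hd|hd] := links_cases ld; case: hc => h1 h2; case: hd => h3 h4; auto.
  by move: hz; rewrite -h3 -h1 (height_over cA) (height_under nA dA).
by move: hz; rewrite -h3 -h1 (height_over dA) (height_under nA cA).
Qed.

Lemma bigon_swap A z w c d par : bigon A z w c d par ->
  exists c' d', bigon A w z c' d' par /\ ((c' = c /\ d' = d) \/ (c' = d /\ d' = c)).
Proof.
move=> [[zA wA cA dA] [lc ld u h sg]].
have u' : uniq [:: w; next_label A w; z; next_label A z].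
  by rewrite (uniq_catC [:: w; next_label A w] [:: z; next_label A z]).
have sg' : sign d = (- sign c)%R by rewrite sg opprK.
have hc := links_cases lc; have hd := links_cases ld.
move: u; rewrite /= !inE !negb_or => /and3P[/and3P[/eqP n1 /eqP n2 /eqP n3] /andP[/eqP n4 /eqP n5] /andP[/eqP n6 _]].
rewrite /bigon_end in lc ld hc hd; case: par lc ld hc hd => /= lc ld hc hd.
  exists c, d; split; last by left.
  split=> //; split=> //; rewrite 1?links_sym //.
  case: h => -[h1 h2]; [right|left]; split.
  - by case: hc => -[? ?]; congruence.
  - by case: hd => -[? ?]; congruence.
  - by case: hc => -[? ?]; congruence.
  - by case: hd => -[? ?]; congruence.
exists d, c; split; last by right.
split=> //; split=> //; rewrite 1?links_sym //.
case: h => -[h1 h2]; [right|left]; split.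
- by case: hd => -[? ?]; congruence.
- by case: hc => -[? ?]; congruence.
- by case: hd => -[? ?]; congruence.
- by case: hc => -[? ?]; congruence.
Qed.

Lemma bigon_shift A k z w c d par : numbered A -> bigon A z w c d par ->
  let S := shift (order A).*2 k in
  bigon (relabel S A) (S z) (S w) (shifted (order A).*2 k c) (shifted (order A).*2 k d) par.
Proof.
move=> nA [[zA wA cA dA] [lc ld u h sg]] S; have [nB oB] := shift_numbered k nA.
have nS x : next_label (relabel S A) (S x) = S (next_label A x).
  by rewrite /next_label oB /S !shift_shift addnC.
have N0 : 0 < (order A).*2 by case/andP: zA => z1; apply: leq_trans.
have lS x y e : links e x y -> links (shifted (order A).*2 k e) (S x) (S y).
  by move=> /orP[] /andP[/eqP <- /eqP <-]; rewrite /links /shifted /= !eqxx ?orbT.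
have beS b : bigon_end (relabel S A) (S w) b = S (bigon_end A w b).
  by rewrite /bigon_end nS; case: b.
split; first split; rewrite /basic_arc ?oB ?shift_bounds //; try (by apply/mem_relabel; exists c);
  try by apply/mem_relabel; exists d.
split=> //; rewrite ?nS ?beS; try exact: lS.
  rewrite (map_inj_in_uniq (f := S) (s := [:: z; next_label A z; w; next_label A w])) // => x y xs ys.
  have sub t : t \in [:: z; next_label A z; w; next_label A w] -> 1 <= t <= (order A).*2.
    by rewrite !inE => /or4P[] /eqP -> //; apply: next_bounds.
  by apply: shift_eq; apply: sub.
by case: h => -[h1 h2]; [left|right]; rewrite -h2 -h1.
Qed.

(** The direction in which the strand labelled x is crossed by the other one:
    1 from right to left, -1 from left to right, whatever the heights. *)
Definition strand_sign (c : crossing) (x : nat) : int :=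
  if over c == x then sign c else (- sign c)%R.

(** Turns depend on the plane curve only: the sign of the crossing and the
    height enter through their product. *)
Lemma turn_links A phi f c y : numbered A -> c \in A -> links c (last_end A f) y ->
  turn A phi f = if (or_sign phi * f.2 * strand_sign c (last_end A f) == 1)%R
                 then (y, 1%R) else (prev_label A y, (-1)%R).
Proof.
move=> nA cA l; rewrite /strand_sign; case: (links_cases l) => -[h1 h2].
  by rewrite h1 eqxx (turn_over nA phi cA h1) h2.
have h3 : (over c == last_end A f) = false by rewrite -h1; apply/negbTE/(over_neq_under nA cA).
rewrite h3 (turn_under nA phi cA h1) h2.
by rewrite mulrN eqr_oppLR.
Qed.

Lemma turn_strand A phi f c x y k : numbered A -> c \in A -> links c x y ->
  last_end A f = x -> (or_sign phi * strand_sign c x)%R = k -> is_sign k -> is_sign f.2 ->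
  turn A phi f = if f.2 == k then (y, 1%R) else (prev_label A y, (-1)%R).
Proof.
move=> nA cA l fx kE ks fs; rewrite (turn_links phi nA cA (y := y)) fx // mulrAC kE.
by case: ks fs => -> [] ->.
Qed.

Lemma return_time (T : eqType) (s : seq T) (g : T -> T) (x : T) :
  {in s, forall y, g y \in s} -> {in s &, injective g} -> x \in s ->
  exists m, iter m.+1 g x = x.
Proof.
move=> gs ginj xs; have its n : iter n g x \in s by elim: n => //= n /gs.
have /trajectP[i ilt ei] : looping g x (size s).
  rewrite -[looping _ _ _]negbK -looping_uniq; apply/negP => u.
  have /(uniq_leq_size u) : {subset traject g x (size s).+1 <= s}.
    by move=> y /trajectP[n _ ->].
  by rewrite size_traject ltnn.
have cancel_iter n a b : a \in s -> b \in s -> iter n g a = iter n g b -> a = b.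
  elim: n a b => // n IH a b as_ bs; rewrite !iterSr => /IH h.
  by apply: ginj => //; apply: h; apply: gs.
exists (size s - i).-1; rewrite prednK ?subn_gt0 //.
by apply: (@cancel_iter i) => //; rewrite -iterD subnKC ?ei // ltnW.
Qed.

Lemma turn_returns A phi f : numbered A -> is_main_arc A f ->
  exists m, iter m.+1 (turn A phi) f = f.
Proof.
move=> nA mf; pose s : seq main_arc := [seq (i, e) | i <- iota 1 (order A).*2, e <- [:: 1%R; (-1)%R]].
have ms g : g \in s <-> is_main_arc A g.
  case: g => i e; split.
    move=> /allpairsP[[j e'] [/= js es [-> ->]]]; split=> /=.
      by move: js; rewrite mem_iota /basic_arc add1n ltnS.
    by move: es; rewrite !inE => /orP[] /eqP ->; [left|right].
  move=> [/= ib es]; apply/allpairsP; exists (i, e); split=> //=.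
    by rewrite mem_iota add1n ltnS.
  by case: es => ->; rewrite !inE eqxx ?orbT.
apply: (@return_time _ s); last exact/ms.
  by move=> g /ms mg; apply/ms/turn_main.
by move=> g h /ms mg /ms mh; apply: turn_inj.
Qed.

Section Collapse.
(* B has the bigon e_2, e_w, and B0 is B without it. *)
Variables (B : symbol) (w : nat).
Let N := (order B).*2.
Hypotheses (w4 : 4 <= w) (wN : w < N).

Lemma next2 : next_label B 2 = 3.
Proof. by rewrite nextE -/N; [case: eqP => //; lia|lia]. Qed.

Lemma nextw : next_label B w = w.+1.
Proof. by rewrite nextE -/N; [case: eqP => //; lia|lia]. Qed.

Variables (c d : crossing) (par : bool).
Hypotheses (nB : numbered B) (bg : bigon B 2 w c d par).
Let p := if par then w else w.+1.
Let q := if par then w.+1 else w.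

Lemma bigon_links : [/\ c \in B, d \in B, links c 2 p & links d 3 q].
Proof.
have [[_ _ cB dB] [lc ld _ _ _]] := bg; split=> //.
  by move: lc; rewrite /bigon_end nextw.
by move: ld; rewrite /bigon_end nextw next2 /q; case: par.
Qed.

Variables (B0 : symbol) (phi : orientation).
Let M := (order B0).*2.
Let rho : int := if par then (-1)%R else 1%R.
Let F := Omega2p_relabel 1 (w - 3).
Hypotheses (nB0 : numbered B0) (NM : N = M + 4).
Hypothesis BE : forall e, e \in B -> e = c \/ e = d \/ e \in relabel F B0.
Hypothesis phiE : (or_sign phi * strand_sign c 2)%R = rho.

Lemma strand_signs : [/\ strand_sign c p = - strand_sign c 2,
  strand_sign d 3 = - strand_sign c 2 & strand_sign d q = strand_sign c 2]%R.
Proof.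
have [cB dB lc ld] := bigon_links; have [_ [_ _ _ h sg]] := bg; rewrite next2 in h.
have cc := links_cases lc; have dd := links_cases ld.
have pq : p != 2 /\ q != 3 by rewrite /p /q; case: (par); lia.
case: pq => /negbTE p2 /negbTE q3.
by rewrite /strand_sign; case: h => -[h1 h2]; case: cc => -[h3 h4]; case: dd => -[h5 h6];
  rewrite ?h1 ?h2 ?h3 ?h4 ?h5 ?h6 ?eqxx ?sg ?(eq_sym 2) ?(eq_sym 3) ?p2 ?q3 ?opprK; split=> //;
  exfalso; lia.
Qed.

Let tau := turn B phi.
Let tau0 := turn B0 phi.

Lemma rho_sign : is_sign rho.
Proof. by rewrite /rho; case: par; [right|left]. Qed.

Lemma prevB x : 1 < x <= N -> prev_label B x = x.-1.
Proof. by move=> xN; rewrite prevE -/N; [case: eqP => //; lia|lia]. Qed.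

Lemma nextB x : 1 <= x < N -> next_label B x = x.+1.
Proof. by move=> xN; rewrite nextE -/N; [case: eqP => //; lia|lia]. Qed.

Lemma bigon_arrivals (f : main_arc) : is_sign f.2 ->
  [/\ last_end B f = 2 -> tau f = if f.2 == rho then (p, 1%R) else (p.-1, (-1)%R),
      last_end B f = p -> tau f = if f.2 == (- rho)%R then (2, 1%R) else (1, (-1)%R),
      last_end B f = 3 -> tau f = if f.2 == (- rho)%R then (q, 1%R) else (q.-1, (-1)%R) &
      last_end B f = q -> tau f = if f.2 == rho then (3, 1%R) else (2, (-1)%R)].
Proof.
move=> fs; have [cB dB lc ld] := bigon_links; have [sp s3 sq] := strand_signs.
have rN : is_sign (- rho)%R by rewrite /rho; case: par; [left; rewrite opprK|right].
have [pN qN] : 1 < p <= N /\ 1 < q <= N by rewrite /p /q; case: par; lia.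
have lc' : links c p 2 by rewrite links_sym.
have ld' : links d q 3 by rewrite links_sym.
have kp : (or_sign phi * strand_sign c p = - rho)%R by rewrite sp mulrN phiE.
have k3 : (or_sign phi * strand_sign d 3 = - rho)%R by rewrite s3 mulrN phiE.
have kq : (or_sign phi * strand_sign d q = rho)%R by rewrite sq phiE.
split=> fx; rewrite /tau.
- by rewrite (turn_strand nB cB lc fx phiE rho_sign fs) prevB.
- by rewrite (turn_strand nB cB lc' fx kp rN fs) prevB //; lia.
- by rewrite (turn_strand nB dB ld fx k3 rN fs) prevB.
by rewrite (turn_strand nB dB ld' fx kq rho_sign fs) prevB //; lia.
Qed.

Let u : main_arc := if par then (w.+1, (-1)%R) else (w.-1, 1%R).
Let v : main_arc := (1, 1%R).

Lemma last_plus x : 1 <= x < N -> last_end B (x, 1%R) = x.+1.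
Proof. by move=> xN; rewrite /last_end /= nextB. Qed.

Lemma last_minus x : last_end B (x, (-1)%R) = x.
Proof. by []. Qed.

(** The arcs v and u arrive at the two corners that lie opposite to the bigon;
    (2, -1) and (w, - rho) turn into each other and bound the bigon. *)
Lemma bigon_turns :
  [/\ tau v = (if par then (w.-1, (-1)%R) else (w.+1, 1%R)), tau u = (3, 1%R),
      tau (3, (-1)%R) = (w, rho), tau (w, rho) = (1, (-1)%R) &
      tau (2, 1%R) = (if par then (w.+1, 1%R) else (w.-1, (-1)%R))] /\
  [/\ tau (if par then (w.-1, 1%R) else (w.+1, (-1)%R)) = (2, 1%R),
      tau (2, (-1)%R) = (w, (- rho)%R) & tau (w, (- rho)%R) = (2, (-1)%R)].
Proof.
have plus : is_sign (1%R : int) by left. have minus : is_sign (-1 : int)%R by right.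
have arr x e := @bigon_arrivals (x, e).
rewrite /u /v; move: arr; rewrite /rho /p /q; case: par => arr; split; split.
- by have [h _ _ _] := arr 1 1%R plus; rewrite h // last_plus //; lia.
- by have [_ _ _ h] := arr w.+1 _ minus; rewrite h.
- by have [_ _ h _] := arr 3 _ minus; rewrite h.
- by have [_ h _ _] := arr w _ minus; rewrite h.
- by have [_ _ h _] := arr 2 _ plus; rewrite h // last_plus //; lia.
- by have [_ h _ _] := arr w.-1 _ plus; rewrite h // last_plus ?prednK //; lia.
- by have [h _ _ _] := arr 2 _ minus; rewrite h.
- by have [_ _ _ h] := arr w _ plus; rewrite opprK h // last_plus //; lia.
- by have [h _ _ _] := arr 1 1%R plus; rewrite h // last_plus //; lia.
- by have [_ _ _ h] := arr w.-1 _ plus; rewrite h // last_plus ?prednK //; lia.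
- by have [_ _ h _] := arr 3 _ minus; rewrite h.
- by have [_ h _ _] := arr w _ plus; rewrite h // last_plus //; lia.
- by have [_ _ h _] := arr 2 _ plus; rewrite h // last_plus //; lia.
- by have [_ h _ _] := arr w.+1 _ minus; rewrite h.
- by have [h _ _ _] := arr 2 _ minus; rewrite h.
by have [_ _ _ h] := arr w _ minus; rewrite h.
Qed.

(* The arc of B0 that contains a given arc of B; the two outer sides of the
   bigon belong to the faces of the opposite strands. *)
Let collapse_label (x : nat) : nat :=
  if x <= 3 then 1 else if x <= w.-1 then x - 2 else if x <= w.+1 then w - 3 else x - 4.
Let collapse (f : main_arc) : main_arc :=
  if f.1 == 2 then (w - 3, (- rho)%R) else if f.1 == w then (1, (-1)%R)
  else (collapse_label f.1, f.2).

Lemma collapse_sides e : (collapse (w.-1, e) = (w - 3, e)) * (collapse (w.+1, e) = (w - 3, e)).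
Proof.
rewrite /collapse /collapse_label /=; split.
  have -> : (w.-1 == 2) = false by lia.
  have -> : (w.-1 == w) = false by lia.
  rewrite leqnn.
  by case: ifP => h; congr (_, _); lia.
have -> : (w.+1 == 2) = false by lia.
have -> : (w.+1 == w) = false by lia.
rewrite leqnn.
by case: ifP => h1; [|case: ifP => h2]; congr (_, _); lia.
Qed.

Lemma FE x : F x = if x <= 1 then x else if x <= w - 3 then x + 2 else x + 4.
Proof. by []. Qed.

Lemma F_inj x y : F x = F y -> x = y.
Proof. by rewrite !FE; case: (leqP x 1); case: (leqP y 1); case: (leqP x (w - 3)); case: (leqP y (w - 3)); lia. Qed.

Lemma collapse_F x e : 1 <= x -> collapse (F x, e) = (x, e).
Proof.
move=> x1; rewrite /collapse /collapse_label /= FE.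
case: (leqP x 1) => h1; [|case: (leqP x (w - 3)) => h2];
  by do ![case: ifP => ?]; try (exfalso; lia); congr (_, _); lia.
Qed.

Lemma collapse_prev y : 1 <= y <= M ->
  collapse (prev_label B (F y), (-1)%R) = (prev_label B0 y, (-1)%R).
Proof.
move=> yM; have Fy : 1 <= F y <= N by rewrite FE; do ![case: ifP => ?]; lia.
have -> : prev_label B (F y) = if y <= 1 then N else (F y).-1.
  rewrite (prevE Fy); congr (if _ then _ else _); rewrite FE.
  by case: (leqP y 1) => h1; [|case: (leqP y (w - 3)) => h2]; lia.
have -> : prev_label B0 y = if y <= 1 then M else y.-1.
  by rewrite (prevE yM); congr (if _ then _ else _); lia.
rewrite /collapse /collapse_label /= FE.
case: (leqP y 1) => h1; [|case: (leqP y (w - 3)) => h2];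
  by do ![case: ifP => ?]; try (exfalso; lia); congr (_, _); lia.
Qed.

Lemma collapse_last f y : is_main_arc B f -> last_end B f = F y -> 1 <= y <= M ->
  last_end B0 (collapse f) = y /\ (collapse f).2 = f.2.
Proof.
case: f => x e [/= xB es] + yM; rewrite /basic_arc -/N in xB; case: es => ->; last first.
  by rewrite last_minus => ->; rewrite collapse_F //; lia.
rewrite /last_end /= nextE -/N // => h.
have e1 : (collapse (x, 1%R)) = (prev_label B0 y, 1%R).
  rewrite (prevE yM) -/M /collapse /collapse_label /=; move: h; rewrite FE.
  case: (x =P N) => hx; case: (y =P 1) => hy; case: (leqP y 1) => h1;
    case: (leqP y (w - 3)) => h2 h;
  by do ![case: ifP => ?]; try (exfalso; lia); congr (_, _); lia.
by rewrite e1 /= next_prev.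
Qed.

Lemma bigon_arcs f : is_main_arc B f -> f != u -> f != v ->
  f != (2, (-1)%R) -> f != (w, (- rho)%R) ->
  [|| last_end B f == 2, last_end B f == 3, last_end B f == w | last_end B f == w.+1] ->
  [\/ f = (3, (-1)%R), f = (w, rho), f = (2, 1%R) |
     f = if par then (w.-1, 1%R) else (w.+1, (-1)%R)].
Proof.
case: f => x e [/= xB es]; rewrite /basic_arc -/N in xB.
case: es => -> fu fv f2 fw; last first.
  rewrite last_minus => /or4P[] /eqP xE; subst x.
  - by rewrite eqxx in f2.
  - by apply: Or41.
  - by move: fw; rewrite /rho; case: (par) => fw; [apply: Or42|rewrite eqxx in fw].
  by move: fu; rewrite /u; case: (par) => fu; [rewrite eqxx in fu|apply: Or44].
rewrite /last_end /= nextE -/N // => h.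
have {}h : [|| x == 1, x == 2, x == w.-1 | x == w] by move: h; case: ifP; lia.
move: h => /or4P[] /eqP xE.
- by move: fv; rewrite xE eqxx.
- by rewrite xE; apply: Or43.
- by move: fu; rewrite xE /u; case: (par) => fu; [apply: Or44|rewrite eqxx in fu].
by move: fw; rewrite xE /rho; case: (par) => fw; [rewrite opprK eqxx in fw|apply: Or42].
Qed.

(** A turn in B at an old crossing is a turn in B0, and a turn at a crossing
    of the bigon stays on one arc of B0. This fails at the two corners v and
    u, where B0 has no corner any more, and inside the bigon. *)
Lemma collapse_step f : is_main_arc B f -> f != u -> f != v ->
  f != (2, (-1)%R) -> f != (w, (- rho)%R) ->
  collapse (tau f) = collapse f \/ collapse (tau f) = tau0 (collapse f).
Proof.
move=> mf fu fv f2 fw; have [[tv tu t3 tw t2] [tL tI1 tI2]] := bigon_turns.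
have [cB dB lc ld] := bigon_links.
have lb := last_end_bounds mf.
have c2 e : collapse (2, e) = (w - 3, (- rho)%R) by [].
have w1 : (1 == w) = false by rewrite ltn_eqF // (leq_trans _ w4).
have w2 : (w == 2) = false by rewrite gtn_eqF // (leq_trans _ w4).
have w3 : (3 == w) = false by rewrite ltn_eqF.
have [X|X] := boolP [|| last_end B f == 2, last_end B f == 3, last_end B f == w | last_end B f == w.+1].
  left; case: (bigon_arcs mf fu fv f2 fw X) => ->.
  - by rewrite t3 /collapse /= eqxx w2 w3.
  - by rewrite tw /collapse /= eqxx w2 w1.
  - by rewrite t2 c2 /rho; case: (par); rewrite collapse_sides // opprK.
  by rewrite tL c2 /rho; case: (par); rewrite collapse_sides // opprK.
right; have [e eB ex] := label_crossing nB lb.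
have notnew x : has_label x c || has_label x d -> [|| x == 2, x == 3, x == w | x == w.+1].
  by move=> /orP[] h; [case: (links_label lc h) => ->|case: (links_label ld h) => ->];
    rewrite /p /q; case: (par); rewrite eqxx ?orbT.
have [ec|[ed|/mem_relabel[e0 eB0 eE]]] := BE eB.
- by rewrite notnew // -ec ex in X.
- by rewrite notnew // -ed ex orbT in X.
have o0 := over_bounds nB0 eB0; have u0 := under_bounds nB0 eB0.
have [x [y [xM yM l0 fx]]] : exists x y, [/\ 1 <= x <= M, 1 <= y <= M, links e0 x y & last_end B f = F x].
  move: ex; rewrite eE => /orP[] /eqP /= h; [exists (over e0), (under e0)|exists (under e0), (over e0)];
    split=> //; by rewrite /links !eqxx ?orbT.
have lF : links e (last_end B f) (F y).
  rewrite fx eE; move: l0 => /orP[] /andP[/eqP <- /eqP <-]; by rewrite /links /= !eqxx ?orbT.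
have [l1 s1] := collapse_last mf fx xM.
have ss : strand_sign e (last_end B f) = strand_sign e0 x.
  rewrite /strand_sign fx eE /=; have [h|h] := eqVneq (over e0) x; first by rewrite h eqxx.
  by case: eqP => // /F_inj h'; rewrite h' eqxx in h.
rewrite /tau (turn_links phi nB eB lF) /tau0 (turn_links phi nB0 eB0 (y := y)) l1 //.
rewrite s1 ss; case: ifP => _; first by rewrite collapse_F //; case/andP: yM.
exact: collapse_prev.
Qed.

Variable om : main_arc -> bool.
Hypothesis om_turn : forall f, is_main_arc B f -> om (tau f) = om f.
Hypothesis om_flip : om (3, 1%R) != om (3, (-1)%R).
Hypothesis om_noflip : om (1, 1%R) = om (1, (-1)%R).

(** The colour does not change along cycles; it changes across e_3, which is
    on the loop, but not across e_1, which is not. The corner u is on one side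
    of e_3, and the other side is joined to the corner v by turns and by
    crossing e_1. *)
Lemma om_separates : om u != om v.
Proof.
have [[tv tu t3 tw t2] _] := bigon_turns.
have plus : is_sign (1%R : int) by left. have minus : is_sign (-1 : int)%R by right.
have mu : is_main_arc B u by rewrite /u /is_main_arc /basic_arc -/N; case: (par); split=> //=; lia.
have m3 : is_main_arc B (3, (-1)%R) by rewrite /is_main_arc /basic_arc -/N; split=> //=; lia.
have mw : is_main_arc B (w, rho).
  by rewrite /is_main_arc /basic_arc -/N; split=> //=; [lia|apply: rho_sign].
have e1 := om_turn mu; have e2 := om_turn m3; have e3 := om_turn mw.
by rewrite -e1 tu /v om_noflip -tw e3 -t3 e2.
Qed.

(** Follow the cycle of v from the arc after the corner back to v. It does not
    meet the other corner, which has another colour, nor the inside of the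
    bigon, whose cycle is closed. So it collapses to a path of turns in B0. *)
Lemma common_cycle_collapse : common_cycle B0 phi (1, 1%R) (w - 3, rho).
Proof.
have [[tv tu t3 tw t2] [tL tI1 tI2]] := bigon_turns.
have mv : is_main_arc B v by rewrite /is_main_arc /basic_arc -/N; split=> //=; [lia|left].
have mit n : is_main_arc B (iter n tau v) by elim: n => //= n; apply: turn_main.
have omit n : om (iter n tau v) = om v by elim: n => //= n <-; apply: om_turn.
have := turn_returns phi nB mv; rewrite -/tau => ret.
pose P m := iter m.+1 tau v == v.
have exP : exists m, P m by have [m hm] := ret; exists m; apply/eqP.
case: (ex_minnP exP) => m /eqP Pm minm.
pose I (f : main_arc) := (f == (2, (-1)%R)) || (f == (w, (- rho)%R)).
have Itau f : I f -> I (tau f) by move=> /orP[] /eqP ->; rewrite ?tI1 ?tI2 /I eqxx ?orbT.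
have noI n : n <= m.+1 -> ~~ I (iter n tau v).
  move=> nm; apply/negP => h.
  have Ik k : I (iter (k + n) tau v) by elim: k => // k; apply: Itau.
  have := Ik (m.+1 - n); rewrite subnK // Pm /I /v !xpair_eqE; lia.
have chain n : n <= m -> exists l, iter l tau0 (collapse (tau v)) = collapse (iter n.+1 tau v).
  elim: n => [|n IH] nm; first by exists 0.
  have [l hl] := IH (ltnW nm).
  have nu : iter n.+1 tau v != u by apply: contraNneq om_separates => <-; rewrite omit.
  have nv : iter n.+1 tau v != v.
    by apply/negP => h; have := minm n h; rewrite leqNgt nm.
  have := noI n.+1 (leqW nm); rewrite negb_or => /andP[i1 i2].
  case: (collapse_step (mit n.+1) nu nv i1 i2) => st.
    by exists l; rewrite hl -st.
  by exists l.+1; rewrite /= hl -st.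
have [l hl] := chain m (leqnn m); rewrite Pm in hl.
have cv : collapse v = (1, 1%R).
  by rewrite /collapse /v /= (_ : (1 == w) = false) //; lia.
have ctv : collapse (tau v) = (w - 3, rho).
  by rewrite tv /rho; case: (par); rewrite collapse_sides.
rewrite cv ctv in hl.
exists (w - 3, rho); split; last by exists l, 0.
by rewrite /is_main_arc /basic_arc -/M; split=> //=; [lia|apply: rho_sign].
Qed.

End Collapse.


Lemma orientation_exists (s k : int) : is_sign s -> is_sign k ->
  exists phi, (or_sign phi * s)%R = k.
Proof. by move=> [->|->] [->|->]; [exists alpha|exists delta|exists delta|exists alpha]. Qed.

Lemma strand_sign_is A c x : numbered A -> c \in A -> is_sign (strand_sign c x).
Proof.
move=> nA cA; rewrite /strand_sign; case: ifP => _; first exact: sign_of cA.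
by case: (sign_of nA cA) => ->; [right|left].
Qed.

Lemma crossing_eta (c : crossing) : c = (over c, under c, sign c).
Proof. by case: c => [[]]. Qed.

Lemma reinsert_label N w x : 4 <= w -> w < N -> 1 <= x <= N -> x <> 2 -> x <> 3 -> x <> w -> x <> w.+1 ->
  let y := if x <= 1 then x else if x <= w.-1 then x - 2 else x - 4 in
  1 <= y <= N - 4 /\ Omega2p_relabel 1 (w - 3) y = x.
Proof.
move=> w4 wN /andP[x0 xN] x2 x3 xw xw1; rewrite /Omega2p_relabel.
case: (leqP x 1) => h1 /=; first by rewrite h1; split=> //; lia.
case: (leqP x w.-1) => h2 /=.
  have -> : (x - 2 <= 1) = false by lia.
  have -> : x - 2 <= w - 3 by lia.
  by split; lia.
have -> : (x - 4 <= 1) = false by lia.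
have -> : (x - 4 <= w - 3) = false by lia.
by split; lia.
Qed.

Section Inverse2.
Variable P : symbol -> Prop.
Hypothesis P_numbered : forall A, P A -> numbered A.
Hypothesis P_shift : forall A k, P A -> P (relabel (shift (order A).*2 k) A).
(* Planarity enters here: the loop from the passage p to the passage q of the
   crossing c has different colours on the two sides of each of its arcs. *)
Hypothesis P_color : forall A c p q i phi, P A -> c \in A -> links c p q ->
  p < q -> p <= i < q -> exists om : main_arc -> bool,
    [/\ forall f, is_main_arc A f -> om (turn A phi f) = om f,
        om (i, 1%R) != om (i, (-1)%R) &
        forall j, basic_arc A j -> ~~ (p <= j < q) -> om (j, 1%R) = om (j, (-1)%R)].

Section Position2.
Variables (B : symbol) (w : nat) (c d : crossing) (par : bool).
Let N := (order B).*2.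
Let M := N - 4.
Hypotheses (pB : P B) (w4 : 4 <= w) (wN : w < N) (bg : bigon B 2 w c d par).
Let nB := P_numbered pB.
Let F := Omega2p_relabel 1 (w - 3).
Let G x := if x <= 1 then x else if x <= w.-1 then x - 2 else x - 4.
Let Q := (B `\ c) `\ d.
Let B0 := relabel G Q.
Let p := if par then w else w.+1.
Let q := if par then w.+1 else w.

Lemma bigon_removed : labelled M B0 /\ relabel F B0 = Q.
Proof.
have [cB dB lc ld] := bigon_links w4 wN bg; rewrite -/p -/q in lc ld.
have lab x : [|| x == 2, x == 3, x == w | x == w.+1] = has_label x c || has_label x d.
  have [c2 cp] := links_has lc; have [d3 dq] := links_has ld.
  apply/idP/orP; last first.
    by move=> [] h; [case: (links_label lc h) => ->|case: (links_label ld h) => ->];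
      rewrite /p /q; case: (par); rewrite eqxx ?orbT.
  move: cp dq; rewrite /p /q; case: (par) => cp dq /or4P[] /eqP ->; by [left|right].
apply: (@sub_labelled B) => //.
- by move=> e; rewrite !in_fsetD1 => /and3P[].
- move=> e x; rewrite !in_fsetD1 => /and3P[ed ec eB] xe.
  have xN := label_bounds nB eB xe; rewrite -/N in xN.
  have : ~~ [|| x == 2, x == 3, x == w | x == w.+1].
    rewrite lab; apply/negP => /orP[] h.
      by rewrite (label_inj nB eB cB xe h) eqxx in ec.
    by rewrite (label_inj nB eB dB xe h) eqxx in ed.
  by rewrite !negb_or => /and4P[/eqP x2 /eqP x3 /eqP xw /eqP xw1]; have [] := reinsert_label w4 wN xN x2 x3 xw xw1.
move=> y yM.
have FyN : 1 <= F y <= N by move: yM; rewrite /M /F /Omega2p_relabel; do ![case: ifP => ?]; lia.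
split.
  move: yM; rewrite /M /F /G /Omega2p_relabel.
  by case: (leqP y 1) => h1; [|case: (leqP y (w - 3)) => h2]; do ![case: ifP => ?]; lia.
have [e eB ye] := label_crossing nB FyN; exists e => //; rewrite !in_fsetD1 eB andbT.
have : ~~ [|| F y == 2, F y == 3, F y == w | F y == w.+1].
  rewrite /F /Omega2p_relabel.
  by case: (leqP y 1) => h1; [|case: (leqP y (w - 3)) => h2]; lia.
rewrite lab negb_or => /andP[h1 h2]; apply/andP; split.
  by apply: contraNneq h2 => <-.
by apply: contraNneq h1 => <-.
Qed.

Lemma Omega2p_bigon : Omega2p B0 B.
Proof.
have [lB0 FB0] := bigon_removed; have [nB0 oB0] := labelled_numbered lB0.
have [cB dB lc ld] := bigon_links w4 wN bg; rewrite -/p -/q in lc ld.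
have N6 : 6 <= N by move: w4 wN; rewrite /N; lia.
pose rho : int := if par then (-1)%R else 1%R.
have rs : is_sign rho by rewrite /rho; case: par; [right|left].
have [phi phiE] := orientation_exists (strand_sign_is 2 nB cB) rs.
have BE e : e \in B -> e = c \/ e = d \/ e \in relabel F B0.
  move=> eB; rewrite FB0 !in_fsetD1 eB.
  by have [->|] := eqVneq e c; [left|have [->|] := eqVneq e d; auto].
have NM : N = (order B0).*2 + 4 by rewrite -oB0 /M; lia.
have pl : 2 < p by rewrite /p; case: (par); lia.
have i3 : 2 <= 3 < p by rewrite /p; case: (par); lia.
have [om [omt omf omn]] := P_color (i := 3) phi pB cB lc pl i3.
have cyc : common_cycle B0 phi (1, 1%R) (w - 3, rho).
  apply: (common_cycle_collapse w4 wN nB bg nB0 NM BE phiE omt omf).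
  by apply: omn => //; rewrite /basic_arc -/N; lia.
right; split; first by move=> B00; move: oB0; rewrite B00 /order cardfs0 /M; lia.
pose theta : int := if over c == 2 then 1%R else (-1)%R.
exists 1, (w - 3), 0, phi, rho, theta; split; split=> //.
- by lia.
- by rewrite -oB0 /M; lia.
- by rewrite /theta; case: ifP => _; [left|right].
- by case: ifP => // _; case: ifP.
have new : Omega2p_new 1 (w - 3) phi rho theta = [fset c; d].
  have [_ [_ _ _ h sg]] := bg; rewrite (next2 w4 wN) in h.
  have -> : Omega2p_new 1 (w - 3) phi rho theta =
    if theta == 1%R then [fset (2, p, (or_sign phi * rho)%R); (3, q, (- (or_sign phi * rho))%R)]
    else [fset (p, 2, (- (or_sign phi * rho))%R); (q, 3, (or_sign phi * rho)%R)].
    have e1 : w - 3 + 4 = w.+1 by lia. have e2 : w - 3 + 3 = w by lia.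
    by rewrite /Omega2p_new /Omega2p_ends /p /q /rho e1 e2; case: (par).
  have sq : (or_sign phi * rho)%R = strand_sign c 2 by rewrite -phiE mulrA; case: (phi); rewrite mul1r.
  rewrite sq /theta /strand_sign.
  case: h => -[h1 h2].
    rewrite h1 eqxx /=.
    have [[_ u1]|[u1 u2]] := links_cases lc; last by exfalso; lia.
    have [[_ v1]|[v1 v2]] := links_cases ld; last by exfalso; move: v2 h2; rewrite /q; case: (par); lia.
    by rewrite [in RHS](crossing_eta c) [in RHS](crossing_eta d) h1 u1 h2 v1 sg opprK.
  have [[u1 u2]|[_ u1]] := links_cases lc; first by exfalso; lia.
  have [[v1 v2]|[_ v1]] := links_cases ld; first by exfalso; move: v2 h2; rewrite /q; case: (par); lia.
  rewrite u1 (_ : (p == 2) = false) /=; last by lia.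
  by rewrite [in RHS](crossing_eta c) [in RHS](crossing_eta d) h1 u1 h2 v1 sg !opprK.
rewrite new FB0 relabel_id.
  apply/fsetP => e; rewrite in_fsetU in_fset2 !in_fsetD1.
  apply/idP/idP; last by move=> /orP[h|/and3P[//]]; move: h => /orP[] /eqP ->.
  move=> eB; rewrite eB andbT; have [//|ec] := eqVneq e c.
  by case: (e == d).
move=> e x; rewrite in_fsetU in_fset2 !in_fsetD1 => he xe; apply: shift0; rewrite -NM.
by apply: (label_bounds nB _ xe); case/orP: he => [h|/and3P[//]]; move: h => /orP[] /eqP ->.
Qed.
End Position2.

Lemma bigon_all A z w c d par : numbered A -> order A = 2 -> bigon A z w c d par ->
  c != d /\ A = [fset c; d].
Proof.
move=> nA o2 [[_ _ cA dA] [_ _ _ _ sg]].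
have cd : c != d.
  by apply/eqP => e; move: sg; rewrite e; case: (sign_of nA dA) => ->.
split=> //; apply/esym/eqP; rewrite eqEfcard cardfs2 cd -/(order A) o2 andbT.
by apply/fsubsetP => e; rewrite in_fset2 => /orP[] /eqP ->.
Qed.

(** With two crossings the bigon is the whole symbol. If its arcs run in the
    same direction, the passages meet the crossings in the order c, d, c, d,
    and a colouring shows that no plane curve does so; otherwise the symbol is
    one of those created from the empty one. *)
Lemma bigon_order2 B w c d par : P B -> order B = 2 -> bigon B 1 w c d par -> Omega2p fset0 B.
Proof.
move=> pB o2 bg; have nB := P_numbered pB.
have [cd BE] := bigon_all nB o2 bg.
have [[_ wB cB dB] [lc ld u h sg]] := bg.
have num x : 1 <= x <= 4 -> (next_label B x = if x == 4 then 1 else x.+1) /\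
    (prev_label B x = if x == 1 then 4 else x.-1).
  by move=> xb; rewrite nextE ?prevE o2.
have [n1 _] := num 1 isT.
have w3 : w = 3.
  move: wB u; rewrite /basic_arc o2 n1 /= => wB; rewrite (num w wB).1 !inE.
  by case: (w =P 4) => h4; lia.
rewrite /bigon_end w3 n1 (num 3 isT).1 in lc ld h; rewrite /= in h.
case: par lc ld bg => /= lc ld bg; last first.
  left; split=> //; exists (sign c); split; first exact: sign_of cB.
  have sd : sign d = (- sign c)%R by rewrite sg opprK.
  rewrite -sd BE; case: h => -[h1 h2]; [left|right].
    have [[_ u1]|[u1 _]] := links_cases lc; last by have := over_neq_under nB cB; rewrite h1 u1.
    have [[_ v1]|[v1 _]] := links_cases ld; last by have := over_neq_under nB dB; rewrite h2 v1.
    by rewrite [in LHS](crossing_eta c) [in LHS](crossing_eta d) h1 h2 u1 v1.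
  have [[u1 _]|[_ u1]] := links_cases lc; first by have := over_neq_under nB cB; rewrite h1 u1.
  have [[v1 _]|[_ v1]] := links_cases ld; first by have := over_neq_under nB dB; rewrite h2 v1.
  by rewrite [in LHS](crossing_eta c) [in LHS](crossing_eta d) h1 h2 u1 v1.
exfalso; have plus : is_sign (1%R : int) by left. have minus : is_sign (-1 : int)%R by right.
have [phi k1] := orientation_exists (strand_sign_is 1 nB cB) minus.
have [om [omt omf _]] := P_color (i := 2) phi pB cB lc isT isT.
have [s3 s2 s4] : [/\ strand_sign c 3 = - strand_sign c 1, strand_sign d 2 = - strand_sign c 1
    & strand_sign d 4 = strand_sign c 1]%R.
  have cc := links_cases lc; have dd := links_cases ld.
  by rewrite /strand_sign; case: h => -[h1 h2]; case: cc => -[h3 h4]; case: dd => -[h5 h6];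
    rewrite ?h1 ?h2 ?h3 ?h4 ?h5 ?h6 ?sg ?opprK; split=> //; exfalso;
    clear -h1 h2 h3 h4 h5 h6; lia.
have lc' : links c 3 1 by rewrite links_sym.
have ld' : links d 4 2 by rewrite links_sym.
have k3 : (or_sign phi * strand_sign c 3 = 1)%R by rewrite s3 mulrN k1 opprK.
have k2 : (or_sign phi * strand_sign d 2 = 1)%R by rewrite s2 mulrN k1 opprK.
have k4 : (or_sign phi * strand_sign d 4 = -1)%R by rewrite s4 k1.
have m f : f \in [:: (2, (-1)%R); (3, (-1)%R); (4, (-1)%R)] -> is_main_arc B f.
  by rewrite !inE => /or3P[] /eqP ->; rewrite /is_main_arc /basic_arc o2; split.
have t2 : turn B phi (2, (-1)%R) = (3, (-1)%R).
  by rewrite (turn_strand nB dB ld (last_minus _ _) k2 plus minus) /= (num 4 isT).2.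
have t3 : turn B phi (3, (-1)%R) = (4, (-1)%R).
  by rewrite (turn_strand nB cB lc' (last_minus _ _) k3 plus minus) /= (num 1 isT).2.
have t4 : turn B phi (4, (-1)%R) = (2, 1%R).
  by rewrite (turn_strand nB dB ld' (last_minus _ _) k4 minus minus).
have q2 : om (3, (-1)%R) = om (2, (-1)%R) by rewrite -t2 omt //; apply: m.
have q3 : om (4, (-1)%R) = om (3, (-1)%R) by rewrite -t3 omt //; apply: m.
have q4 : om (2, 1%R) = om (4, (-1)%R) by rewrite -t4 omt //; apply: m.
by rewrite q4 q3 q2 eqxx in omf.
Qed.

Lemma shift_remove2E A k c d : numbered A -> c \in A -> d \in A -> c != d ->
  relabel (shift (order A).*2 k) ((A `\ c) `\ d) =
  (relabel (shift (order A).*2 k) A `\ shifted (order A).*2 k c) `\ shifted (order A).*2 k d.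
Proof.
move=> nA cA dA cd; rewrite -shift_removeE //; apply: relabelD1.
  by rewrite in_fsetD1 dA eq_sym cd.
move=> e; rewrite in_fsetD1 => /andP[_ eA].
move=> /(shift_eq (over_bounds nA eA) (over_bounds nA dA)) h.
by apply: (label_inj nA (x := over d)); rewrite // /has_label ?h eqxx.
Qed.

(** After z is rotated to 2, the other arc must lie between the labels 4 and
    2n for the bigon to be created with a = 1 and without an additional
    rotation; this fails only when the last end of e_w precedes z immediately. *)
Lemma remove_bigon A A' z w c d par : P A -> P A' -> A' = compress ((A `\ c) `\ d) ->
  bigon A z w c d par -> next_label A w != prev_label A z -> sim P A' A.
Proof.
move=> pA pA' eA' bg wz; have nA := P_numbered pA; pose N := (order A).*2.
have [[zA wA cA dA] [_ _ u _ sg]] := bg.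
have cd : c != d.
  by apply/eqP => e; move: sg; rewrite e; case: (sign_of nA dA) => ->.
have N2 : 2 <= N by rewrite /N; case/andP: zA; lia.
have [k kz] := @shift_to N z 2 zA N2.
have [nB oB] := shift_numbered k nA.
have bg' := bigon_shift k nA bg; rewrite /= -/N in bg' nB oB.
set B := relabel _ A in bg' nB oB; set S := shift N k in bg'; rewrite -/S in kz.
set w1 := S w in bg'; rewrite kz in bg'.
have nS x : next_label B (S x) = S (next_label A x).
  by rewrite /next_label oB -/N /S !shift_shift addnC.
have Spz : S (prev_label A z) = 1.
  have h : next_label B (S (prev_label A z)) = 2 by rewrite nS next_prev.
  have pb : 1 <= S (prev_label A z) <= (order B).*2 by rewrite oB; apply: shift_bounds; lia.
  by move: h pb; rewrite /next_label => h pb; move: h; rewrite next_shift //; case: eqP; lia.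
have [w4 wN] : 4 <= w1 /\ w1 < (order B).*2.
  have [[_ wB _ _] [_ _ u' _ _]] := bg'.
  have nw1 : next_label B w1 != 1.
    rewrite /w1 nS -Spz; apply: contra_neq wz => h.
    by apply: (shift_eq _ _ h); [apply: next_bounds|apply: prev_bounds].
  have n2 : next_label B 2 = if 2 == (order B).*2 then 1 else 3 by rewrite nextE //; lia.
  move: nw1 u'; rewrite /= !inE n2 (nextE wB); rewrite /basic_arc in wB.
  by case: (w1 =P (order B).*2) => h1; case: (2 =P (order B).*2) => h2; lia.
have pB : P B := P_shift k pA.
have [lB0 FB0] := bigon_removed pB w4 wN bg'.
have [nB0 oB0] := labelled_numbered lB0.
apply: (sim_remove P_numbered P_shift pA pA' nB0 eA' (k := k) _ _ (F := Omega2p_relabel 1 (w1 - 3))).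
- by move=> e; rewrite !in_fsetD1 => /and3P[].
- by rewrite FB0 shift_remove2E.
- move=> x y x1 xy yM; rewrite /Omega2p_relabel.
  by case: (leqP x 1); case: (leqP y 1); case: (leqP x (w1 - 3)); case: (leqP y (w1 - 3)); lia.
- move=> x; rewrite -oB0 -/N oB -/N /Omega2p_relabel => xb.
  by move: wN; rewrite oB -/N => wN; case: (leqP x 1); case: (leqP x (w1 - 3)); lia.
move=> pB0; apply: sim_move => //; do 4 right; left.
exact: (Omega2p_bigon pB w4 wN bg').
Qed.

(** The two arcs may be exchanged, so only the case in which each arc
    immediately precedes the other one is left; then the bigon has all the
    labels, hence two crossings. *)
Lemma Omega2m_inverse A A' : P A -> P A' -> Omega2m A A' -> sim P A' A.
Proof.
move=> pA pA' [z [w [c [d [g sg eA']]]]]; have nA := P_numbered pA.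
have [par bg] := gon2_bigon nA g sg; pose N := (order A).*2.
have [[zA wA cA dA] [_ _ u _ _]] := bg; have [c' [d' [bg' cd']]] := bigon_swap bg.
have [n2|n2] := eqVneq (order A) 2.
  have [cd AE] := bigon_all nA n2 bg.
  have A0 : A' = fset0.
    rewrite eA' -[RHS]compress0; congr compress; apply/fsetP => e.
    by rewrite AE !in_fsetD1 in_fset2 in_fset0; case: (e == c); case: (e == d).
  have [k kz] := @shift_to N z 1 zA ltac:(by rewrite /N n2).
  have := bigon_shift k nA bg; rewrite /= -/N kz => bg1.
  have [nB oB] := shift_numbered k nA.
  apply: sim_trans (sim_unshift P_numbered P_shift k pA).
  apply: sim_move => //; first exact: P_shift.
  do 4 right; left; rewrite A0; apply: bigon_order2 bg1; first exact: P_shift.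
  by rewrite oB.
have [wz|wz] := eqVneq (next_label A w) (prev_label A z); last exact: remove_bigon eA' bg wz.
have [zw|zw] := eqVneq (next_label A z) (prev_label A w); last first.
  apply: remove_bigon bg' zw => //; rewrite eA'.
  by case: cd' => -[-> ->]; [exact: erefl|rewrite !fsetDDl fsetUC].
exfalso; clear -u n2 zA wA wz zw.
exfalso; move: u; rewrite /= !inE; move: zA wA wz zw; rewrite /basic_arc => zA wA.
by rewrite !nextE // !prevE //; do ![case: eqP => ?]; lia.
Qed.
End Inverse2.

Local Close Scope fset_scope.
Local Open Scope ring_scope.
Local Open Scope classical_set_scope.

(** * Based symbols of diagrams *)

Section Based.
Context {R : realType} {C : category}.
Variables (K : @diagram R C).
Notation X := (cx K).
Notation Y := (cy K).
Notation doub := (double X Y).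

Lemma double_sym s t : doub s t -> doub t s.
Proof. by move=> [n hX hY]; split=> // -[k hk]; apply: n; exists (- k); rewrite mulrNz -hk opprB. Qed.

Lemma double_passage s t : doub s t -> passage X Y s /\ passage X Y t.
Proof. by move=> d; split; [exists t|exists s; apply: double_sym]. Qed.

Lemma double_shift s t (k l : int) : doub s t -> doub (s + k%:~R) (t + l%:~R).
Proof.
move=> [n hX hY]; have pX := cx_periodic K; have pY := cy_periodic K.
split; rewrite ?periodic_int //.
move=> [j hj]; apply: n; exists (j - k + l); rewrite intrD intrB -hj; ring.
Qed.

Lemma derive1_periodic (f : R -> R) (k : int) t : (forall t, f (t + 1) = f t) ->
  derive1 f (t + k%:~R) = derive1 f t.
Proof.
move=> pf; rewrite /derive1; set d := (fun _ : R => _); set d' := (fun _ : R => _).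
suff -> : d = d' by []; rewrite funeqE => h; rewrite /d /d' addrA.
by rewrite !(periodic_int pf).
Qed.

Lemma det_shift s t (k l : int) : det X Y (s + k%:~R) (t + l%:~R) = det X Y s t.
Proof.
have pX := cx_periodic K; have pY := cy_periodic K.
by rewrite /det !derive1_periodic.
Qed.

Lemma up_shift s (k : int) : up K (s + k%:~R) = up K s.
Proof.
have pu := up_periodic K; have pn (n : nat) t : up K (t + n%:R) = up K t.
  by elim: n t => [|n IH] t; rewrite ?addr0 // -natr1 addrA pu IH.
case: k => n; rewrite ?NegzE ?mulrNz -?pmulrn ?pn //.
by rewrite -{2}[s](subrK n.+1%:R) pn.
Qed.

Lemma passage_shift t (k : int) : passage X Y (t + k%:~R) <-> passage X Y t.
Proof.
have pX := cx_periodic K; have pY := cy_periodic K.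
split; last exact: periodic_passage.
by move=> /(periodic_passage (- k) pX pY); rewrite mulrNz addrK.
Qed.

Variables (t0 : R) (A : symbol) (ts : seq R).
Hypothesis base : base_point K t0.
Hypothesis sts : sorted <%R ts.
Hypothesis mem_ts : forall t, t \in ts <-> t0 < t < t0 + 1 /\ passage X Y t.
Hypothesis mem_A : forall c : crossing, c \in A <->
  exists s t, [/\ s \in ts, t \in ts, doub s t, up K s
    & c = ((index s ts).+1, (index t ts).+1, if 0 < det X Y s t then 1 else -1)].

Lemma uniq_ts : uniq ts.
Proof. exact: lt_sorted_uniq. Qed.

Lemma same_param_ts s t : s \in ts -> t \in ts -> same_param s t -> s = t.
Proof.
move=> /mem_ts[/andP[s1 s2] _] /mem_ts[/andP[t1 t2] _] st.
have [l|l|//] := ltgtP s t.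
  by case: (@not_same_param R s t); [apply/andP; split; lra|case: st => k hk; exists (- k); rewrite mulrNz -hk opprB].
by case: (@not_same_param R t s); [apply/andP; split; lra|].
Qed.

Lemma partner_exists t : t \in ts -> exists2 s, s \in ts & doub t s.
Proof.
move=> /mem_ts[tb [s d]]; have [k /andP[k0 k1]] := shift_into t0 s.
have d' : doub t (s + k%:~R) by have := double_shift 0 k d; rewrite addr0.
exists (s + k%:~R) => //; apply/mem_ts; split; last by have [] := double_passage d'.
rewrite k1 andbT lt_neqAle k0 andbT; apply/eqP => e; apply: base; rewrite e.
by have [] := double_passage d'.
Qed.

Lemma partner_unique t s s' : s \in ts -> s' \in ts -> doub t s -> doub t s' -> s = s'.
Proof. by move=> sts' s'ts d d'; apply: same_param_ts => //; apply: double_points d d'. Qed.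

Lemma index_inj s t : s \in ts -> t \in ts -> index s ts = index t ts -> s = t.
Proof. by move=> ss tt e; rewrite -(nth_index 0 ss) e nth_index. Qed.

Lemma based_labelled : labelled (size ts) A.
Proof.
have ix t : t \in ts -> (1 <= (index t ts).+1 <= size ts)%N by move=> tt; rewrite ltnS leq0n index_mem.
split.
- by move=> c /mem_A[s [t [_ _ _ _ ->]]]; rewrite /sign /=; case: ifP; [left|right].
- move=> c /mem_A[s [t [ss tt d us ->]]]; apply/eqP => -[/(index_inj ss tt) e].
  by case: d => n _ _; apply: n; exists 0; rewrite e subrr.
- move=> c c' x /mem_A[s [t [ss tt d us ->]]] /mem_A[s' [t' [ss' tt' d' us' ->]]].
  have ou := over_under d; have ou' := over_under d'.
  move=> /orP[] /eqP <- /orP[] /eqP [] /index_inj e.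
  + have es := e ss' ss; have et : t' = t by apply: (partner_unique tt' tt _ d); rewrite -es.
    by rewrite es et.
  + by have es := e tt' ss; move: ou'; rewrite us' es us.
  + by have es := e ss' tt; move: ou; rewrite us -es us'.
  have et := e tt' tt; have es : s' = s.
    apply: (partner_unique (t := t) ss' ss); last exact: double_sym.
    by rewrite -et; apply: double_sym.
  by rewrite es et.
move=> x; split.
  case: x => // i /andP[_ ix']; have it : nth 0 ts i \in ts by apply: mem_nth.
  have [s ss d] := partner_exists it; have ou := over_under d.
  have ei : index (nth 0 ts i) ts = i by rewrite index_uniq // uniq_ts.
  have [u|u] := boolP (up K (nth 0 ts i)).
    exists ((index (nth 0 ts i) ts).+1, (index s ts).+1,
        if 0 < det X Y (nth 0 ts i) s then 1 else -1).
      by apply/mem_A; exists (nth 0 ts i), s.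
    by rewrite /has_label /= ei eqxx.
  exists ((index s ts).+1, (index (nth 0 ts i) ts).+1,
      if 0 < det X Y s (nth 0 ts i) then 1 else -1).
    apply/mem_A; exists s, (nth 0 ts i); split=> //; first exact: double_sym.
    by move: u; rewrite ou negbK.
  by rewrite /has_label /= ei eqxx orbT.
by move=> [c /mem_A[s [t [ss tt _ _ ->]]] /orP[] /eqP <-]; apply: ix.
Qed.

(** Moving the base point past the first passage x makes x the last passage,
    at the time x + 1 of the next period; all labels drop by one modulo their
    number. *)
Lemma rotate_one : (1 < size ts)%N ->
  Sigma_D R C (relabel (shift (size ts) (size ts).-1) A).
Proof.
case def_ts: ts => [|x [|y r]] // _; set ts' := rcons (y :: r) (x + 1).
have xts : x \in ts by rewrite def_ts mem_head.
have yts : y \in ts by rewrite def_ts !inE eqxx orbT.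
have := sts; rewrite def_ts /= => /andP[xy pr].
have yr z : z \in r -> y < z by move=> zr; have /allP := order_path_min lt_trans pr; apply.
have [/andP[x1 x2] xp] := (mem_ts x).1 xts; have [/andP[y1 y2] yp] := (mem_ts y).1 yts.
pose m := (x + y) / 2; have [xm my] : x < m /\ m < y by rewrite /m; split; lra.
have gap z : z \in ts -> z = x \/ y <= z.
  by rewrite def_ts !inE => /or3P[/eqP ->|/eqP ->|/yr/ltW]; auto.
have np : ~ passage X Y m.
  move=> pm; have /gap[e|] : m \in ts by apply/mem_ts; split=> //; apply/andP; split; lra.
    by move: xm; rewrite e ltxx.
  by rewrite leNgt my.
have sts' : sorted <%R ts'.
  rewrite /ts' /= rcons_path pr /=.
  have : last y r \in ts by rewrite def_ts in_cons mem_last orbT.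
  by move=> /mem_ts[/andP[_ l2] _]; lra.
have mem_ts' t : t \in ts' <-> m < t < m + 1 /\ passage X Y t.
  rewrite mem_rcons in_cons; split.
    move=> /orP[/eqP ->|tr].
      by split; [apply/andP; split; lra|apply: (passage_shift x 1).2].
    have tt : t \in ts by rewrite def_ts in_cons tr orbT.
    have [/andP[l1 l2] pt] := (mem_ts t).1 tt; split=> //.
    have yt : y <= t by move: tr; rewrite in_cons => /orP[/eqP ->|/yr/ltW].
    by apply/andP; split; lra.
  move=> [/andP[m1 m2] pt]; have [l|l|e] := ltgtP t (t0 + 1).
  - have tt : t \in ts by apply/mem_ts; split=> //; apply/andP; split; lra.
    move: (tt); rewrite def_ts in_cons => /orP[/eqP e|->]; last by rewrite orbT.
    by move: m1; rewrite e; lra.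
  - have pt' : passage X Y (t - 1) by apply: (passage_shift (t - 1) 1).1; rewrite subrK.
    have /gap[e|] : t - 1 \in ts by apply/mem_ts; split=> //; apply/andP; split; lra.
      by rewrite -e subrK eqxx.
    by lra.
  by case: base; apply: (passage_shift t0 1).1; rewrite -e.
have size' : size ts' = size ts by rewrite size_rcons def_ts.
pose mv t := if t == x then x + 1 else t.
have mv_shift t : exists k : int, mv t = t + k%:~R.
  by rewrite /mv; case: eqP => [->|_]; [exists 1|exists 0; rewrite addr0].
have uts' : uniq ts' by apply: lt_sorted_uniq.
have mv_mem t : t \in ts -> mv t \in ts'.
  rewrite /mv def_ts in_cons mem_rcons in_cons; case: eqP => [->|_] /=; first by rewrite eqxx.
  by move=> ->; rewrite orbT.
have mv_index t : t \in ts -> (index (mv t) ts').+1 = shift (size ts) (size ts).-1 (index t ts).+1.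
  move=> tt; rewrite prev_shift ?ltnS ?leq0n ?index_mem // eqSS /mv.
  have i0 z : index z ts = if x == z then 0%N else (index z (y :: r)).+1 by rewrite def_ts.
  rewrite i0 (eq_sym x); case: (t =P x) => [e|/eqP ne].
    have nx : (x + 1 \in y :: r) = false.
      apply/negbTE/negP => h.
      have /mem_ts[/andP[_ l] _] : x + 1 \in ts by rewrite def_ts in_cons h orbT.
      by move: l; rewrite ltrD2r ltNge (ltW x1).
    by rewrite /ts' -cats1 index_cat nx /= eqxx addn0 def_ts.
  have tr : t \in y :: r by move: tt; rewrite def_ts in_cons (negbTE ne).
  by rewrite /ts' -cats1 index_cat tr.
exists K, m; split=> //; exists ts'; split=> // c; split.
  move=> /mem_relabel[d /mem_A[s [t [ss tt ds us ->]]] ->].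
  have [k ek] := mv_shift s; have [l el] := mv_shift t.
  exists (mv s), (mv t); split; try exact: mv_mem.
  - by rewrite ek el; apply: double_shift.
  - by rewrite ek up_shift.
  by rewrite !mv_index // ek el det_shift def_ts.
have back t : t \in ts' -> exists2 t', t' \in ts & t = mv t'.
  rewrite mem_rcons in_cons => /orP[/eqP ->|tr]; first by exists x => //; rewrite /mv eqxx.
  exists t; first by rewrite def_ts in_cons tr orbT.
  rewrite /mv; case: eqP => // e; move: tr; rewrite e in_cons => /orP[/eqP h|/yr h]; lra.
move=> [s [t [/back[s' ss ->] /back[t' tt ->] ds us ->]]].
have [k ek] := mv_shift s'; have [l el] := mv_shift t'.
apply/mem_relabel; exists ((index s' ts).+1, (index t' ts).+1, if 0 < det X Y s' t' then 1 else -1).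
  apply/mem_A; exists s', t'; split=> //; last by move: us; rewrite ek up_shift.
  by move: ds; rewrite ek el => /(double_shift (- k) (- l)); rewrite !mulrNz !addrK.
by rewrite !mv_index // ek el det_shift def_ts.
Qed.

End Based.

(** * Colourings of the faces of a diagram *)

Lemma diagram_smooth_or_pl (R : realType) (C : category) (K : @diagram R C) :
  smooth_curve (cx K) (cy K) \/ pl_curve (cx K) (cy K).
Proof. by case: C K => K; [left|right]; exact: (curve_category K). Qed.

Section Coloring.
Context {R : realType} {C : category}.
Variables (K : @diagram R C).
Notation X := (cx K).
Notation Y := (cy K).

Lemma diagram_pushable t : exists e wx wy : R, 0 < e /\ pushes X Y 1 t e wx wy.
Proof.
case: (diagram_smooth_or_pl K) => [[sX sY nz]|pl].
  by apply: smooth_pushable => //; apply: nz.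
exact: (pl_pushable t (cx_periodic K) (cy_periodic K) (finite_passages K) pl).
Qed.

Lemma diagram_continuous : continuous X /\ continuous Y.
Proof.
case: (diagram_smooth_or_pl K) => [[sX sY nz]|pl].
  by split=> t; apply: differentiable_continuous; apply/derivable1_diffP; [apply: (sX 0%N)|apply: (sY 0%N)].
split=> t; have [e [a1 [b1 [a2 [b2 [e0 hl hr]]]]]] :=
  pl_locally_affine t (cx_periodic K) (cy_periodic K) pl.
  by apply: (affine_sides_continuous (a := a2) (b := a1) e0) => h he; [have [] := hr h he|have [] := hl h he].
by apply: (affine_sides_continuous (a := b2) (b := b1) e0) => h he; [have [] := hr h he|have [] := hl h he].
Qed.

Lemma diagram_strictly_transverse s t : double X Y s t ->
  exists2 e : R, 0 < e & strictly_transverse X Y (if 0 < det X Y s t then 1 else - 1) s t e.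
Proof.
move=> d; have [dXs dYs dXt dYt nz] := transverse d.
case: (diagram_smooth_or_pl K) => [[sX sY _]|pl]; first exact: smooth_strictly_transverse.
exact: (pl_strictly_transverse (cx_periodic K) (cy_periodic K) pl).
Qed.

Variables (t0 : R) (A : symbol) (ts : seq R).
Hypothesis base : base_point K t0.
Hypothesis sts : sorted <%R ts.
Hypothesis mem_ts : forall t, t \in ts <-> t0 < t < t0 + 1 /\ passage X Y t.
Hypothesis mem_A : forall c : crossing, c \in A <->
  exists s t, [/\ s \in ts, t \in ts, double X Y s t, up K s
    & c = ((index s ts).+1, (index t ts).+1, if 0 < det X Y s t then 1 else -1)].

Let N := size ts.
Definition time (x : nat) : R := nth 0 ts x.-1.
(** The last arc runs past the base point to the first passage of the next
    period. *)
Definition edge_end (i : nat) : R := if (i < size ts)%N then nth 0 ts i else nth 0 ts 0 + 1.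
Definition mid (i : nat) : R := (time i + edge_end i) / 2.

Lemma time_mem i : (1 <= i <= N)%N -> time i \in ts.
Proof. by move=> iN; apply: mem_nth; rewrite -/N; lia. Qed.

Lemma time_lt i j : (1 <= i)%N -> (i < j)%N -> (j <= N)%N -> time i < time j.
Proof.
move=> i1 ij jN; apply: (sorted_ltn_nth lt_trans 0 sts); rewrite ?inE -/N; lia.
Qed.

Lemma time_bounds i : (1 <= i <= N)%N -> t0 < time i < t0 + 1.
Proof. by move=> /time_mem/mem_ts[]. Qed.

Lemma edge_end_lt i : (1 <= i < N)%N -> edge_end i = time i.+1.
Proof. by move=> /andP[_ iN]; rewrite /edge_end iN. Qed.

Lemma edge_end_last : edge_end N = time 1 + 1.
Proof. by rewrite /edge_end ltnn. Qed.

Lemma edge_nonempty i : (1 <= i <= N)%N -> time i < edge_end i.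
Proof.
move=> iN; have [l|l] := ltnP i N; first by rewrite edge_end_lt ?time_lt //; lia.
have -> : i = N by lia.
have /andP[a b] := time_bounds iN; have /andP[c d] := @time_bounds 1 ltac:(lia).
have e : i = N by lia. rewrite e in a b.
by rewrite edge_end_last; lra.
Qed.

Lemma edge_nonpassage i t : (1 <= i <= N)%N -> time i < t < edge_end i -> ~ passage X Y t.
Proof.
move=> iN /andP[l1 l2] pt.
have between z : z \in ts -> time i < z -> (i < N)%N && (time i.+1 <= z).
  move=> zt iz; have zN : (index z ts < N)%N by rewrite index_mem.
  have ez : z = time (index z ts).+1 by rewrite /time nth_index.
  have iz' : (i < (index z ts).+1)%N.
    rewrite ltnNge; apply/negP; rewrite leq_eqVlt => /orP[/eqP e|h].
      by move: iz; rewrite ez e ltxx.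
    have := @time_lt (index z ts).+1 i isT h ltac:(lia); rewrite -ez => h'.
    by move: (lt_trans iz h'); rewrite ltxx.
  apply/andP; split; first by lia.
  have [e|ne] := eqVneq i.+1 (index z ts).+1; first by rewrite e -ez.
  by rewrite ez ltW // time_lt //; lia.
have /andP[b1 b2] := time_bounds iN.
have [l|l|e] := ltgtP t (t0 + 1).
- have /between/(_ l1)/andP[i2 h] : t \in ts by apply/mem_ts; split=> //; apply/andP; split; lra.
  by move: l2; rewrite edge_end_lt ?ltNge ?h //; lia.
- have pt' : passage X Y (t - 1) by apply: (passage_shift K (t - 1) 1).1; rewrite subrK.
  have [iN'|iN'] := ltnP i N.
    rewrite edge_end_lt in l2; last by lia.
    have /andP[_ h] := @time_bounds i.+1 ltac:(lia); lra.
  have ei : i = N by lia.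
  rewrite ei edge_end_last in l2.
  have tt : t - 1 \in ts by apply/mem_ts; split=> //; apply/andP; have /andP[_ h] := @time_bounds 1 ltac:(lia); split; lra.
  set z := t - 1 in tt.
  have zN : (index z ts < N)%N by rewrite index_mem.
  have ez : z = time (index z ts).+1 by rewrite /time nth_index.
  have [e|ne] := eqVneq (index z ts) 0%N.
    by rewrite e in ez; move: l2; rewrite -ez /z; lra.
  have := @time_lt 1 (index z ts).+1 isT ltac:(lia) zN; rewrite -ez /z; lra.
by case: base; apply: (passage_shift K t0 1).1; rewrite -e.
Qed.

Lemma mid_bounds i : (1 <= i <= N)%N -> time i < mid i < edge_end i.
Proof. by move=> /edge_nonempty h; rewrite /mid; apply/andP; split; lra. Qed.

Lemma order_ts : (order A).*2 = N.
Proof.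
by have [_ <-] := labelled_numbered (based_labelled base sts mem_ts mem_A).
Qed.

Section Sides.
Variable kappa : R -> R -> bool.
Hypothesis kappa_const : forall x y, off_curve X Y x y -> exists2 r : R, 0 < r &
  forall x' y', `|x' - x| < r -> `|y' - y| < r -> kappa x' y' = kappa x y.

Let cX := diagram_continuous.1.
Let cY := diagram_continuous.2.
Let pX := cx_periodic K.
Let pY := cy_periodic K.

Lemma edge_side i r u v c : (1 <= i <= N)%N -> is_unit_sign r ->
  time i < u < edge_end i -> time i < v < edge_end i ->
  side X Y kappa r u c -> side X Y kappa r v c.
Proof.
move=> iN rs /andP[u1 u2] /andP[v1 v2] su.
have np a b : time i < a -> b < edge_end i -> forall t, a <= t <= b -> ~ passage X Y t.
  move=> a1 b2 t /andP[t1 t2]; apply: (edge_nonpassage iN).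
  by rewrite (lt_le_trans a1 t1) (le_lt_trans t2 b2).
have [uv|vu] := leP u v.
  exact: (side_interval cX cY pX pY diagram_pushable kappa_const rs uv (np _ _ u1 v2) su).
have npv := np _ _ v1 u2; have vv : v <= v <= u by rewrite lexx ltW.
have [c' sv] := side_exists cX cY pX pY diagram_pushable kappa_const rs (npv v vv).
have su' := side_interval cX cY pX pY diagram_pushable kappa_const rs (ltW vu) npv sv.
by rewrite (side_unique diagram_pushable rs su su').
Qed.

(** The arc that leaves the passage x forwards (r = 1) or backwards (r = -1). *)
Definition corner_arc (x : nat) (r : R) : nat := if r == 1 then x else prev_label A x.

(** Sides do not change along an arc, so they may be read at its middle. *)
Lemma corner_arc_side x r : (1 <= x <= N)%N -> is_unit_sign r ->
  exists2 d : R, 0 < d & forall h, 0 < h < d -> ~ passage X Y (time x + r * h) /\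
    forall r' c, is_unit_sign r' ->
      side X Y kappa r' (mid (corner_arc x r)) c <-> side X Y kappa r' (time x + r * h) c.
Proof.
move=> xN rs.
have [i [k [iN ei gap]]] : exists i (k : int), [/\ (1 <= i <= N)%N, corner_arc x r = i &
    exists2 d : R, 0 < d & forall h, 0 < h < d -> time i < time x + r * h + k%:~R < edge_end i].
  rewrite /corner_arc; case: rs => ->; rewrite ?eqxx.
    exists x, 0; split=> //; exists (edge_end x - time x).
      by rewrite subr_gt0 edge_nonempty.
    by move=> h /andP[h0 h1]; rewrite mul1r addr0; apply/andP; split; lra.
  rewrite (_ : (-1 == 1 :> R) = false); last by apply/eqP; lra.
  have pb : (1 <= prev_label A x <= N)%N by rewrite -order_ts; apply: prev_bounds; rewrite order_ts.
  have gp := edge_nonempty pb; have pE := prevE (A := A) (x := x); rewrite order_ts in pE.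
  have {}pE := pE xN; have [x1|x1] := eqVneq x 1%N.
    exists (prev_label A x), 1; split=> //; exists (edge_end (prev_label A x) - time (prev_label A x)).
      by rewrite subr_gt0.
    have en : edge_end (prev_label A x) = time x + 1 by rewrite pE x1 eqxx edge_end_last.
    by move=> h /andP[h0 h1]; rewrite mulN1r; apply/andP; split; lra.
  exists (prev_label A x), 0; split=> //; exists (edge_end (prev_label A x) - time (prev_label A x)).
    by rewrite subr_gt0.
  have en : edge_end (prev_label A x) = time x.
    by rewrite pE (negbTE x1) edge_end_lt ?prednK //; lia.
  by move=> h /andP[h0 h1]; rewrite mulN1r addr0; apply/andP; split; lra.
have [d d0 gap'] := gap; exists d => // h hd; have g := gap' h hd; split.
  by move=> /(passage_shift K _ k).2; apply: edge_nonpassage iN g.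
move=> r' c rs'; rewrite ei; have m := mid_bounds iN; split=> s.
  have s' := edge_side iN rs' m g s; have := side_period pX pY (- k) s'.
  by rewrite mulrNz addrK.
by apply: (edge_side iN rs' g m); apply: side_period.
Qed.

(** The phi-cycle of f runs along a face that is on the left of f for phi =
    alpha, on the right for phi = delta; arcs - e_i exchange the sides of e_i. *)
Definition face_color (phi : orientation) (f : main_arc) : bool :=
  `[< side X Y kappa ((or_sign phi * f.2)%:~R) (mid f.1) true >].

Lemma sign_unit (e : int) : is_sign e -> is_unit_sign (e%:~R : R).
Proof. by move=> [->|->]; [left|right; rewrite mulrNz]. Qed.

Lemma sign_mul (e e' : int) : is_sign e -> is_sign e' -> is_sign (e * e')%R.
Proof. by move=> [->|->] [->|->]; [left|right|right|left]. Qed.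

Lemma face_colorP phi (f : main_arc) c : is_sign f.2 ->
  side X Y kappa ((or_sign phi * f.2)%:~R) (mid f.1) c -> face_color phi f = c.
Proof.
move=> fs s; have rs := sign_unit (sign_mul (or_sign_is phi) fs).
apply/asboolP/idP => [s'|ct]; last by rewrite -ct in s *.
by rewrite (side_unique diagram_pushable rs s s').
Qed.

Lemma face_color_side phi (f : main_arc) : is_main_arc A f ->
  side X Y kappa ((or_sign phi * f.2)%:~R) (mid f.1) (face_color phi f).
Proof.
move=> [fb fs]; have rs := sign_unit (sign_mul (or_sign_is phi) fs).
have iN : (1 <= f.1 <= N)%N by rewrite -order_ts.
have np := edge_nonpassage iN (mid_bounds iN).
have [c s] := side_exists cX cY pX pY diagram_pushable kappa_const rs np.
by rewrite (face_colorP fs s).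
Qed.

(** The arc f arrives at the passage x and leaves by the half-strand that
    bounds, together with f, a sector on the side of phi; the colour of this
    sector is seen by both arcs. *)
Lemma face_color_turn phi f : is_main_arc A f ->
  face_color phi (turn A phi f) = face_color phi f.
Proof.
move=> mf; have [nA _] := labelled_numbered (based_labelled base sts mem_ts mem_A).
have xN := last_end_bounds mf; set x := last_end A f in xN.
have [c cA xc] := label_crossing nA xN; rewrite order_ts in xN.
(* a and b are the times of the two passages, a that of the arriving strand. *)
have [a [b [y [tta ttb yN [ab lxy ss]]]]] : exists a b y, [/\ a = time x, b = time y, (1 <= y <= N)%N &
    [/\ double X Y a b, links c x y & strand_sign c x = if 0 < det X Y a b then 1 else -1]].
  have [s [t [ss tt d us cE]]] := (mem_A c).1 cA.
  have es : time (index s ts).+1 = s by rewrite /time nth_index.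
  have et : time (index t ts).+1 = t by rewrite /time nth_index.
  have is_ : ((index s ts).+1 <= N)%N by rewrite index_mem.
  have it : ((index t ts).+1 <= N)%N by rewrite index_mem.
  have ne : (index s ts).+1 != (index t ts).+1 by have := over_neq_under nA cA; rewrite cE.
  move: xc; rewrite /has_label cE /over /under /= => /orP[] /eqP ex.
    exists s, t, (index t ts).+1; rewrite -ex es et; split=> //; split=> //.
      by rewrite /links /= !eqxx.
    by rewrite /strand_sign /over /sign /= eqxx.
  exists t, s, (index s ts).+1; rewrite -ex es et; split=> //; split=> //; first exact: double_sym.
    by rewrite /links /= !eqxx orbT.
  rewrite /strand_sign /over /sign /= (negbTE ne).
  have -> : det X Y t s = - det X Y s t by rewrite /det; ring.
  have [_ _ _ _ nz] := transverse d; rewrite oppr_gt0.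
  by case: (ltgtP (det X Y s t) 0) nz => // ->; rewrite eqxx.
pose D : int := strand_sign c x.
have Ds : is_sign D by rewrite /D ss; case: ifP; [left|right].
have [e e0 st] := diagram_strictly_transverse ab.
have DE : (if 0 < det X Y a b then 1 else - 1) = D%:~R :> R.
  by rewrite /D ss; case: ifP; rewrite ?mulrNz.
rewrite DE in st.
have [h0 h00 corner] := corner_sides cX cY pX pY diagram_pushable (@double_points _ _ K)
  kappa_const ab e0 st (sign_unit Ds).
have fs : is_sign f.2 by case: mf.
pose r1 : int := (- f.2)%R; have r1s : is_sign r1 by rewrite /r1; case: fs => ->; [right|left].
pose r2 : int := (D * (or_sign phi * f.2))%R.
have r0s := sign_mul (or_sign_is phi) fs.
have r2s : is_sign r2 by apply: sign_mul.
have arcf : corner_arc x r1%:~R = f.1.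
  rewrite /corner_arc /r1 /x; case: (f) mf => i u [/= ib [->|->]]; rewrite ?mulrNz ?opprK ?eqxx //.
  by rewrite (_ : (-1 == 1 :> R) = false); [apply: prev_next|apply/eqP; lra].
have [d1 d10 k1] := corner_arc_side xN (sign_unit r1s).
have [d2 d20 k2] := corner_arc_side yN (sign_unit r2s).
pose h := Num.min h0 (Num.min d1 d2) / 2.
have m0 : 0 < Num.min h0 (Num.min d1 d2) by rewrite !lt_min h00 d10.
have hp : 0 < h by rewrite divr_gt0.
have : h < Num.min h0 (Num.min d1 d2) by rewrite /h; lra.
rewrite !lt_min => /and3P[hh0 hd1 hd2].
have [np1 {}k1] := k1 h ltac:(by rewrite hp). have [np2 {}k2] := k2 h ltac:(by rewrite hp).
have := face_color_side phi mf; rewrite -arcf => /(k1 _ _ (sign_unit r0s)) sf.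
rewrite -tta -ttb in sf np2 k2.
have DD (z : int) : (D * (D * z))%R = z by case: Ds => ->; rewrite ?mul1r // !mulN1r opprK.
have := corner r1%:~R r2%:~R h h (face_color phi f) (sign_unit r1s) (sign_unit r2s)
  ltac:(by rewrite hp) ltac:(by rewrite hp) np2.
rewrite -intrM /r2 DD => /(_ sf).
rewrite -mulrNz -intrM (_ : (- D * r1 = D * f.2)%R) -/r2; last by rewrite /r1 mulrNN.
have Dfs := sign_mul Ds fs.
move=> /(k2 _ _ (sign_unit Dfs)) st'.
have tE : turn A phi f = if (or_sign phi * f.2 * D == 1)%R then (y, 1%R) else (prev_label A y, (-1)%R).
  exact: turn_links.
have r2E : r2 = (or_sign phi * f.2 * D)%R by rewrite /r2 mulrC.
rewrite tE; case: ifPn => cond; apply: face_colorP; rewrite /=; try by [left|right].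
  move: st'; rewrite /corner_arc r2E (eqP cond) mulr1z eqxx mulr1.
  suff -> : (D * f.2)%R = or_sign phi by [].
  move: (cond); by case: Ds fs (or_sign_is phi) => -> [] -> [] ->.
have c2 : (or_sign phi * f.2 * D)%R = (-1)%R.
  move: cond; by case: Ds fs (or_sign_is phi) => -> [] -> [] ->.
move: st'; rewrite /corner_arc r2E c2 mulrNz mulr1z (_ : (-1 == 1 :> R) = false); last by apply/eqP; lra.
suff -> : (D * f.2)%R = (or_sign phi * -1)%R by [].
by move: c2; case: Ds fs (or_sign_is phi) => -> [] -> [] ->.
Qed.
End Sides.

Lemma links_double c x y : c \in A -> links c x y -> double X Y (time x) (time y).
Proof.
move=> cA lxy; have [s [t [ss tt d us cE]]] := (mem_A c).1 cA.
have es : time (index s ts).+1 = s by rewrite /time nth_index.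
have et : time (index t ts).+1 = t by rewrite /time nth_index.
move: lxy; rewrite /links cE /over /under /= => /orP[] /andP[/eqP <- /eqP <-]; rewrite es et //.
exact: double_sym.
Qed.

(** The loop of K between the two passages of c passes exactly once through
    the middle of e_i, which is not a crossing, so the colours on the two
    sides of e_i differ. An arc outside of [p, q) does not meet the loop, and
    both its sides have the colour of its middle point. *)
Lemma subloop_coloring phi c p q i : c \in A -> links c p q -> (p < q)%N -> (p <= i < q)%N ->
  exists om : main_arc -> bool,
    [/\ forall f, is_main_arc A f -> om (turn A phi f) = om f,
        om (i, 1%R) != om (i, (-1)%R) &
        forall j, basic_arc A j -> ~~ (p <= j < q)%N -> om (j, 1%R) = om (j, (-1)%R)].
Proof.
move=> cA lpq pq /andP[pi iq].
have [nA _] := labelled_numbered (based_labelled base sts mem_ts mem_A).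
have [cp cq] := links_has lpq.
have pN := label_bounds nA cA cp; have qN := label_bounds nA cA cq; rewrite order_ts in pN qN.
have [_ Xpq Ypq] := links_double cA lpq.
have [cX cY] := diagram_continuous.
have [p1 pN2] := andP pN; have [q1 qN2] := andP qN.
have i1 := leq_trans p1 pi; have iN' : (i < N)%N := leq_trans iq qN2.
have iN : (1 <= i <= N)%N by rewrite i1 ltnW.
have tpq : time p < time q by apply: time_lt.
have /andP[tp0 tp1] := time_bounds pN. have /andP[tq0 tq1] := time_bounds qN.
have time_le x y : (1 <= x)%N -> (x <= y)%N -> (y <= N)%N -> time x <= time y.
  move=> x1; rewrite leq_eqVlt => /orP[/eqP -> //|xy] yN; exact/ltW/time_lt.
have /andP[m1 m2] := mid_bounds iN; have npi := edge_nonpassage iN (mid_bounds iN).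
have tpi : time p <= time i by apply: time_le => //; apply: ltnW.
have eiq : edge_end i <= time q by rewrite edge_end_lt ?i1 //; apply: time_le.
have [e [wx [wy [e0 pw]]]] := diagram_pushable (mid i).
have simple t : time p <= t <= time q -> X t = X (mid i) -> Y t = Y (mid i) -> t = mid i.
  move=> /andP[l1 l2] Xt Yt; apply: contrapT => ne; apply: npi; exists t; split=> // sp.
  have [l|l|//] := ltgtP t (mid i).
    by apply: (@not_same_param R t (mid i)) => //; apply/andP; split; lra.
  apply: (@not_same_param R (mid i) t); first by apply/andP; split; lra.
  by case: sp => k hk; exists (- k); rewrite mulrNz -hk opprB.
have [kappa [kloop flip]] := loop_coloring cX cY tpq Xpq Ypq
  (le_lt_trans tpi m1) (lt_le_trans m2 eiq) e0 pw simple.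
have kappa_const x y : off_curve X Y x y -> exists2 r : R, 0 < r &
    forall x' y', `|x' - x| < r -> `|y' - y| < r -> kappa x' y' = kappa x y.
  by move=> off; apply: kloop => t _; apply: off.
have iA e' : is_sign e' -> is_main_arc A (i, e') by move=> es; split; rewrite //= /basic_arc order_ts.
exists (face_color kappa phi); split.
- by move=> f; apply: face_color_turn.
- have := face_color_side kappa_const phi (iA 1%R (or_introl erefl)).
  have := face_color_side kappa_const phi (iA (-1)%R (or_intror erefl)).
  case: phi => /= s1 s2; first exact: flip s2 s1.
  by rewrite eq_sym; apply: flip s1 s2.
move=> j jA npq; have jN : (1 <= j <= N)%N by rewrite -order_ts.
have [jN1 jN2] := andP jN.
have /andP[l1 l2] := mid_bounds jN.
have off t : time p <= t <= time q -> X t = X (mid j) -> Y t = Y (mid j) -> False.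
  move=> /andP[t1 t2] Xt Yt.
  apply: (edge_nonpassage jN (mid_bounds jN)); exists t; split=> // sp.
  move: npq; rewrite negb_and -ltnNge -leqNgt => /orP[jp|qj].
    have ejp : edge_end j <= time p by rewrite edge_end_lt ?jN1 ?(leq_trans jp pN2) //; apply: time_le.
    have /andP[j0 j1] := time_bounds jN.
    apply: (@not_same_param R (mid j) t); first by apply/andP; split; lra.
    by case: sp => k hk; exists (- k); rewrite mulrNz -hk opprB.
  have tqj : time q <= time j by apply: time_le.
  have ej : edge_end j <= time p + 1.
    have t1p : time 1 <= time p by apply: time_le.
    have [jl|jl] := ltnP j N; last first.
      have -> : j = N by apply/eqP; rewrite eqn_leq jN2 jl.
      by rewrite edge_end_last lerD2r.
    rewrite edge_end_lt ?jN1 //; have /andP[_ h] := time_bounds (jl : (1 <= j.+1 <= N)%N).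
    have /andP[h1 _] := time_bounds (leq_trans jN1 jN2 : (1 <= 1 <= N)%N); lra.
  by apply: (@not_same_param R t (mid j)) => //; apply/andP; split; lra.
have [r r0 hr] := kloop _ _ off.
have col r' : side X Y kappa r' (mid j) (kappa (X (mid j)) (Y (mid j))).
  by move=> e' e'0; exists r => // x y hx hy _; apply: hr; rewrite addrAC subrr add0r.
by rewrite (face_colorP (f := (j, 1%R)) _ (col _)) ?(face_colorP (f := (j, (-1)%R)) _ (col _)) //;
  [right|left].
Qed.

End Coloring.

Section Diagrams.
Variables (R : realType) (C : category).

Lemma Sigma_D_numbered A : Sigma_D R C A -> numbered A.
Proof.
move=> [K [t0 [base [ts [sts mem_ts mem_A]]]]].
by have [] := labelled_numbered (based_labelled base sts mem_ts mem_A).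
Qed.

(** Moving the base point past one passage rotates by 2n - 1, which is -1
    modulo 2n; its iterates are all the rotations. *)
Lemma Sigma_D_shift A k : Sigma_D R C A -> Sigma_D R C (relabel (shift (order A).*2 k) A).
Proof.
move=> sA; pose N := (order A).*2.
have step j B : Sigma_D R C B -> order B = order A -> j = N.-1 ->
    Sigma_D R C (relabel (shift N j) B).
  move=> sB oB ->; have nB := Sigma_D_numbered sB.
  have [n0|n0] := eqVneq (order A) 0%N.
    rewrite relabel_id // => c x cB xc; have := label_bounds nB cB xc.
    by rewrite oB n0; case: x {xc}.
  case: (sB) => K [t0 [base [ts [sts mem_ts mem_B]]]].
  have [_ e] := labelled_numbered (based_labelled base sts mem_ts mem_B).
  have -> : N = size ts by rewrite e oB.
  apply: (rotate_one base sts mem_ts mem_B).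
  by rewrite e oB -addnn; move: n0; case: (order A) => // n _; rewrite addSn addnS.
have it j : Sigma_D R C (relabel (shift N (j * N.-1)) A) /\
    order (relabel (shift N (j * N.-1)) A) = order A.
  elim: j => [|j [sj oj]].
    by rewrite mul0n; split; [rewrite relabel_id // => c x cA xc; apply: shift0; apply: label_bounds xc; first exact: Sigma_D_numbered|have [] := shift_numbered 0 (Sigma_D_numbered sA)].
  have -> : relabel (shift N (j.+1 * N.-1)) A = relabel (shift N N.-1) (relabel (shift N (j * N.-1)) A).
    by rewrite relabel_comp; apply: eq_relabel => c x _ _ /=; rewrite shift_shift mulSn.
  split; first exact: step.
  by have [_] := shift_numbered N.-1 (Sigma_D_numbered sj); rewrite oj.
have [n0|N0] := posnP N.
  rewrite relabel_id // => c x cA xc; have := label_bounds (Sigma_D_numbered sA) cA xc.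
  by rewrite -/N n0; case: x {xc}.
have -> : relabel (shift (order A).*2 k) A = relabel (shift N (k * N.-1 * N.-1)) A.
  apply: eq_relabel => c x cA xc; have xN := label_bounds (Sigma_D_numbered sA) cA xc.
  have -> : (k * N.-1 * N.-1 = k + (k * (N - 2)) * N)%N.
    by move: (N0); rewrite -/N /N; case: (order A) => // n _; rewrite doubleS /=; nia.
  by rewrite -shift_shift shift_mult.
by have [] := it (k * N.-1)%N.
Qed.
End Diagrams.

Theorem lemma28 (R : realType) (C : category) :
  Equivalence (fun A A' : {A : symbol | Sigma_D R C A} =>
                 sim_al R C (proj1_sig A) (proj1_sig A')).
Proof.
have num := @Sigma_D_numbered R C; have rot := @Sigma_D_shift R C.
have color A c p q i phi : Sigma_D R C A -> c \in A -> links c p q -> (p < q)%N ->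
    (p <= i < q)%N -> exists om : main_arc -> bool,
    [/\ forall f, is_main_arc A f -> om (turn A phi f) = om f,
        om (i, 1%R) != om (i, (-1)%R) &
        forall j, basic_arc A j -> ~~ (p <= j < q)%N -> om (j, 1%R) = om (j, (-1)%R)].
  move=> [K [t0 [base [ts [sts mem_ts mem_A]]]]].
  exact: (subloop_coloring base sts mem_ts mem_A).
have inverse A A' : Sigma_D R C A -> Sigma_D R C A' -> alg_move A A' -> sim (Sigma_D R C) A' A.
  move=> sA sA' [mv|[mv|[mv|[mv|[mv|[mv|mv]]]]]].
  - by apply: sim_move => //; left; apply: Omega_beta_inverse => //; apply: num.
  - by rewrite mv; apply: sim_refl.
  - by apply: sim_move => //; do 3 right; left; apply: Omega1p_inverse => //; apply: num.
  - exact: (Omega1m_inverse num rot).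
  - by apply: sim_move => //; do 5 right; left; apply: Omega2p_inverse => //; apply: num.
  - exact: (Omega2m_inverse num rot color).
  by apply: sim_move => //; do 6 right; apply: Omega3_inverse => //; apply: num.
split.
- by move=> [A sA]; apply: (@sim_refl (Sigma_D R C)).
- move=> [A sA] [A' sA'] [k [S [/= S0 Sk PS mS]]]; rewrite /= -S0 -Sk.
  have back n : (n <= k)%N -> sim (Sigma_D R C) (S n) (S 0%N).
    elim: n => [|n IH] nk; first exact/sim_refl/PS.
    by apply: sim_trans (IH (ltnW nk)); apply: inverse (mS n nk); apply: PS => //; apply: ltnW.
  exact: back (leqnn k).
by move=> A A' A''; apply: sim_trans.
Qed.
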